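(* Let $R$ be a vertex Lie algebra over $\mathbb{C}$ and let $\mathcal{V}(R)$ be the associated vertex algebra. Let $E=\{E_n\}$ be the sequence defined by $$E_n=\mathrm{span}\{a^{(1)}(-1)\cdots a^{(r)}(-1)\mathbf{1}\mid 0\le r\le n,\ a^{(i)}\in R\}$$ (so $E_n=0$ for $n<0$). Then $E$ is a good filtration of $\mathcal{V}(R)$ and each $E_n$ is an $\mathcal{L}(R)_+$-submodule of $\mathcal{V}(R)$. Furthermore, the linear map $$\psi:S(R)\to\mathrm{gr}_E\mathcal{V}(R),\qquad u^{(1)}\cdots u^{(n)}\mapsto u^{(1)}(-1)\cdots u^{(n)}(-1)\mathbf{1}+E_{n-1}\quad(u^{(i)}\in R)$$ is a vertex-Poisson-algebra isomorphism, and $\psi$ is an $\mathcal{L}(R)_+$-module isomorphism.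
   Context: Vertex algebra: a vector space $V$ over $\mathbb{C}$ with a linear map $Y:V\to\mathrm{Hom}(V,V((x)))$, $v\mapsto Y(v,x)=\sum_{n\in\mathbb{Z}}v_nx^{-n-1}$, and a vector $\mathbf{1}\in V$ such that $Y(\mathbf{1},x)=\mathrm{id}$; $Y(v,x)\mathbf{1}\in V[[x]]$ with $v_{-1}\mathbf{1}=v$; and for $u,v\in V$ the Jacobi identity holds: $$x_0^{-1}\delta\left(\tfrac{x_1-x_2}{x_0}\right)Y(u,x_1)Y(v,x_2)-x_0^{-1}\delta\left(\tfrac{x_2-x_1}{-x_0}\right)Y(v,x_2)Y(u,x_1)=x_2^{-1}\delta\left(\tfrac{x_1-x_0}{x_2}\right)Y(Y(u,x_0)v,x_2),$$ where $\delta(x)=\sum_{n\in\mathbb{Z}}x^n$ and powers of binomials are expanded in nonnegative powers of the second variable. Put $\mathcal{D}v=v_{-2}\mathbf{1}$. Vertex Lie algebra: a vector space $R$ with a linear operator $\partial$ and bilinear products $(a,b)\mapsto a_nb$ ($n\in\mathbb{N}=\{0,1,2,\dots\}$) such that for $a,b,c\in R$, $m,n\in\mathbb{N}$: (C0) $a_nb=0$ for $n$ sufficiently large; (C1) $(\partial a)_nb=-n\,a_{n-1}b$ (which is $0$ for $n=0$); (C2) $a_nb=\sum_{i\ge0}(-1)^{n+i+1}\frac{1}{i!}\partial^i(b_{n+i}a)$; (C3) $a_mb_nc-b_na_mc=\sum_{i=0}^m\binom{m}{i}(a_ib)_{m+n-i}c$. One writes $Y_-(a,x)=\sum_{n\ge0}a_nx^{-n-1}$.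 Vertex Poisson algebra: a unital commutative associative algebra $A$ with a derivation $\partial$ and a vertex Lie algebra structure $(Y_-,\partial)$ (same $\partial$) such that each $a_n$ ($a\in A$, $n\ge0$) is a derivation of $A$. A vertex-Poisson-algebra isomorphism is a bijective algebra homomorphism $f$ with $f\partial=\partial f$ and $f(a_nb)=f(a)_nf(b)$ for $n\ge0$. Associated Lie algebra: $\mathcal{L}(R)=(R\otimes\mathbb{C}[t,t^{-1}])/\hat\partial(R\otimes\mathbb{C}[t,t^{-1}])$, $\hat\partial=\partial\otimes1+1\otimes\frac{d}{dt}$; with $a(n)$ the image of $a\otimes t^n$, $[a(m),b(n)]=\sum_{i\ge0}\binom{m}{i}(a_ib)(m+n-i)$. $\mathcal{L}(R)_+$ is the subalgebra spanned by the $a(n)$, $n\ge0$. $\mathcal{V}(R)=U(\mathcal{L}(R))\otimes_{U(\mathcal{L}(R)_+)}\mathbb{C}$ ($\mathbb{C}$ trivial), $\mathbf{1}=1\otimes1$; $R$ embeds in $\mathcal{V}(R)$ via $a\mapsto a(-1)\mathbf{1}$, and $\mathcal{V}(R)$ has a unique vertex algebra structure with vacuum $\mathbf{1}$ and $Y(a,x)=\sum_{n\in\mathbb{Z}}a(n)x^{-n-1}$ for $a\in R$. $R$ is an $\mathcal{L}(R)_+$-module with $a(n)$ acting as $a_n$, and $\mathcal{L}(R)_+$ acts on the symmetric algebra $S(R)$ by the induced derivations. $S(R)$ is a vertex Poisson algebra with the unique structure extending $\partial$ and $Y_-$ of $R$. Good filtration of a vertex algebra $V$: an increasing family of subspaces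 $E_n$ ($n\in\mathbb{Z}$) with $\bigcup_nE_n=V$, $\mathbf{1}\in E_0$, and for $u\in E_m$, $v\in E_n$: $u_jv\in E_{m+n}$ for $j<0$, $u_jv\in E_{m+n-1}$ for $j\ge0$. Then $\mathrm{gr}_EV=\coprod_nE_n/E_{n-1}$ is a vertex Poisson algebra with, for $u\in E_m$, $v\in E_n$, $i\ge0$: $(u+E_{m-1})(v+E_{n-1})=u_{-1}v+E_{m+n-1}$, $\partial(u+E_{m-1})=\mathcal{D}u+E_{m-1}$, $(u+E_{m-1})_i(v+E_{n-1})=u_iv+E_{m+n-2}$. The $\mathcal{L}(R)_+$-module structure on $\mathrm{gr}_E\mathcal{V}(R)$ is the one induced from $\mathcal{V}(R)$ on the quotients $E_n/E_{n-1}$. *)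

(* Defs.v *)
From HB Require Import structures.
From mathcomp Require Import all_boot generic_quotient.
From mathcomp Require Import order ssralg ssrnum ssrint ring_quotient.
From mathcomp Require Import finmap.
From mathcomp Require Import boolp classical_sets functions cardinality fsbigop.
From mathcomp Require Import reals complex.
From mathcomp.multinomials Require Import monalg.

Set Implicit Arguments.
Unset Strict Implicit.
Unset Printing Implicit Defensive.

Import GRing.Theory.
Local Open Scope ring_scope.
Local Open Scope classical_set_scope.
Local Open Scope quotient_scope.

Record subspace (F : fieldType) (V : lmodType F) := Subspace {
  subspace_pred :> {pred V};
  subspace_closed : GRing.subsemimod_closed subspace_pred
}.

HB.instance Definition _ (F : fieldType) (V : lmodType F) (S : subspace V) :=
  GRing.isSubmodClosed.Build F V (subspace_pred S) (subspace_closed S).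

Section Span.
Context (F : fieldType) (V : lmodType F).

Definition span_pred (X : set V) : {pred V} := fun v =>
  `[< exists2 s : seq (F * V), (forall p, p \in s -> X p.2)
        & v = \sum_(p <- s) p.1 *: p.2 >].

Lemma span_closed X : GRing.subsemimod_closed (span_pred X).
Proof.
split; [split=> [|u v] | move=> c u].
- by apply/asboolP; exists [::]; rewrite ?big_nil.
- move=> /asboolP[s sX ->] /asboolP[t tX ->]; apply/asboolP; exists (s ++ t).
    by move=> p; rewrite mem_cat => /orP[/sX|/tX].
  by rewrite big_cat.
- move=> /asboolP[s sX ->]; apply/asboolP.
  exists [seq (c * p.1, p.2) | p <- s]; first by move=> _ /mapP[p /sX + ->].
  rewrite big_map scaler_sumr; apply: eq_bigr => p _ /=; by rewrite scalerA.
Qed.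

Definition span (X : set V) : subspace V := Subspace (span_closed X).

Lemma mem_span (X : set V) v : X v -> v \in span X.
Proof.
move=> Xv; apply/asboolP; exists [:: (1, v)]; last by rewrite big_seq1 scale1r.
by move=> p; rewrite inE => /eqP->.
Qed.

End Span.

Section SubspaceType.
Context (F : fieldType) (V : lmodType F) (S : subspace V).

Definition subsp := {v : V | v \in S}.
HB.instance Definition _ := [isSub of subsp for @sval V (fun v => v \in S)].
HB.instance Definition _ := [Choice of subsp by <:].
HB.instance Definition _ := [SubChoice_isSubZmodule of subsp by <:].
HB.instance Definition _ :=
  GRing.SubZmodule_isSubLmodule.Build F V (fun v => v \in S) subsp
    (subspace_closed S).

End SubspaceType.

Section QuotientSpace.
Context (F : fieldType) (V : lmodType F) (S : subspace V).

Definition quotsp := Quotient.quot (subspace_pred S).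
HB.instance Definition _ := Choice.on quotsp.
HB.instance Definition _ := EqQuotient.on quotsp.
HB.instance Definition _ := GRing.Zmodule.on quotsp.
HB.instance Definition _ := ZmodQuotient.on quotsp.

Definition qclass (v : V) : quotsp := \pi v.

Lemma qclass_repr x : qclass (repr x) = x.
Proof. exact: reprK. Qed.

Lemma qclassP u v : reflect (qclass u = qclass v) (u - v \in S).
Proof. by rewrite Quotient.idealrBE; apply: eqP. Qed.

Lemma qclassD u v : qclass u + qclass v = qclass (u + v).
Proof. by rewrite /qclass [in RHS]raddfD. Qed.

Definition qscale (c : F) (x : quotsp) : quotsp := qclass (c *: repr x).

Lemma qclassZ c v : qscale c (qclass v) = qclass (c *: v).
Proof. by apply/qclassP; rewrite -scalerBr rpredZ //; apply/qclassP/qclass_repr. Qed.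

Let qscaleA a b x : qscale a (qscale b x) = qscale (a * b) x.
Proof. by rewrite -[x]qclass_repr (qclassZ b) !qclassZ scalerA. Qed.

Let qscale1 : left_id 1 qscale.
Proof. by move=> x; rewrite -[x in LHS]qclass_repr qclassZ scale1r qclass_repr. Qed.

Let qscaleDr : right_distributive qscale +%R.
Proof.
move=> a x y; rewrite -[x]qclass_repr -[y]qclass_repr.
by rewrite qclassD !qclassZ qclassD scalerDr.
Qed.

Let qscaleDl x : {morph qscale^~ x : a b / a + b}.
Proof. by move=> a b; rewrite -[x]qclass_repr !qclassZ qclassD scalerDl. Qed.

HB.instance Definition _ :=
  GRing.Zmodule_isLmodule.Build F quotsp qscaleA qscale1 qscaleDr qscaleDl.

End QuotientSpace.

Section DirectSum.
Context (F : fieldType) (I : choiceType) (M : I -> lmodType F).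

Definition dprod := forall i, M i.
HB.instance Definition _ := Choice.on dprod.

Let dadd (f g : dprod) : dprod := fun i => f i + g i.
Let dopp (f : dprod) : dprod := fun i => - f i.
Let dscale (c : F) (f : dprod) : dprod := fun i => c *: f i.

Let daddA : associative dadd.
Proof. by move=> f g h; apply: functional_extensionality_dep => i; exact: addrA. Qed.
Let daddC : commutative dadd.
Proof. by move=> f g; apply: functional_extensionality_dep => i; exact: addrC. Qed.
Let dadd0 : left_id (fun=> 0) dadd.
Proof. by move=> f; apply: functional_extensionality_dep => i; exact: add0r. Qed.
Let daddN : left_inverse (fun=> 0) dopp dadd.
Proof. by move=> f; apply: functional_extensionality_dep => i; exact: addNr. Qed.
HB.instance Definition _ := GRing.isZmodule.Build dprod daddA daddC dadd0 daddN.

Let dscaleA a b f : dscale a (dscale b f) = dscale (a * b) f.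
Proof. by apply: functional_extensionality_dep => i; exact: scalerA. Qed.
Let dscale1 : left_id 1 dscale.
Proof. by move=> f; apply: functional_extensionality_dep => i; exact: scale1r. Qed.
Let dscaleDr : right_distributive dscale +%R.
Proof. by move=> a f g; apply: functional_extensionality_dep => i; exact: scalerDr. Qed.
Let dscaleDl f : {morph dscale^~ f : a b / a + b}.
Proof. by move=> a b; apply: functional_extensionality_dep => i; exact: scalerDl. Qed.
HB.instance Definition _ :=
  GRing.Zmodule_isLmodule.Build F dprod dscaleA dscale1 dscaleDr dscaleDl.

Definition finsupp_pred : {pred dprod} :=
  fun f => `[< finite_set [set i | f i != 0] >].

Lemma finsupp_closed : GRing.subsemimod_closed finsupp_pred.
Proof.
split; [split=> [|f g] | move=> c f].
- apply/asboolP; rewrite (_ : [set _ | _] = set0) // -subset0 => i /=.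
  by rewrite eqxx.
- move=> /asboolP ff /asboolP fg; apply/asboolP.
  have : finite_set ([set i | f i != 0] `|` [set i | g i != 0]).
    by rewrite finite_setU.
  apply: sub_finite_set => i /= fgi; case: (eqVneq (f i) 0) => [fi0|]; last by left.
  right; apply: contra_neq fgi => gi0.
  by rewrite -[LHS]/(f i + g i) fi0 gi0 addr0.
- move=> /asboolP ff; apply/asboolP; apply: sub_finite_set ff => i /=.
  by apply: contra_neq => fi0; rewrite -[LHS]/(c *: f i) fi0 scaler0.
Qed.

Definition finsupp_sub : subspace dprod := Subspace finsupp_closed.

Definition dsum := subsp finsupp_sub.
HB.instance Definition _ := GRing.Lmodule.on dsum.

Definition dcoef (x : dsum) (i : I) : M i := \val x i.

Definition dsupp (x : dsum) : {fset I} := fset_set [set i | dcoef x i != 0].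

Lemma dfwith_finsupp i (m : M i) :
  (dfwith (fun j => 0 : M j) m : dprod) \in finsupp_sub.
Proof.
apply/asboolP; apply: (@sub_finite_set _ _ [set i]) => // j /=.
by apply: contra_neqP => /eqP ji; rewrite dfwith_out // eq_sym.
Qed.

Definition dinj i (m : M i) : dsum := Sub (dfwith _ m : dprod) (dfwith_finsupp m).

End DirectSum.

Lemma malg_scaleAr (F : fieldType) (K : monomType) (c : F) (g h : {malg F[K]}) :
  c *: (g * h) = g * (c *: h).
Proof.
have cC u : c%:MP * u = u * c%:MP :> {malg F[K]}.
  rewrite !malgM_def fgmulUg fgmulgU; apply: eq_bigr => k _.
  by rewrite mul1m mulm1 mulrC.
by rewrite -!mul_malgC mulrA cC -mulrA.
Qed.

Section Enveloping.
Context (F : fieldType) (L : lmodType F) (br : L -> L -> L).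

Notation free_alg := {malg F[{fmonom L}]}.

Definition free_gen (x : L) : free_alg := << fmu x >>.

(* U(L) is the free algebra on the set L modulo the two-sided ideal generated by
   these relations; the first two families turn the free algebra into T(L). *)
Variant env_rel : free_alg -> Prop :=
| env_relD x y : env_rel (free_gen (x + y) - (free_gen x + free_gen y))
| env_relZ c x : env_rel (free_gen (c *: x) - c *: free_gen x)
| env_rel_br x y :
    env_rel (free_gen x * free_gen y - free_gen y * free_gen x - free_gen (br x y)).

Definition env_ideal : subspace free_alg :=
  span [set z | exists a r b, env_rel r /\ z = a * r * b].

Lemma env_idealMl a z : z \in env_ideal -> a * z \in env_ideal.
Proof.
move=> /asboolP[s sX ->]; rewrite mulr_sumr big_seq rpred_sum // => p ps.
rewrite -malg_scaleAr; apply/rpredZ/mem_span.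
by have [b [r [c [rr ->]]]] := sX p ps; exists (a * b), r, c; rewrite !mulrA.
Qed.

Lemma env_idealMr a z : z \in env_ideal -> z * a \in env_ideal.
Proof.
move=> /asboolP[s sX ->]; rewrite mulr_suml big_seq rpred_sum // => p ps.
rewrite -scalerAl; apply/rpredZ/mem_span.
by have [b [r [c [rr ->]]]] := sX p ps; exists b, r, (c * a); rewrite !mulrA.
Qed.

Lemma env_ideal_proper : 1 \notin env_ideal.
Proof.
have gen0 x : (free_gen x)@_mone = 0.
  by rewrite mcoeffU -val_eqE /= fm1 fmU.
have rel0 r : env_rel r -> r@_mone = 0.
  case=> [x y|c x|x y].
  - by rewrite mcoeffB mcoeffD !gen0 addr0 subr0.
  - by rewrite mcoeffB mcoeffZ !gen0 mulr0 subr0.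
  - by rewrite !mcoeffB !rmorphM /= !gen0 mulr0 !subr0.
apply/negP => /asboolP[s sX /(congr1 (mcoeff mone))/eqP].
rewrite rmorph1 raddf_sum big_seq big1 ?oner_eq0 // => p ps.
have [a [r [b [rr ->]]]] := sX p ps.
by rewrite /= mcoeffZ !rmorphM /= (rel0 r rr) mulr0 mul0r mulr0.
Qed.

Definition env_alg := quotsp env_ideal.
HB.instance Definition _ := GRing.Lmodule.on env_alg.

Let one : env_alg := qclass env_ideal 1.
Let mul (x y : env_alg) : env_alg := qclass env_ideal (repr x * repr y).

Lemma env_mulE a b :
  mul (qclass env_ideal a) (qclass env_ideal b) = qclass env_ideal (a * b).
Proof.
apply/qclassP; set a' := repr _; set b' := repr _.
have -> : a' * b' - a * b = (a' - a) * b' + a * (b' - b).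
  by rewrite mulrBl mulrBr addrA subrK.
by apply: rpredD; [apply: env_idealMr|apply: env_idealMl];
  apply/qclassP/qclass_repr.
Qed.

Let mulA : associative mul.
Proof.
move=> x y z; rewrite -[x]qclass_repr -[y]qclass_repr -[z]qclass_repr.
rewrite [mul (qclass _ (repr y)) _]env_mulE.
rewrite [mul (qclass _ (repr x)) (qclass _ (repr y))]env_mulE.
by rewrite !env_mulE mulrA.
Qed.
Let mul1 : left_id one mul.
Proof. by move=> x; rewrite -[x in LHS]qclass_repr env_mulE mul1r qclass_repr. Qed.
Let mulr1 : right_id one mul.
Proof. by move=> x; rewrite -[x in LHS]qclass_repr env_mulE mulr1 qclass_repr. Qed.
Let mulDl : left_distributive mul +%R.
Proof.
move=> x y z; rewrite -[x]qclass_repr -[y]qclass_repr -[z]qclass_repr.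
by rewrite qclassD !env_mulE qclassD mulrDl.
Qed.
Let mulDr : right_distributive mul +%R.
Proof.
move=> x y z; rewrite -[x]qclass_repr -[y]qclass_repr -[z]qclass_repr.
by rewrite qclassD !env_mulE qclassD mulrDr.
Qed.
Let one_neq0 : one != 0.
Proof.
apply: contra env_ideal_proper => /eqP one0.
have : one = qclass env_ideal 0 by rewrite one0 /qclass raddf0.
by move/qclassP; rewrite subr0.
Qed.

HB.instance Definition _ :=
  GRing.Zmodule_isNzRing.Build env_alg mulA mul1 mulr1 mulDl mulDr one_neq0.

Lemma env_classZ (c : F) (a : free_alg) :
  c *: (qclass env_ideal a : env_alg) = qclass env_ideal (c *: a).
Proof. exact: qclassZ. Qed.

Lemma env_classM (a b : free_alg) :
  (qclass env_ideal a : env_alg) * (qclass env_ideal b : env_alg)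
  = qclass env_ideal (a * b).
Proof. exact: env_mulE. Qed.

Let scaleAl (c : F) (x y : env_alg) : c *: (x * y) = (c *: x) * y.
Proof.
rewrite -[x]qclass_repr -[y]qclass_repr env_classM !env_classZ env_classM.
by rewrite scalerAl.
Qed.
HB.instance Definition _ := GRing.Lmodule_isLalgebra.Build F env_alg scaleAl.

Let scaleAr (c : F) (x y : env_alg) : c *: (x * y) = x * (c *: y).
Proof.
rewrite -[x]qclass_repr -[y]qclass_repr env_classM !env_classZ env_classM.
by rewrite malg_scaleAr.
Qed.
HB.instance Definition _ := GRing.Lalgebra_isAlgebra.Build F env_alg scaleAr.

Definition env_gen (x : L) : env_alg := qclass env_ideal (free_gen x).

(* The extension of a Lie algebra morphism f : L -> B to U(L); it does not depend
   on the representative when f is linear and f [x, y] = f x f y - f y f x. *)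
Definition env_lift (B : lalgType F) (f : L -> B) (u : env_alg) : B :=
  mmap (fun c : F => c%:A) (fun w : {fmonom L} => \prod_(x <- w) f x) (repr u).

End Enveloping.

(* S(V) = T(V) / (xy - yx), the enveloping algebra of V with zero bracket. *)
Definition sym_alg (F : fieldType) (V : lmodType F) : algType F :=
  env_alg (fun _ _ : V => 0).

(* The tensor product over an algebra A of a right module (M, ract) and a left
   module (N, lact): the vector space on the pairs modulo the usual relations. *)
Section Tensor.
Context (F : fieldType) (A : Type) (M N : lmodType F).
Context (ract : M -> A -> M) (lact : A -> N -> N).

Notation pairs := {malg F[(M * N)%type]}.
Notation pair m n := (<< (m, n) >> : pairs).

Variant tensor_rel : pairs -> Prop :=
| tensor_relDl m m' n : tensor_rel (pair (m + m') n - (pair m n + pair m' n))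
| tensor_relDr m n n' : tensor_rel (pair m (n + n') - (pair m n + pair m n'))
| tensor_relZl c m n : tensor_rel (pair (c *: m) n - c *: pair m n)
| tensor_relZr c m n : tensor_rel (pair m (c *: n) - c *: pair m n)
| tensor_rel_act m a n : tensor_rel (pair (ract m a) n - pair m (lact a n)).

Definition tensor := quotsp (span tensor_rel).
HB.instance Definition _ := GRing.Lmodule.on tensor.

Definition tens (m : M) (n : N) : tensor := qclass (span tensor_rel) (pair m n).

(* [tensor_map f] is m tensor n |-> f m tensor n, for f linear and commuting with
   the right action. *)
Definition tensor_map (f : M -> M) (t : tensor) : tensor :=
  \sum_(p <- msupp (repr t)) (repr t)@_p *: tens (f p.1) p.2.

End Tensor.

Section VertexStructures.
Context (F : fieldType).

(* The coefficient of [x ^ (k - i) * y ^ i] in [(x - y) ^ k], expanded in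
   nonnegative powers of [y]. *)
Definition binz (k : int) (i : nat) : F :=
  (\prod_(j < i) (k - j%:Z)%:~R) / (i`!)%:R.
Definition delta_coef (k : int) (i : nat) : F := (-1) ^+ i * binz k i.

Section VertexAlgebra.
Context (V : lmodType F).

(* [Y u n v] is u_n v.  The field [va_jacobi] is the coefficient of
   x_0^(-l-1) x_1^(-m-1) x_2^(-n-1) in the Jacobi identity applied to w;
   the sums over i are finite by [va_trunc]. *)
Record is_vertex_algebra (Y : V -> int -> V -> V) (vac : V) : Prop := {
  va_linl : forall n v, linear (fun u => Y u n v);
  va_linr : forall u n, linear (Y u n);
  va_trunc : forall u v, exists N : int, forall n, (N <= n)%R -> Y u n v = 0;
  va_vac : forall n v, Y vac n v = if n == -1 then v else 0;
  va_creation : forall v n, (0 <= n)%R -> Y v n vac = 0;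
  va_creation1 : forall v, Y v (-1) vac = v;
  va_jacobi : forall u v w (l m n : int),
    \sum_(i \in [set: nat])
      delta_coef l i *: Y u (m + l - i%:Z) (Y v (n + i%:Z) w)
    - (-1) ^ l *: (\sum_(i \in [set: nat])
      delta_coef l i *: Y v (n + l - i%:Z) (Y u (m + i%:Z) w))
    = \sum_(i \in [set: nat])
      delta_coef (i%:Z - m - 1) i *: Y (Y u (l + i%:Z) v) (m + n - i%:Z) w
}.

End VertexAlgebra.

(* [pr a n b] is a_n b. *)
Record is_vertex_Lie (R : lmodType F) (d : R -> R) (pr : R -> nat -> R -> R)
    : Prop := {
  vl_d_lin : linear d;
  vl_linl : forall n b, linear (fun a => pr a n b);
  vl_linr : forall a n, linear (pr a n);
  vl_C0 : forall a b, exists N, forall n, (N <= n)%N -> pr a n b = 0;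
  vl_C1 : forall a n b, pr (d a) n b = - (n%:R *: pr a n.-1 b);
  vl_C2 : forall a n b,
    pr a n b = \sum_(i \in [set: nat])
      ((-1) ^+ (n + i + 1) / (i`!)%:R) *: iter i d (pr b (n + i)%N a);
  vl_C3 : forall a b c m n,
    pr a m (pr b n c) - pr b n (pr a m c)
    = \sum_(i < m.+1) ('C(m, i))%:R *: pr (pr a i b) (m + n - i)%N c
}.

Record vertexLie := VertexLie {
  vl_sort :> lmodType F;
  vl_d : vl_sort -> vl_sort;
  vl_pr : vl_sort -> nat -> vl_sort -> vl_sort;
  vlP : is_vertex_Lie vl_d vl_pr
}.

Record vertexPoissonOps (A : lmodType F) := VertexPoissonOps {
  vp_mul : A -> A -> A;
  vp_one : A;
  vp_d : A -> A;
  vp_pr : A -> nat -> A -> A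
}.

Definition is_derivation (A : lmodType F) (mul : A -> A -> A) (D : A -> A) :=
  linear D /\ forall a b, D (mul a b) = mul (D a) b + mul a (D b).

Record is_vertex_Poisson (A : lmodType F) (P : vertexPoissonOps A) : Prop := {
  vp_mul_linl : forall b, linear (fun a => vp_mul P a b);
  vp_mulA : associative (vp_mul P);
  vp_mulC : commutative (vp_mul P);
  vp_mul1 : left_id (vp_one P) (vp_mul P);
  vp_d_der : is_derivation (vp_mul P) (vp_d P);
  vp_Lie : is_vertex_Lie (vp_d P) (vp_pr P);
  vp_pr_der : forall a n, is_derivation (vp_mul P) (vp_pr P a n)
}.

Definition vertex_Poisson_iso (A B : lmodType F)
    (P : vertexPoissonOps A) (Q : vertexPoissonOps B) (f : A -> B) : Prop :=
  [/\ is_vertex_Poisson P, is_vertex_Poisson Q, bijective f &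
   [/\ linear f,
       f (vp_one P) = vp_one Q,
       forall a b, f (vp_mul P a b) = vp_mul Q (f a) (f b),
       forall a, f (vp_d P a) = vp_d Q (f a) &
       forall a n b, f (vp_pr P a n b) = vp_pr Q (f a) n (f b)]].

Definition is_Lie_module (L : lmodType F) (br : L -> L -> L) (M : lmodType F)
    (act : L -> M -> M) : Prop :=
  [/\ forall m, linear (fun x => act x m),
      forall x, linear (act x) &
      forall x y m, act (br x y) m = act x (act y m) - act y (act x m)].

Definition Lie_module_iso (L : lmodType F) (br : L -> L -> L)
    (M N : lmodType F) (actM : L -> M -> M) (actN : L -> N -> N) (f : M -> N) :=
  [/\ is_Lie_module br actM, is_Lie_module br actN, linear f, bijective f &
      forall x m, f (actM x m) = actN x (f m)].

End VertexStructures.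

Section Associated.
Context (F : fieldType) (R : vertexLie F).

(* R tensor C[t, 1/t], written as the direct sum of the R tensor t^n. *)
Definition loop := @dsum F int (fun _ => vl_sort R).
HB.instance Definition _ := GRing.Lmodule.on loop.

Definition loop_mon (a : R) (n : int) : loop :=
  @dinj F int (fun _ => vl_sort R) n a.

(* d tensor 1 + 1 tensor d/dt *)
Definition loop_d (f : loop) : loop :=
  \sum_(n <- dsupp f)
    (loop_mon (vl_d (dcoef f n)) n + loop_mon (n%:~R *: dcoef f n) (n - 1)).

Definition loop_br (f g : loop) : loop :=
  \sum_(m <- dsupp f) \sum_(n <- dsupp g) \sum_(i \in [set: nat])
    loop_mon (binz F m i *: vl_pr (dcoef f m) i (dcoef g n)) (m + n - i%:Z).

Definition LR := quotsp (span (range loop_d)).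
HB.instance Definition _ := GRing.Lmodule.on LR.

Definition Lmode (a : R) (n : int) : LR := qclass _ (loop_mon a n).

(* The bracket of R tensor C[t, 1/t] induces one on L(R): [loop_br f g] lies in
   the image of [loop_d] as soon as f or g does. *)
Definition Lbr (x y : LR) : LR := qclass _ (loop_br (repr x) (repr y)).

Definition Lplus_sub : subspace LR :=
  span [set x | exists a (n : nat), x = Lmode a n%:Z].

Definition Lplus := subsp Lplus_sub.
HB.instance Definition _ := GRing.Lmodule.on Lplus.

Lemma Lmode_Lplus a (n : nat) : Lmode a n%:Z \in Lplus_sub.
Proof. by apply: mem_span; exists a, n. Qed.

Definition Lpmode (a : R) (n : nat) : Lplus := Sub (Lmode a n%:Z) (Lmode_Lplus a n).

(* The default value 0 is never used: L(R)_+ is closed under the bracket. *)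
Definition Lpbr (x y : Lplus) : Lplus := insubd 0 (Lbr (\val x) (\val y)).

Definition UL := env_alg Lbr.
HB.instance Definition _ := GRing.Algebra.on UL.
Definition ULp := env_alg Lpbr.
HB.instance Definition _ := GRing.Algebra.on ULp.

Definition ULp_incl (a : ULp) : UL := env_lift (fun x : Lplus => env_gen Lbr (\val x)) a.

Definition ULp_aug (a : ULp) : F^o := env_lift (fun _ : Lplus => 0 : F^o) a.

(* C is the trivial module of L(R)_+, on which U(L(R)_+) acts through its
   augmentation. *)
Definition VR := tensor (fun (u : UL) (a : ULp) => u * ULp_incl a)
                        (fun (a : ULp) (c : F^o) => ULp_aug a * c).
HB.instance Definition _ := GRing.Lmodule.on VR.

Definition VRvac : VR := tens _ _ (1 : UL) (1 : F^o).

Definition VRact (x : LR) : VR -> VR := tensor_map (fun u : UL => env_gen Lbr x * u).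

Definition VRembed (a : R) : VR := VRact (Lmode a (-1)) VRvac.

Definition SR : algType F := sym_alg R.
Definition SRgen (a : R) : SR := env_gen (fun _ _ : R => 0) a.

Definition is_induced_action (act : Lplus -> SR -> SR) : Prop :=
  [/\ is_Lie_module Lpbr act,
      forall x, is_derivation *%R (act x) &
      forall a n b, act (Lpmode a n) (SRgen b) = SRgen (vl_pr a n b)].

(* a_1(-1) ... a_r(-1) 1 for s = [:: a_1; ...; a_r] *)
Definition VRmonomial (s : seq R) : VR :=
  foldr (fun a v => VRact (Lmode a (-1)) v) VRvac s.

Definition VRfilt (n : int) : subspace VR :=
  span [set v | exists2 s : seq R, (Posz (size s) <= n)%R & v = VRmonomial s].

End Associated.

Section GoodFiltration.
Context (F : fieldType) (V : lmodType F).

Record good_filtration (Y : V -> int -> V -> V) (vac : V) (E : int -> subspace V)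
    : Prop := {
  gf_incr : forall m n, (m <= n)%R -> {subset E m <= E n};
  gf_exhaust : forall v, exists n, v \in E n;
  gf_vac : vac \in E 0;
  gf_neg : forall m n u v j, u \in E m -> v \in E n -> (j < 0)%R ->
    Y u j v \in E (m + n);
  gf_nneg : forall m n u v j, u \in E m -> v \in E n -> (0 <= j)%R ->
    Y u j v \in E (m + n - 1)
}.

Section RelativeQuotient.
Context (S T : subspace V).

Lemma restr_closed : GRing.subsemimod_closed
  ((fun v : subsp S => \val v \in T) : {pred subsp S}).
Proof.
split; [split=> [|u v] | move=> c u].
- exact: (rpred0 T).
- exact: (@rpredD _ T).
- exact: (@rpredZ _ _ T).
Qed.

Definition restr_sub : subspace (subsp S) := Subspace restr_closed.

End RelativeQuotient.

Context (E : int -> subspace V).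

Definition gr_piece (n : int) : lmodType F := quotsp (restr_sub (E n) (E (n - 1))).

Definition gr := @dsum F int gr_piece.
HB.instance Definition _ := GRing.Lmodule.on gr.

(* The element v + E_(n-1) of gr, for v in E_n; the class of 0 otherwise. *)
Definition gr_class (n : int) (v : V) : gr :=
  dinj (qclass (restr_sub (E n) (E (n - 1))) (insubd 0 v) : gr_piece n).

(* A representative in E_n of the component of degree n. *)
Definition gr_lift (x : gr) (n : int) : V := \val (repr (dcoef x n)).

(* The maps induced on gr by f and op, when f maps E_n to E_n and op maps
   E_m x E_n to E_(m+n+s), compatibly with the subspaces one degree lower. *)
Definition gr_map (f : V -> V) (x : gr) : gr :=
  \sum_(n <- dsupp x) gr_class n (f (gr_lift x n)).

Definition gr_map2 (op : V -> V -> V) (s : int) (x y : gr) : gr :=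
  \sum_(m <- dsupp x) \sum_(n <- dsupp y)
    gr_class (m + n + s) (op (gr_lift x m) (gr_lift y n)).

Definition gr_ops (Y : V -> int -> V -> V) (vac : V) : vertexPoissonOps gr := {|
  vp_mul := gr_map2 (fun u v => Y u (-1) v) 0;
  vp_one := gr_class 0 vac;
  vp_d := gr_map (fun v => Y v (-2) vac);
  vp_pr := fun x i y => gr_map2 (fun u v => Y u i%:Z v) (-1) x y
|}.

End GoodFiltration.

(* Main.v *)
(** The class of a t^(-n-1) in L(R) is that of (d^n a / n!) t^(-1), so L(R) is the
    direct sum of {a(-1) | a in R}, a copy of R, and of L(R)_+.  Injectivity of psi
    amounts to a linear map V(R) -> S(R) sending a_1(-1)...a_r(-1)1 to a_1...a_r plus
    terms of lower degree, that is, to a multilinear function h on words in L(R) which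
    vanishes on words ending in L(R)_+, has the right leading term, and satisfies
    h(u x y v) - h(u y x v) = h(u [x,y] v).  No basis of R is needed: h is built by
    induction on the length of the words.  Attach distinct labels to the letters, sort
    them by exchanging neighbours, and add up the values h(u [x,y] v) of the exchanges;
    by the Jacobi identity the result does not depend on the way of sorting, and its
    average over all labellings has the exchange property.

    The inclusions defining a good filtration follow by induction on r from
    (a_(-1) u)_n v = sum_i a_(-1-i) u_(n+i) v + u_(n-1-i) a_i v.  The products of gr are
    compared with those of S(R) on generators: they are derivations in the second
    argument, and skew symmetry (C2) moves a generator to the first one.  The axioms for
    gr are then transported from S(R) along psi. *)

Require Import Defs.
From HB Require Import structures.
From mathcomp Require Import all_boot ssrAC generic_quotient order ssralg ssrnum ssrint.
From mathcomp Require Import finmap boolp classical_sets functions cardinality fsbigop.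
From mathcomp.multinomials Require Import monalg.
From mathcomp Require Import reals complex zify ring.

Set Implicit Arguments.
Unset Strict Implicit.
Unset Printing Implicit Defensive.

Import Order.TTheory GRing.Theory Num.Theory.
Local Open Scope ring_scope.

(** * Binomial coefficients with an integer upper index *)

(** Labels stand in for an ordered basis. The value obtained by sorting one labelled word satisfies
    the exchange relation only if the labels are exchanged together with the letters. Exchanging
    neighbours permutes the set of labellings, so in the average the labels drop out, while the
    correction, the same for every labelling, survives with coefficient 1. This division by n!, like
    the one in d^k a / k!, uses characteristic zero. Vanishing on L(R)_+ is built into the labels:
    every letter is first split along the projection onto L(R)_+, and the components in L(R)_+ get
    smaller labels than all others. If such a component stands at the distinguished end of the word,
    sorting only ever replaces it there by another one; the brackets formed at that end stay in
    L(R)_+ because it is a subalgebra; and the sorted word is killed by the leading term, which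
    factors through L(R) / L(R)_+. The recursion puts this end at the head of the words, and
    [pbw_functional] reverses them. *)

Lemma int_step_ind (P : int -> Prop) :
  P 0 -> (forall y, P y <-> P (y + 1)) -> forall y, P y.
Proof.
move=> P0 PS y; case: (intP y) => // n.
  by elim: n => [|n IHn]; [rewrite -[1%:Z]add0r -PS | rewrite -addn1 PoszD -PS].
elim: n => [|n IHn]; apply/PS; first by rewrite addNr.
by rewrite -[n.+2]addn1 PoszD opprD addrNK.
Qed.

Section GeneralizedBinomials.
Context (F : numFieldType).
Local Notation binz := (binz F).

Let fact_neq0 i : (i`!)%:R != 0 :> F.
Proof. by rewrite pnatr_eq0 -lt0n fact_gt0. Qed.

Let S_neq0 i : i.+1%:R != 0 :> F.
Proof. by rewrite pnatr_eq0. Qed.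

Lemma binz0 k : binz k 0 = 1.
Proof. by rewrite /Defs.binz big_ord0 divr1. Qed.

Lemma binzS k i : i.+1%:R * binz k i.+1 = (k - i%:Z)%:~R * binz k i.
Proof.
rewrite /Defs.binz big_ord_recr /= factS natrM.
by field; rewrite fact_neq0 addrC natr1 S_neq0.
Qed.

Lemma binz_absorb k i : i.+1%:R * binz k i.+1 = k%:~R * binz (k - 1) i.
Proof.
rewrite /Defs.binz big_ord_recl /= subr0 factS natrM.
under [in LHS]eq_bigr => j _.
  rewrite (_ : k - (bump 0 j)%:Z = k - 1 - j%:Z); last by rewrite /bump; lia.
  over.
by field; rewrite fact_neq0 addrC natr1 S_neq0.
Qed.

Lemma binz_pascal k i : binz (k + 1) i.+1 = binz k i.+1 + binz k i.
Proof.
apply: (mulfI (S_neq0 i)); rewrite binz_absorb addrK mulrDr binzS -mulrDl.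
by congr (_ * _); rewrite -[i.+1%:R]/(i.+1%:~R) -intrD; congr _%:~R; lia.
Qed.

Lemma binz_nat n i : binz n%:Z i = 'C(n, i)%:R.
Proof.
elim: n i => [|n IHn] [|i]; rewrite ?binz0 ?bin0 //.
  by apply: (mulfI (S_neq0 i)); rewrite binz_absorb bin0n mulr0 mul0r.
by rewrite binS natrD -!IHn -binz_pascal -addn1 PoszD.
Qed.

(** Reversing the order of the i factors and giving each one a sign (upper negation). The
    coefficients on the right of [va_jacobi] become ordinary binomials in this way. *)
Lemma delta_coef_reflect m i : delta_coef F (i%:Z - m - 1) i = binz m i.
Proof.
rewrite /delta_coef /Defs.binz mulrA; congr (_ / _).
rewrite -{1}(card_ord i) -prodr_const -big_split [RHS](reindex_inj rev_ord_inj) /=.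
apply: eq_bigr => j _; rewrite mulN1r -rmorphN; congr _%:~R.
by have := ltn_ord j; rewrite /=; lia.
Qed.

(** By Pascal's rule ([H]) the sum at y + 1 in degree t + 1 is the sum of those at y in degrees t +
    1 and t. Read downwards, from y + 1 to y, this yields degree t + 1 only once degree t is known,
    hence the inner induction. *)
Lemma binz_vandermonde (x y : int) (t : nat) :
  \sum_(j < t.+1) binz x (t - j)%N * binz y j = binz (x + y) t.
Proof.
move: y t; apply: int_step_ind => [t|y].
  rewrite big_ord_recl big1 ?addr0 /= ?subn0 ?binz0 ?mulr1 // => j _.
  by rewrite (binz_nat 0) bin0n mulr0.
have H t : \sum_(j < t.+2) binz x (t.+1 - j)%N * binz (y + 1) j =
    \sum_(j < t.+2) binz x (t.+1 - j)%N * binz y j +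
    \sum_(j < t.+1) binz x (t - j)%N * binz y j.
  rewrite big_ord_recl [in RHS]big_ord_recl !binz0 -[RHS]addrA; congr (_ + _).
  rewrite -big_split; apply: eq_bigr => j _ /=.
  by rewrite binz_pascal mulrDr /bump !add1n subSS.
split=> IH t; last first.
  elim: t => [|t IHt]; first by rewrite big_ord1 !binz0 mulr1.
  have := H t; rewrite IH IHt addrA binz_pascal => /esym.
  by move/addIr.
case: t => [|t]; first by rewrite big_ord1 !binz0 mulr1.
by rewrite H !IH addrA binz_pascal.
Qed.

(** Both sides are the coefficient of z^k in (1+z)^(m+n) (1 - z/(1+z))^m = (1+z)^n. Without power
    series: [G m x k] is unchanged when m and x both grow by one, which reduces the claim to m =
    0. *)
Lemma binz_alternating_sum (m n : int) (k : nat) :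
  \sum_(i < k.+1) (-1) ^+ i * binz m i * binz (m + n - i%:Z) (k - i)%N = binz n k.
Proof.
pose G (m x : int) k : F :=
  \sum_(i < k.+1) (-1) ^+ i * binz m i * binz (x - i%:Z) (k - i)%N.
have GSm y x t : G (y + 1) (x + 1) t.+1 = G y (x + 1) t.+1 - G y x t.
  rewrite /G big_ord_recl [in X in _ = X - _]big_ord_recl !binz0 -[RHS]addrA; congr (_ + _).
  rewrite -sumrN -big_split; apply: eq_bigr => i _.
  rewrite /= /bump add1n subSS binz_pascal.
  rewrite (_ : x + 1 - i.+1%:Z = x - i%:Z); last by lia.
  by rewrite exprS; ring.
have GSx y x t : G y (x + 1) t.+1 = G y x t.+1 + G y x t.
  rewrite /G big_ord_recr [in X in _ = X + _]big_ord_recr /= subnn !binz0.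
  rewrite addrAC -big_split; congr (_ + _); apply: eq_bigr => i _ /=.
  rewrite subSn; last by rewrite -ltnS.
  by rewrite (_ : x + 1 - i%:Z = x - i%:Z + 1) ?binz_pascal ?mulrDr //; lia.
have GS y x t : G (y + 1) (x + 1) t = G y x t.
  by case: t => [|t]; [rewrite /G !big_ord1 !binz0 | rewrite GSm GSx addrK].
rewrite -[LHS]/(G m (m + n) k); move: m; apply: int_step_ind => [|m].
  rewrite /G big_ord_recl big1 ?addr0 /= => [|i _].
    rewrite expr0 mul1r binz0 mul1r subn0; congr (Defs.binz _ _ _).
    lia.
  by rewrite (binz_nat 0) bin0n mulr0 mul0r.
by rewrite -[G m _ _]GS (_ : m + 1 + n = m + n + 1) //; lia.
Qed.

Lemma binz_trinomial m s j :
  binz m (s + j)%N * 'C(s + j, s)%:R = binz m s * binz (m - s%:Z) j.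
Proof.
have fE : 'C(s + j, s)%:R = ((s + j)`!)%:R / ((s`!)%:R * (j`!)%:R) :> F.
  rewrite -(bin_fact (leq_addr j s)) addKn !natrM mulfK //.
  by rewrite mulf_neq0 ?fact_neq0.
rewrite /Defs.binz fE big_split_ord /=.
under [X in _ * X / _ * _]eq_bigr => i _ do rewrite PoszD opprD addrA.
by field; rewrite !fact_neq0.
Qed.

End GeneralizedBinomials.

(** * A basis-free Poincare-Birkhoff-Witt theorem *)

Section AdjacentSwaps.
Context (T : Type).

Fixpoint swapl i (w : seq T) : seq T :=
  match i, w with
  | 0%N, x :: y :: v => y :: x :: v
  | i'.+1, x :: v => x :: swapl i' v
  | _, _ => w
  end.

Lemma swapl_nil i : swapl i [::] = [::].
Proof. by case: i. Qed.

Lemma size_swapl i w : size (swapl i w) = size w.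
Proof. by elim: i w => [|i IHi] [|x [|y w]] //=; rewrite IHi. Qed.

Lemma swaplK i : involutive (swapl i).
Proof. by elim: i => [|i IHi] [|x [|y w]] //=; rewrite IHi. Qed.

Lemma swapl_size_cat u x y v : swapl (size u) (u ++ x :: y :: v) = u ++ y :: x :: v.
Proof. by elim: u => //= z u ->. Qed.

Lemma nth_swapl x0 i w k : (i.+1 < size w)%N ->
  nth x0 (swapl i w) k =
  nth x0 w (if k == i then i.+1 else if k == i.+1 then i else k).
Proof.
elim: i w k => [|i IHi] [|x [|y w]] [|[|k]] //= iw.
- by rewrite -[0%N]/(0%N) (IHi (y :: w) 0%N iw) !eqSS /=; case: (0%N == i).
- by rewrite (IHi (y :: w) k.+1 iw) !eqSS; case: ifP => //; case: ifP.
Qed.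

Lemma swaplC i j w : (i.+1 < j)%N -> swapl i (swapl j w) = swapl j (swapl i w).
Proof.
elim: i j w => [|i IHi] [|j] w //= ij.
  by case: j ij => [|j] // _; case: w => [|x [|y w]].
by case: w => [|x w] //=; rewrite IHi.
Qed.

Lemma swapl_braid i w : (i.+2 < size w)%N ->
  swapl i (swapl i.+1 (swapl i w)) = swapl i.+1 (swapl i (swapl i.+1 w)).
Proof.
elim: i w => [|i IHi] [|x [|y [|z w]]] //= iw.
by congr (_ :: _); apply: IHi.
Qed.

End AdjacentSwaps.

Arguments swapl {T} i w : simpl nomatch.

Lemma perm_swapl (T : eqType) i (w : seq T) : perm_eq (swapl i w) w.
Proof.
elim: i w => [|i IHi] [|x w] //=; last by rewrite perm_cons.
by case: w => [|y w] //=; rewrite -cat1s -[x :: _]cat1s perm_catCA.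
Qed.

Lemma big_swapl (R : Type) (T : eqType) (idx : R) (op : Monoid.com_law idx) i
    (s : seq (seq T)) (G : seq T -> R) :
  uniq s -> (forall w, w \in s -> swapl i w \in s) ->
  \big[op/idx]_(w <- s) G (swapl i w) = \big[op/idx]_(w <- s) G w.
Proof.
move=> us sP; rewrite -(big_map (swapl i) predT G); apply: perm_big.
apply: uniq_perm => //; first by rewrite (map_inj_uniq (can_inj (@swaplK _ i))).
move=> w; apply/mapP/idP => [[v vs ->]|ws]; first exact: sP.
by exists (swapl i w); rewrite ?swaplK ?sP.
Qed.

Section Inversions.

Definition desc (s : seq nat) i :=
  (i.+1 < size s)%N && (nth 0%N s i.+1 < nth 0%N s i)%N.

Fixpoint inv (s : seq nat) : nat :=
  if s is x :: t then (count (fun y => y < x)%N t + inv t)%N else 0%N.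

Lemma inv_swapl s i : desc s i -> inv s = (inv (swapl i s)).+1.
Proof.
elim: i s => [|i IHi] [|x s] //.
  by case: s => [|y s] //=; rewrite /desc /= => xy; rewrite xy ltnNge ltnW //=; lia.
rewrite -[desc _ _]/(desc s i) /= => /IHi ->.
by rewrite (permP (perm_swapl i s)) addnS.
Qed.

End Inversions.

(** * Multilinear functions on words *)

Section Words.
Context (F : fieldType) (L : lmodType F).

(* w0 = c w1 + w2 in one slot, the three words agreeing in all others. *)
Inductive lin3 (c : F) : seq L -> seq L -> seq L -> Prop :=
| lin3_head x y v : lin3 c (c *: x + y :: v) (x :: v) (y :: v)
| lin3_cons z w0 w1 w2 : lin3 c w0 w1 w2 -> lin3 c (z :: w0) (z :: w1) (z :: w2).

Definition multilinear (M : lmodType F) (g : seq L -> M) :=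
  forall c w0 w1 w2, lin3 c w0 w1 w2 -> g w0 = c *: g w1 + g w2.

Lemma lin3_slot c u x y v :
  lin3 c (u ++ (c *: x + y) :: v) (u ++ x :: v) (u ++ y :: v).
Proof. by elim: u => [|z u IHu]; constructor. Qed.

Lemma lin3_slotP c w0 w1 w2 : lin3 c w0 w1 w2 ->
  exists u x y v, [/\ w0 = u ++ (c *: x + y) :: v, w1 = u ++ x :: v & w2 = u ++ y :: v].
Proof.
elim=> [x y v|z ? ? ? _ [u [x [y [v [-> -> ->]]]]]]; first by exists [::], x, y, v.
by exists (z :: u), x, y, v.
Qed.

Lemma lin3_size c w0 w1 w2 : lin3 c w0 w1 w2 ->
  size w1 = size w0 /\ size w2 = size w0.
Proof. by elim=> [|z ? ? ? _ [/= -> ->]]. Qed.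

Lemma lin3_swapl c i w0 w1 w2 :
  lin3 c w0 w1 w2 -> lin3 c (swapl i w0) (swapl i w1) (swapl i w2).
Proof.
move=> l3; elim: l3 i => [x y [|z v]|z ? ? ? l3 IH] [|i] /=; try by do ?constructor.
by case: l3 => [x y [|z' v]|z' ? ? ? l3]; do ?constructor.
Qed.

Lemma multilinear0 (M : lmodType F) (g : seq L -> M) u v :
  multilinear g -> g (u ++ 0 :: v) = 0.
Proof.
move=> /(_ (-1) _ _ _ (lin3_slot (-1) u 0 0 v)).
by rewrite scaler0 addr0 scaleN1r addNr.
Qed.

Lemma multilinearD (M : lmodType F) (g : seq L -> M) u x y v :
  multilinear g -> g (u ++ (x + y) :: v) = g (u ++ x :: v) + g (u ++ y :: v).
Proof.
by move=> /(_ 1 _ _ _ (lin3_slot 1 u x y v)); rewrite !scale1r.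
Qed.

Lemma multilinearZ (M : lmodType F) (g : seq L -> M) u c x v :
  multilinear g -> g (u ++ (c *: x) :: v) = c *: g (u ++ x :: v).
Proof.
move=> gl; have := gl _ _ _ _ (lin3_slot c u x 0 v).
by rewrite multilinear0 // !addr0.
Qed.

Lemma multilinearN (M : lmodType F) (g : seq L -> M) u x v :
  multilinear g -> g (u ++ (- x) :: v) = - g (u ++ x :: v).
Proof. by move=> gl; rewrite -scaleN1r multilinearZ // scaleN1r. Qed.

Lemma multilinear_cons (M : lmodType F) (g : seq L -> M) x :
  multilinear g -> multilinear (fun w => g (x :: w)).
Proof. by move=> gl c w0 w1 w2 l3; apply: gl; constructor. Qed.

End Words.

(** * Replacing two neighbouring letters by their bracket *)

Section Contractions.
Context (F : fieldType) (L : lmodType F) (br : L -> L -> L).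
Context (br_l : forall y, linear (br^~ y)) (br_r : forall x, linear (br x)).

Fixpoint contr i (w : seq L) : seq L :=
  match i, w with
  | 0%N, x :: y :: v => br x y :: v
  | i'.+1, x :: v => x :: contr i' v
  | _, _ => w
  end.

Lemma contr_nil i : contr i [::] = [::].
Proof. by case: i. Qed.

Lemma size_contr i w : (i.+1 < size w)%N -> size (contr i w) = (size w).-1.
Proof.
elim: i w => [|i IHi] [|x [|y w]] //= iw.
by rewrite (IHi (y :: w)).
Qed.

Lemma contr_size_cat u x y v : contr (size u) (u ++ x :: y :: v) = u ++ br x y :: v.
Proof. by elim: u => //= z u ->. Qed.

(** A contraction at i shortens the word, so that position j + 1 to its right becomes position j. *)
Lemma contr_swapl_far i j w : (i < j)%N ->
  contr i (swapl j.+1 w) = swapl j (contr i w).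
Proof.
elim: i j w => [|i IHi] [|j] // [|x w] // ij; last exact: (congr1 (cons x) (IHi _ _ _)).
by case: w => [|y w] //=; rewrite ?swapl_nil ?contr_nil.
Qed.

Lemma contr_far_swapl i j w : (i < j)%N ->
  contr j.+1 (swapl i w) = swapl i (contr j.+1 w).
Proof.
elim: i j w => [|i IHi] [|j] // [|x w] // ij; last exact: (congr1 (cons x) (IHi _ _ _)).
by case: w => [|y w] //=; rewrite ?swapl_nil ?contr_nil.
Qed.

Lemma contrC i j w : (i < j)%N ->
  contr i (contr j.+1 w) = contr j (contr i w).
Proof.
elim: i j w => [|i IHi] [|j] // [|x w] // ij; last exact: (congr1 (cons x) (IHi _ _ _)).
by case: w => [|y w] //=; rewrite ?swapl_nil ?contr_nil.
Qed.

Lemma multilinear_contr (M : lmodType F) (g : seq L -> M) i :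
  multilinear g -> multilinear (fun w => g (contr i w)).
Proof.
move=> gl c w0 w1 w2 l3; apply: gl.
elim: l3 i => [x y v|z u0 u1 u2 l3 IH] [|i] /=.
- by case: v => [|z v]; rewrite ?br_l; apply: lin3_head.
- exact: lin3_head.
- case: l3 => [x y v|z' ? ? ? l3]; last exact: lin3_cons.
  by rewrite br_r; apply: lin3_head.
- exact: lin3_cons.
Qed.

End Contractions.

Lemma exchange_sub (V : zmodType) (a b c d : V) : a - b = c - d -> b + c = d + a.
Proof.
by move=> /eqP; rewrite subr_eq => /eqP ->; rewrite [RHS]addrC addrAC subrK addrC.
Qed.

(** * Sorting labelled words, independently of the order of the exchanges *)

Section PathSums.
Context (F : numFieldType) (L A : lmodType F) (br : L -> L -> L).
Context (br_l : forall y, linear (br^~ y)) (br_r : forall x, linear (br x)).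
Context (br_anti : forall x y, br x y = - br y x).
(** The Jacobi identity in the form in which reversing x y z meets it: one route exchanges x y, then
    x z, then y z, and each exchange leaves its bracket next to the third letter. *)
Context (br_jac : forall x y z,
  br (br x y) z + br y (br x z) + br (br y z) x = 0).
Context (t : seq L -> A) (t_lin : multilinear t).
Context (t_swap : forall i w, t (swapl i w) = t w).
Local Notation contr := (contr br).

Section OneStep.
Context (f : seq L -> A).

(** The number k is fuel. Starting from k = [inv s] it suffices exactly, since every exchange at a
    descent removes one inversion ([inv_swapl]). Which descent is picked is irrelevant by
    [sorted_value_step]. *)
Fixpoint sortsum k (s : seq nat) (w : seq L) : A :=
  if k is k'.+1 then
    if [pick i : 'I_(size s) | desc s i] is Some i
    then sortsum k' (swapl i s) (swapl i w) + f (contr i w)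
    else t w
  else t w.

(* w is sorted according to the labels s; each exchange of neighbours adds the
   value under f of the word in which they are replaced by their bracket. *)
Definition sorted_value s w := sortsum (inv s) s w.

Variant sorted_value_spec s : Prop :=
| SortedValueDone of (forall i, ~~ desc s i) & (forall w, sorted_value s w = t w)
| SortedValueStep i of desc s i & (forall w, sorted_value s w =
      sorted_value (swapl i s) (swapl i w) + f (contr i w)).

Lemma sorted_valueP s : sorted_value_spec s.
Proof.
case: (pickP (fun i : 'I_(size s) => desc s i)) => [i0 i0s|s0].
  case E: [pick i : 'I_(size s) | desc s i] => [i|]; last first.
    by move: E; case: pickP => // /(_ i0); rewrite i0s.
  have si : desc s i by move: E; case: pickP => // j js [<-].
  by apply: (SortedValueStep si) => w; rewrite /sorted_value (inv_swapl si) /= E.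
apply: SortedValueDone => [i|w].
  apply/negP => si; have is_ : (i < size s)%N by move: si => /andP[/ltnW].
  by have := s0 (Ordinal is_); rewrite /= si.
by rewrite /sorted_value; case: (inv s) => //= k; case: pickP => // i; rewrite s0.
Qed.

Lemma sorted_value_ind (P : seq nat -> Prop) :
  (forall s, (forall i, ~~ desc s i) -> (forall w, sorted_value s w = t w) -> P s) ->
  (forall s i, desc s i -> (forall w, sorted_value s w =
      sorted_value (swapl i s) (swapl i w) + f (contr i w)) ->
      P (swapl i s) -> P s) ->
  forall s, P s.
Proof.
move=> P0 PS s; elim: {s}(inv s) {-2}s (leqnn (inv s)) => [|m IHm] s sm.
  case: (sorted_valueP s) => [s0 sE|i si sE]; first exact: P0.
  by move: sm; rewrite (inv_swapl si).
case: (sorted_valueP s) => [s0 sE|i si sE]; first exact: P0.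
by apply: (PS _ i) => //; apply: IHm; rewrite -ltnS -(inv_swapl si).
Qed.

Context (f_lin : multilinear f).

Lemma sorted_value_lin s : multilinear (sorted_value s).
Proof.
elim/sorted_value_ind: s => [s _ sE|s i _ sE IH] c w0 w1 w2 l3.
  by rewrite !sE; apply: t_lin.
rewrite !sE (IH _ _ _ _ (lin3_swapl i l3)).
rewrite (multilinear_contr br_l br_r i f_lin l3) scalerDr.
by rewrite !addrA; congr (_ + _); rewrite addrAC.
Qed.

(** In the recursion f and f' are consecutive functionals, [pbw n] and [pbw n.-1]: f has the
    exchange property on words of length n with correction f', and this is used to treat words of
    length n + 1. *)
Context (f' : seq L -> A) (f'_lin : multilinear f') (n : nat).
Context (f_swap : forall i w, size w = n -> (i.+1 < n)%N ->
  f w - f (swapl i w) = f' (contr i w)).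

Let contr_swapl_anti i w : (i.+1 < size w)%N -> exists u x y v,
  contr i w = u ++ br x y :: v /\ contr i (swapl i w) = u ++ br y x :: v.
Proof.
elim: i w => [|i IHi] [|x [|y w]] // iw; first by exists [::], x, y, w.
have [u [x' [y' [v [/= e1 e2]]]]] := IHi (y :: w) iw.
by exists (x :: u), x', y', v; rewrite /= e1 e2.
Qed.

(* The two ways of reversing three adjacent letters; J is the Jacobi identity. *)
Let jac_terms i w : size w = n.+1 -> (i.+2 < n.+1)%N ->
  f (contr i w) + f (contr i.+1 (swapl i w)) +
    f (contr i (swapl i.+1 (swapl i w))) =
  f (contr i.+1 w) + f (contr i (swapl i.+1 w)) +
    f (contr i.+1 (swapl i (swapl i.+1 w))).
Proof.
move=> wn iw; apply/eqP; rewrite -subr_eq0; apply/eqP.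
have sz v j : size v = n.+1 -> (j < n)%N -> size (contr j v) = n.
  by move=> vn jn; rewrite size_contr vn.
have E1 := f_swap (i := i) (sz _ i wn (ltnW iw)) iw.
have E2 := f_swap (i := i) (sz (swapl i w) i.+1 (etrans (size_swapl i w) wn) iw) iw.
have wn3 : size (swapl i.+1 (swapl i w)) = n.+1 by rewrite !size_swapl.
have E3 := f_swap (i := i) (sz _ i wn3 (ltnW iw)) iw.
have [e1 e2 e3 J] : [/\ swapl i (contr i w) = contr i.+1 (swapl i (swapl i.+1 w)),
    swapl i (contr i.+1 (swapl i w)) = contr i (swapl i.+1 w),
    swapl i (contr i (swapl i.+1 (swapl i w))) = contr i.+1 w &
    f' (contr i (contr i w)) + f' (contr i (contr i.+1 (swapl i w)))
    + f' (contr i (contr i (swapl i.+1 (swapl i w)))) = 0].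
  have [u [x [y [z [v [-> ui]]]]]] :
      exists u x y z v, w = u ++ x :: y :: z :: v /\ size u = i.
    have : (2 < size (drop i w))%N by rewrite size_drop wn ltn_subRL addn2.
    case E: (drop i w) => [|x [|y [|z v]]] //= _.
    exists (take i w), x, y, z, v; rewrite -E cat_take_drop size_takel //.
    by rewrite wn; lia.
  have s1 (u' : seq L) a b c v' : size u' = i ->
      swapl i.+1 (u' ++ a :: b :: c :: v') = u' ++ a :: c :: b :: v'.
    by move=> <-; elim: u' => //= d u' ->.
  have c1 (u' : seq L) a b c v' : size u' = i ->
      contr i.+1 (u' ++ a :: b :: c :: v') = u' ++ a :: br b c :: v'.
    by move=> <-; elim: u' => //= d u' ->.
  have s0 (u' : seq L) a b v' : size u' = i ->
      swapl i (u' ++ a :: b :: v') = u' ++ b :: a :: v'.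
    by move=> <-; apply: swapl_size_cat.
  have c0 (u' : seq L) a b v' : size u' = i ->
      contr i (u' ++ a :: b :: v') = u' ++ br a b :: v'.
    by move=> <-; apply: contr_size_cat.
  rewrite !(s0, s1, c0, c1) //; split=> //.
  by rewrite -!multilinearD // br_jac multilinear0.
rewrite -E1 -E2 -E3 e1 e2 e3 in J; rewrite -[RHS]J.
by rewrite !opprD (AC (3*3) ((1*6)*(2*5)*(3*4))).
Qed.


Lemma desc_swapl_far s i j : desc s i -> desc s j -> (i.+1 < j)%N ->
  desc (swapl i s) j /\ desc (swapl j s) i.
Proof.
rewrite /desc !size_swapl => /andP[is_ si] /andP[js sj] ij.
rewrite is_ js /= !nth_swapl //.
do ![rewrite (_ : (_ == _) = false); last by apply/eqP; lia].
by rewrite si sj.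
Qed.

Let IH_step m := forall s w i, (inv s < m)%N -> size s = n.+1 -> size w = n.+1 ->
  desc s i -> sorted_value s w =
    sorted_value (swapl i s) (swapl i w) + f (contr i w).

(** Local confluence. For distant descents the two exchanges commute, and the corrections agree
    because both differences are the value of f' on the same doubly contracted word. For adjacent
    descents the three labels are decreasing; both routes reverse the triple, by the braid relation,
    and [jac_terms] compares the corrections. *)
Let step_join m s w i j : IH_step m -> (inv s <= m)%N -> size s = n.+1 ->
  size w = n.+1 -> desc s i -> desc s j -> (i < j)%N ->
  sorted_value (swapl i s) (swapl i w) + f (contr i w) =
  sorted_value (swapl j s) (swapl j w) + f (contr j w).
Proof.
move=> IH sm sn wn si sj ij.
have small k : desc s k -> (inv (swapl k s) < m)%N.
  by move=> /inv_swapl <-.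
have jn : (j < n)%N by move: sj => /andP[]; rewrite sn.
have [ij1|ij1] := ltnP i.+1 j.
  have [si' sj'] := desc_swapl_far si sj ij1.
  rewrite (IH (swapl i s) _ j) ?size_swapl ?small //.
  rewrite (IH (swapl j s) _ i) ?size_swapl ?small //.
  rewrite !(swaplC _ ij1) -!addrA; congr (_ + _).
  case: j ij1 jn {ij sj si' sj'} => // j ij1 jn.
  rewrite contr_swapl_far // contr_far_swapl //; apply: exchange_sub.
  by rewrite !f_swap ?size_contr ?wn ?contrC //=; lia.
have {ij1 ij} jE : j = i.+1 by lia.
rewrite {}jE in sj jn *.
have sn2 : (i.+2 < size s)%N by rewrite sn.
have [ab bc] : (nth 0 s i.+1 < nth 0 s i)%N /\ (nth 0 s i.+2 < nth 0 s i.+1)%N.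
  by move: si sj => /andP[_ ->] /andP[_ ->].
have neqs : ((i.+1 == i) = false) * ((i.+2 == i) = false) * ((i.+2 == i.+1) = false)
    * ((i == i.+1) = false) * ((i == i.+2) = false) * ((i.+1 == i.+2) = false).
  by do ![split]; apply/eqP; lia.
have descs :
    [/\ desc (swapl i s) i.+1, desc (swapl i.+1 (swapl i s)) i,
        desc (swapl i.+1 s) i & desc (swapl i (swapl i.+1 s)) i.+1].
  rewrite /desc !size_swapl sn2 (ltnW sn2) /=.
  do ![rewrite nth_swapl ?size_swapl ?(ltnW sn2) // ?eqxx ?neqs /= ?eqxx ?neqs /=].
  by rewrite ab bc (ltn_trans bc ab).
have {descs} [d1 d2 d3 d4] := descs.
rewrite (IH (swapl i s) _ i.+1) ?size_swapl ?small //.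
rewrite (IH (swapl i.+1 s) _ i) ?size_swapl ?small //.
have ltt k l : desc s k -> desc (swapl k s) l -> (inv (swapl l (swapl k s)) < m)%N.
  by move=> /small lk /inv_swapl kl; apply: leq_trans lk; rewrite kl.
rewrite (IH (swapl i.+1 (swapl i s)) _ i) ?size_swapl ?ltt //.
rewrite (IH (swapl i (swapl i.+1 s)) _ i.+1) ?size_swapl ?ltt //.
rewrite !swapl_braid ?sn ?wn // -!addrA; congr (_ + _).
have := jac_terms wn jn.
by rewrite !addrA => E; rewrite (ACl (3*2*1)) /= E [RHS](ACl (3*2*1)).
Qed.

(** Newman's argument, by induction on the number of inversions: the descent picked by [sortsum] may
    be traded for any other one, by [step_join]. *)
Lemma sorted_value_step s w i : size s = n.+1 -> size w = n.+1 -> desc s i ->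
  sorted_value s w = sorted_value (swapl i s) (swapl i w) + f (contr i w).
Proof.
elim: {s}(inv s) {-2}s (leqnn (inv s)) w i => [|m IHm] s sm w i sn wn si.
  by move: sm; rewrite (inv_swapl si).
have [s0 _|j sj ->] := sorted_valueP s; first by rewrite (negPf (s0 i)) in si.
have IH : IH_step m.+1 by move=> ? ? ? ?; apply: IHm.
have [ij|ji|->] := ltngtP i j; last by [].
  by rewrite -(step_join IH sm sn wn si sj).
by rewrite -(step_join IH sm sn wn sj si).
Qed.

(** At an ascent, this is the step at the descent of the exchanged word read backwards; the sign is
    absorbed by the antisymmetry of the bracket. The right-hand side no longer involves the labels,
    which is what makes averaging work. *)
Lemma sorted_value_swapl s w i : size s = n.+1 -> size w = n.+1 -> (i < n)%N ->
  nth 0%N s i != nth 0%N s i.+1 ->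
  sorted_value s w - sorted_value (swapl i s) (swapl i w) = f (contr i w).
Proof.
move=> sn wn iN; rewrite neq_ltn => /orP[lt|lt]; last first.
  have si : desc s i by rewrite /desc sn ltnS iN.
  by rewrite (sorted_value_step sn wn si) addrC addKr.
have is_ : (i.+1 < size s)%N by rewrite sn.
rewrite (@sorted_value_step (swapl i s) (swapl i w) i) ?size_swapl //; last first.
  rewrite /desc size_swapl is_ !nth_swapl // eqxx.
  by rewrite (_ : (i.+1 == i) = false) ?eqxx //; apply/eqP; lia.
rewrite !swaplK opprD addNKr.
have: (i.+1 < size w)%N by rewrite wn.
move=> /contr_swapl_anti [u [x [y [v [-> ->]]]]].
by rewrite br_anti multilinearN // opprK.
Qed.

End OneStep.

(** * Splitting the letters along a projection, and averaging over the labellings *)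

Fixpoint bits n : seq bitseq :=
  if n is n'.+1 then map (cons true) (bits n') ++ map (cons false) (bits n')
  else [:: [::]].

Lemma mem_bits n e : (e \in bits n) = (size e == n).
Proof.
elim: n e => [|n IHn] [|b e] //=; rewrite mem_cat.
  by apply/orP => -[] /mapP[].
rewrite eqSS -IHn.
by apply/orP/idP => [[] /mapP[? ? [_ ->]] //|en]; case: b; [left|right]; apply: map_f.
Qed.

Lemma bits_uniq n : uniq (bits n).
Proof.
elim: n => //= n IHn; rewrite cat_uniq !map_inj_uniq ?IHn ?andbT //=; last 2 first.
- by move=> ? ? [].
- by move=> ? ? [].
by apply/hasPn => _ /mapP[e _ ->]; apply/negP => /mapP[].
Qed.

Context (pi : L -> L) (pi_lin : linear pi) (pi_idem : forall x, pi (pi x) = pi x).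
Context (pi_br : forall x y, pi (br (pi x) (pi y)) = br (pi x) (pi y)).
Context (t_pi : forall x w, t (pi x :: w) = 0).

Fixpoint proj (e : bitseq) (w : seq L) : seq L :=
  match e, w with
  | b :: e', x :: w' => (if b then pi x else x - pi x) :: proj e' w'
  | _, _ => w
  end.

Lemma size_proj e w : size (proj e w) = size w.
Proof. by elim: e w => [|b e IHe] [|x w] //=; rewrite IHe. Qed.

Lemma nth_proj e w k : (k < size e)%N -> (k < size w)%N ->
  nth 0 (proj e w) k =
  if nth false e k then pi (nth 0 w k) else nth 0 w k - pi (nth 0 w k).
Proof. by elim: e w k => [|b e IHe] [|x w] [|k] //=; apply: IHe. Qed.

Lemma lin3_proj c e w0 w1 w2 :
  lin3 c w0 w1 w2 -> lin3 c (proj e w0) (proj e w1) (proj e w2).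
Proof.
move=> l3; elim: l3 e => [x y v|z ? ? ? l3 IH] [|b e] /=; try by constructor.
case: b; rewrite pi_lin; first exact: lin3_head.
rewrite opprD addrACA -scalerN -scalerDr; exact: lin3_head.
Qed.

Lemma sum_proj (g : seq L -> A) w : multilinear g ->
  \sum_(e <- bits (size w)) g (proj e w) = g w.
Proof.
elim: w g => [|x w IHw] g g_lin; first by rewrite big_seq1.
rewrite /= big_cat /= !big_map -big_split /=.
rewrite -(IHw _ (multilinear_cons x g_lin)); apply: eq_bigr => e _.
by rewrite -(multilinearD [::]) //= addrC subrK.
Qed.

Lemma proj_swapl i e w : size e = size w ->
  proj (swapl i e) (swapl i w) = swapl i (proj e w).
Proof.
elim: i e w => [|i IHi] [|b e] [|x w] //= [ew]; last by rewrite IHi.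
by case: e w ew => [|b' e] [|y w].
Qed.

(* Labels below n mark the components in the image of pi, so that these are sorted
   to the head of the word. *)
Definition labels n (s : seq nat) (e : bitseq) : seq nat :=
  [seq (if p.2 then p.1 else p.1 + n)%N | p <- zip s e].

Lemma size_labels n s e : size s = n -> size e = n -> size (labels n s e) = n.
Proof. by move=> sn en; rewrite size_map size_zip sn en minnn. Qed.

Lemma labels_swapl n i s e : size s = size e ->
  labels n (swapl i s) (swapl i e) = swapl i (labels n s e).
Proof.
elim: i s e => [|i IHi] [|a s] [|b e] //= [se]; last by rewrite -IHi.
by case: s e se => [|a' s] [|b' e].
Qed.

Lemma nth_labels n s e i : size s = n -> size e = n -> (i < n)%N ->
  nth 0%N (labels n s e) i =
  if nth false e i then nth 0%N s i else (nth 0%N s i + n)%N.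
Proof.
move=> sn en iN; rewrite (nth_map (0%N, false)) ?size_zip ?sn ?en ?minnn //.
by rewrite nth_zip ?sn ?en.
Qed.

Section Perms.
Context (n : nat).

Lemma perms_size (s : seq nat) : s \in permutations (iota 0 n) -> size s = n.
Proof. by rewrite mem_permutations => /perm_size ->; rewrite size_iota. Qed.

Lemma perms_nth_lt (s : seq nat) i : s \in permutations (iota 0 n) -> (i < n)%N ->
  (nth 0%N s i < n)%N.
Proof.
move=> sP iN; have := sP; rewrite mem_permutations => /perm_mem /(_ (nth 0%N s i)).
by rewrite mem_nth ?(perms_size sP) // mem_iota /= add0n => /esym.
Qed.

(** Two labels shifted alike differ because s is a permutation; a shifted one is at least n and an
    unshifted one is below n. Equal neighbouring labels would break [sorted_value_swapl]. *)
Lemma labels_neq (s : seq nat) (e : bitseq) i :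
  s \in permutations (iota 0 n) -> e \in bits n ->
  (i.+1 < n)%N -> nth 0%N (labels n s e) i != nth 0%N (labels n s e) i.+1.
Proof.
move=> sP; rewrite mem_bits => /eqP en iN; have sn := perms_size sP.
have us : uniq s.
  by move: sP; rewrite mem_permutations => /perm_uniq ->; rewrite iota_uniq.
have si1 := perms_nth_lt sP iN; have si := perms_nth_lt sP (ltnW iN).
have ne : nth 0%N s i != nth 0%N s i.+1.
  by rewrite nth_uniq ?sn ?(ltnW iN) //; apply/eqP; lia.
rewrite (nth_labels sn en (ltnW iN)) (nth_labels sn en iN).
by case: ifP; case: ifP; lia.
Qed.

End Perms.

(* Sorting depends on the labels, averaging over all of them restores the exchange
   relation (see pbw_swapl). *)
Definition average (f : seq L -> A) (w : seq L) : A :=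
  ((size w)`!)%:R^-1 *: \sum_(s <- permutations (iota 0 (size w)))
    \sum_(e <- bits (size w)) sorted_value f (labels (size w) s e) (proj e w).

Fixpoint pbw n : seq L -> A := if n is n'.+1 then average (pbw n') else t.

Lemma average_const n (a : A) :
  (n`!)%:R^-1 *: \sum_(s <- permutations (iota 0 n)) a = a.
Proof.
rewrite big_const_seq count_predT size_permutations ?iota_uniq // size_iota.
rewrite iter_addr_0 -scaler_nat scalerA mulVf ?scale1r //.
by rewrite pnatr_eq0 -lt0n fact_gt0.
Qed.

Lemma average_lin f : multilinear f -> multilinear (average f).
Proof.
move=> f_lin c w0 w1 w2 l3; rewrite /average.
have [-> ->] := lin3_size l3; rewrite [c *: _]scalerA [c * _]mulrC -scalerA.
rewrite -scalerDr; congr (_ *: _); rewrite scaler_sumr -big_split /=.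
apply: eq_bigr => s _; rewrite scaler_sumr -big_split /=; apply: eq_bigr => e _.
exact/(sorted_value_lin f_lin)/lin3_proj.
Qed.

Lemma pbw_lin n : multilinear (pbw n).
Proof. by elim: n => //= n; apply: average_lin. Qed.

(** Exchanging two positions permutes the pairs of a labelling and a splitting, so the average for
    the exchanged word can be reindexed to match that for w term by term. Each difference is the
    value at the contraction of [proj e w], whatever the labelling, and summing over e restores w by
    multilinearity. *)
Lemma pbw_swapl n i w : size w = n -> (i.+1 < n)%N ->
  pbw n w - pbw n (swapl i w) = pbw n.-1 (contr i w).
Proof.
elim: n i w => // n IHn i w wn iN; rewrite -[n.+1.-1]/n /= /average.
rewrite size_swapl wn.
have reindex (G : seq nat -> bitseq -> A) :
    \sum_(s <- permutations (iota 0 n.+1)) \sum_(e <- bits n.+1) G s e =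
    \sum_(s <- permutations (iota 0 n.+1)) \sum_(e <- bits n.+1)
      G (swapl i s) (swapl i e).
  rewrite -(@big_swapl _ _ _ _ i) ?permutations_uniq => [|//|s]; last first.
    by rewrite !mem_permutations; apply: perm_trans; apply: perm_swapl.
  apply: eq_bigr => s _; rewrite -(@big_swapl _ _ _ _ i) ?bits_uniq => [//|//|e].
  by rewrite !mem_bits size_swapl.
rewrite [X in _ - _ *: X]reindex {reindex}.
rewrite -scalerBr -sumrB -[RHS](average_const n.+1); congr (_ *: _).
apply: eq_big_seq => s sP; rewrite -sumrB -wn.
rewrite -(sum_proj w (multilinear_contr br_l br_r i (pbw_lin n))).
apply: eq_big_seq => e eP; have sn := perms_size sP.
have en : size e = n.+1 by apply/eqP; rewrite -mem_bits -wn.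
rewrite wn labels_swapl ?sn ?en // proj_swapl ?wn //.
apply: (sorted_value_swapl (pbw_lin n) (pbw_lin n.-1) IHn).
- exact: size_labels.
- by rewrite size_proj.
- by rewrite -ltnS.
- by apply: labels_neq => //; rewrite -wn.
Qed.

(** Invariant of the sorting: letters with labels below m are fixed by pi, and the head has such a
    label. An exchange at the head brings forward an even smaller label, so both letters are fixed
    by pi and so is their bracket, whence the correction vanishes; an exchange elsewhere leaves the
    head in place in the contracted word. The sorted word is killed by [t_pi]. *)
Lemma sorted_value_pi f n m s w :
  (forall x v, (size v).+1 = n -> f (pi x :: v) = 0) ->
  size s = n.+1 -> size w = n.+1 ->
  (forall k, (k < n.+1)%N -> (nth 0%N s k < m)%N -> pi (nth 0 w k) = nth 0 w k) ->
  (head 0%N s < m)%N -> sorted_value f s w = 0.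
Proof.
move=> f_pi.
elim/(@sorted_value_ind f): s w => [s _ sE|s i /andP[is_ si] sE IH] w sn wn ok hs.
  rewrite sE; case: w wn ok => // x w _ /(_ 0%N isT).
  by rewrite nth0 => /(_ hs) /= <-; rewrite t_pi.
rewrite sE IH ?size_swapl //; first 1 last.
- move=> k kn; rewrite !nth_swapl ?wn -?sn //; apply: ok.
  by case: eqP => // _; [rewrite -sn|case: eqP => // _; rewrite -sn ltnW].
- case: i is_ si {sE IH} => [|i] is_ si; last by case: s sn hs {ok is_ si}.
  by case: s is_ si hs {sn ok} => [|a [|b s]] //= _; apply: ltn_trans.
rewrite add0r; case: i is_ si {sE IH} => [|i] is_ si.
  have n1 : (1 < n.+1)%N by rewrite -sn.
  case: w wn ok => [|x [|y w]] // wn ok; first by rewrite -wn in n1.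
  have px : pi x = x by apply: (ok 0%N) => //; rewrite nth0.
  have py : pi y = y.
    by apply: (ok 1%N); rewrite -?sn //; apply: ltn_trans si _; rewrite nth0.
  by rewrite -px -py /= -pi_br f_pi //; case: wn.
case: w wn ok => [|x w] //= [wn] /(_ 0%N isT); rewrite nth0 => /(_ hs) /= <-.
by rewrite f_pi // size_contr wn //; move: is_; rewrite sn; lia.
Qed.

Lemma pbw_pi n x w : (size w).+1 = n -> pbw n (pi x :: w) = 0.
Proof.
elim: n x w => // n IHn x w [wn].
have wE : size (pi x :: w) = n.+1 by rewrite /= wn.
rewrite -[pbw _ _]/(average (pbw n) _) /average wE big1_seq ?scaler0 // => s.
move=> /andP[_ sP]; rewrite big1_seq // => e /andP[_ eP].
have sn := perms_size sP.
have en : size e = n.+1 by apply/eqP; rewrite -mem_bits.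
(* The head lies in the image of pi, so its complementary component is zero. In the remaining terms
   the head carries a label below n + 1. *)
have [e0|/negbTE e0] := boolP (nth false e 0); last first.
  case: e en e0 {eP} => [|b e] //= _ ->; rewrite pi_idem subrr.
  exact/(@multilinear0 _ _ _ _ [::])/sorted_value_lin/pbw_lin.
apply: (@sorted_value_pi _ n n.+1) => //.
- by rewrite size_labels.
- by rewrite size_proj.
- move=> k kn; rewrite nth_labels //; case: ifP => [ek _|_]; last by lia.
  rewrite nth_proj ?en ?wE // ek; exact: pi_idem.
- by rewrite -nth0 nth_labels // e0 perms_nth_lt.
Qed.

Context (Q : nat -> A -> Prop).
Context (Q_lin : forall k c a b, Q k a -> Q k b -> Q k (c *: a + b)).
Context (Q0 : forall k, Q k 0) (Q_S : forall k a, Q k a -> Q k.+1 a).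
Context (t_Q : forall w, Q (size w).+1 (t w)).

(** Sorting does not change t, and every correction is a value on a word shorter by one, hence of
    lower degree by induction. Here Q k is to be read as having degree less than k. *)
Lemma pbw_top n w : size w = n -> Q n (pbw n w - t w).
Proof.
have QD k a b : Q k a -> Q k b -> Q k (a + b).
  by move=> ? ?; rewrite -[a]scale1r; apply: Q_lin.
have QZ k c a : Q k a -> Q k (c *: a).
  by move=> ?; rewrite -[_ *: _]addr0; apply: Q_lin.
have Qsum k I (r : seq I) (P : pred I) (G : I -> A) :
    (forall i, P i -> Q k (G i)) -> Q k (\sum_(i <- r | P i) G i).
  by move=> GQ; elim/big_rec: _ => // i a Pi; apply: (QD); apply: GQ.
elim: n w => [|n IHn] w wn; first by rewrite subrr.
have IHQ v : size v = n -> Q n.+1 (pbw n v).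
  move=> vn; rewrite -[pbw n v](subrK (t v)); apply: (QD); first exact/Q_S/IHn.
  by rewrite -vn.
rewrite -[t w](average_const n.+1) /= /average wn -scalerBr -sumrB; apply: (QZ).
rewrite big_seq; apply: (Qsum) => s /perms_size sn.
rewrite -[in t w](sum_proj w t_lin) wn -sumrB big_seq; apply: (Qsum) => e.
rewrite mem_bits => /eqP en.
have := size_proj e w; have := size_labels sn en; rewrite wn.
move: (labels _ _ _) (proj e w) => s' v {s sn e en}.
elim/(@sorted_value_ind (pbw n)): s' v => [s _ sE v _ _|s i /andP[is_ _] sE IH v sn vn].
  by rewrite sE subrr.
rewrite sE addrAC -(t_swap i v); apply: (QD); first by apply: IH; rewrite size_swapl.
by apply: IHQ; rewrite size_contr vn // -sn.
Qed.

End PathSums.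

(** In the induced module the subalgebra acts first, from the right end of a word, whereas [pbw]
    vanishes on words that begin in the image of pi. Reversing the words turns one into the other
    and the bracket into its opposite [br']. *)
Lemma pbw_functional (F : numFieldType) (L A : lmodType F) (br : L -> L -> L)
    (pi : L -> L) (t : seq L -> A) (Q : nat -> A -> Prop) :
  (forall y, linear (br^~ y)) -> (forall x, linear (br x)) ->
  (forall x y, br x y = - br y x) ->
  (forall x y z, br x (br y z) = br (br x y) z + br y (br x z)) ->
  linear pi -> (forall x, pi (pi x) = pi x) ->
  (forall x y, pi (br (pi x) (pi y)) = br (pi x) (pi y)) ->
  multilinear t -> (forall w w', perm_eq w w' -> t w = t w') ->
  (forall x w, t (pi x :: w) = 0) ->
  (forall k c a b, Q k a -> Q k b -> Q k (c *: a + b)) -> (forall k, Q k 0) ->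
  (forall k a, Q k a -> Q k.+1 a) -> (forall w, Q (size w).+1 (t w)) ->
  exists h : seq L -> A,
    [/\ multilinear h,
        forall u x y v,
          h (u ++ x :: y :: v) - h (u ++ y :: x :: v) = h (u ++ br x y :: v),
        forall w x, h (rcons w (pi x)) = 0 &
        forall w, Q (size w) (h w - t w)].
Proof.
move=> brl brr anti jac pil pii pib tl tp tpi Ql Q0 QS tQ.
pose br' x y := br y x.
have anti' x y : br' x y = - br' y x by exact: anti.
have jac' x y z : br' (br' x y) z + br' y (br' x z) + br' (br' y z) x = 0.
  rewrite /br' jac [br (br z x) y]anti addrK [br (br z y) x]anti.
  by rewrite addNr.
have ts i w : t (swapl i w) = t w by exact/tp/perm_swapl.
have pib' x y : pi (br' (pi x) (pi y)) = br' (pi x) (pi y) by exact: pib.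
pose h w := pbw br' t pi (size w) (rev w).
have sE u x v : size (u ++ x :: v) = (size u + size v).+1.
  by rewrite size_cat /= addnS.
exists h; split.
- move=> c w0 w1 w2 l3; rewrite /h; have [-> ->] := lin3_size l3.
  apply: (@pbw_lin _ _ _ br') => //.
  have [u [x [y [v [-> -> ->]]]]] := lin3_slotP l3.
  by rewrite !rev_cat !rev_cons !cat_rcons; apply: lin3_slot.
- move=> u x y v; rewrite /h !sE /= addnS !rev_cat !rev_cons !cat_rcons.
  have := @pbw_swapl _ _ _ br' brr brl anti' jac' t tl pi pil
    (size u + size v).+2 (size (rev v))
    (rev v ++ y :: x :: rev u) _ _.
  rewrite swapl_size_cat contr_size_cat; apply; rewrite ?sE /= !size_rev; lia.
- move=> w x; rewrite /h size_rcons rev_rcons.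
  by apply: (@pbw_pi _ _ _ br') => //; rewrite size_rev.
move=> w; rewrite /h (tp w (rev w)); last by rewrite perm_sym perm_rev.
by apply: (@pbw_top _ _ _ br') => //; rewrite ?size_rev.
Qed.

(** * Quotients, direct sums and free algebras *)

Section LinearPredicate.
Context (F : fieldType) (V W : lmodType F) (f : V -> W) (f_lin : linear f).

(* Unlike [f_lin] itself, this equation can be rewritten with when V and W are
   concrete: it leaves no unfolded structure instances behind. *)
Lemma linP c u v : f (c *: u + v) = c *: f u + f v.
Proof. exact: f_lin. Qed.

Lemma lin0 : f 0 = 0.
Proof. by have := f_lin (-1) 0 0; rewrite scaler0 addr0 scaleN1r addNr. Qed.

Lemma linD u v : f (u + v) = f u + f v.
Proof. by have := f_lin 1 u v; rewrite !scale1r. Qed.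

Lemma linZ c v : f (c *: v) = c *: f v.
Proof. by have := f_lin c v 0; rewrite lin0 !addr0. Qed.

Lemma linN v : f (- v) = - f v.
Proof. by rewrite -scaleN1r linZ scaleN1r. Qed.

Lemma linB u v : f (u - v) = f u - f v.
Proof. by rewrite linD linN. Qed.

Lemma lin_sum I (r : seq I) (P : pred I) (G : I -> V) :
  f (\sum_(i <- r | P i) G i) = \sum_(i <- r | P i) f (G i).
Proof. by apply: (big_morph f linD lin0). Qed.

End LinearPredicate.

Lemma linear_comp (F : fieldType) (U V W : lmodType F) (f : V -> W) (g : U -> V) :
  linear f -> linear g -> linear (f \o g).
Proof. by move=> fl gl c x y; rewrite /= gl fl. Qed.

Lemma linear_lincomb (F : fieldType) (V W : lmodType F) (f g : V -> W) c :
  linear f -> linear g -> linear (fun v => c *: f v + g v).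
Proof.
move=> fl gl k x y; rewrite fl gl !scalerDr !scalerA [c * k]mulrC.
by rewrite addrACA.
Qed.

Lemma linear_sub (F : fieldType) (V W : lmodType F) (f g : V -> W) :
  linear f -> linear g -> linear (fun v => f v - g v).
Proof. by move=> fl gl k x y; rewrite fl gl opprD addrACA -scalerBr. Qed.

Section SpanQuotient.
Context (F : fieldType) (V : lmodType F).

Lemma span_ind (X : set V) (P : V -> Prop) :
  P 0 -> (forall c u v, X u -> P v -> P (c *: u + v)) ->
  forall v, v \in span X -> P v.
Proof.
move=> P0 PS v /asboolP[s sX ->]; elim: s sX => [|p s IHs] sX; rewrite ?big_nil //.
rewrite big_cons; apply: PS; first by apply: sX; rewrite mem_head.
by apply: IHs => q qs; apply: sX; rewrite inE qs orbT.
Qed.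

Context (S : subspace V).

Lemma qclass_lin : linear (qclass S).
Proof. by move=> c u v; rewrite -qclassD -qclassZ. Qed.

Lemma qclass_eq0 v : (qclass S v = 0) <-> (v \in S).
Proof.
have -> : 0 = qclass S 0 by rewrite (lin0 qclass_lin).
by split=> [/qclassP|vS]; [|apply/qclassP]; rewrite subr0.
Qed.

Lemma quot_ind (P : quotsp S -> Prop) : (forall v, P (qclass S v)) -> forall x, P x.
Proof. by move=> PS x; rewrite -[x]qclass_repr. Qed.

Lemma repr_qclass v : repr (qclass S v) - v \in S.
Proof. by apply/qclassP; rewrite qclass_repr. Qed.

Context (W : lmodType F) (f : V -> W) (f_lin : linear f).
Context (f_ker : forall v, v \in S -> f v = 0).

Lemma quot_lift_class v : f (repr (qclass S v)) = f v.
Proof. by apply/eqP; rewrite -subr_eq0 -linB // f_ker // repr_qclass. Qed.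

Lemma quot_lift_lin : linear (fun x : quotsp S => f (repr x)).
Proof.
move=> c; elim/quot_ind=> u; elim/quot_ind=> v.
by rewrite -qclass_lin !quot_lift_class f_lin.
Qed.

End SpanQuotient.

Section DirectSumLift.
Context (F : fieldType) (I : choiceType) (M : I -> lmodType F) (W : lmodType F).
Local Notation dsum := (@dsum F I M).

Lemma dcoef_lin i : linear (fun x : dsum => dcoef x i).
Proof. by []. Qed.

Lemma dsumP (x y : dsum) : (forall i, dcoef x i = dcoef y i) -> x = y.
Proof.
by move=> xy; apply/val_inj/functional_extensionality_dep => i; apply: xy.
Qed.

Lemma dcoef_dinj i (m : M i) : dcoef (dinj m) i = m.
Proof. by rewrite /dcoef SubK dfwith_in. Qed.

Lemma dcoef_dinj_neq i (m : M i) j : i != j -> dcoef (dinj m) j = 0.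
Proof. by move=> ij; rewrite /dcoef SubK dfwith_out. Qed.

Lemma dinj_lin i : linear (@dinj F I M i).
Proof.
move=> c u v; apply: dsumP => j; rewrite dcoef_lin.
have [<-|ij] := eqVneq i j; first by rewrite !dcoef_dinj.
by rewrite !dcoef_dinj_neq // scaler0 addr0.
Qed.

Lemma mem_dsupp (x : dsum) i : (i \in dsupp x) = (dcoef x i != 0).
Proof.
have fx : finite_set [set i | dcoef x i != 0]%classic.
  by have /asboolP := valP x.
by rewrite in_fset_set // ; apply/idP/idP => [/set_mem|/mem_set].
Qed.

Lemma dsumE (x : dsum) : x = \sum_(i <- dsupp x) dinj (dcoef x i).
Proof.
apply: dsumP => i; rewrite (lin_sum (dcoef_lin i)).
have [ix|ix] := boolP (i \in dsupp x).
  rewrite (big_fsetD1 i) //= dcoef_dinj big1_fset ?addr0 // => j.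
  by rewrite !inE => /andP[ji _] _; rewrite dcoef_dinj_neq.
rewrite big1_fset => [|j jx _].
  by apply/eqP; rewrite mem_dsupp negbK in ix.
by rewrite dcoef_dinj_neq //; apply: contraNneq ix => <-.
Qed.

Context (phi : forall i, M i -> W).

Definition dlift (x : dsum) : W := \sum_(i <- dsupp x) phi (dcoef x i).

Context (phi_lin : forall i, linear (@phi i)).

Lemma dlift_wide (x : dsum) (D : {fset I}) : (dsupp x `<=` D)%fset ->
  dlift x = \sum_(i <- D) phi (dcoef x i).
Proof.
move=> xD; rewrite /dlift; apply: big_fset_incl => // i _.
by rewrite mem_dsupp negbK => /eqP ->; rewrite lin0.
Qed.

Lemma dlift_lin : linear dlift.
Proof.
move=> c x y; pose D := (dsupp x `|` dsupp y `|` dsupp (c *: x + y)%R)%fset.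
rewrite !(@dlift_wide _ D);
  try by apply/fsubsetP => i; rewrite !in_fsetU => ->; rewrite ?orbT.
rewrite scaler_sumr -big_split; apply: eq_bigr => i _ /=.
by rewrite dcoef_lin phi_lin.
Qed.

Lemma dlift_dinj i (m : M i) : dlift (dinj m) = phi m.
Proof.
rewrite (@dlift_wide _ [fset i]%fset) ?big_seq_fset1 ?dcoef_dinj //.
apply/fsubsetP => j; rewrite mem_dsupp inE; apply: contraR.
by rewrite eq_sym => /dcoef_dinj_neq ->.
Qed.

End DirectSumLift.

Lemma dsum_ind (F : fieldType) (I : choiceType) (M : I -> lmodType F)
    (P : @dsum F I M -> Prop) :
  P 0 -> (forall x y, P x -> P y -> P (x + y)) -> (forall i (m : M i), P (dinj m)) ->
  forall x, P x.
Proof.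
move=> P0 PD Pi x; rewrite [x]dsumE.
by elim/big_rec: _ => // i y _; apply: PD.
Qed.

Section MalgLift.
Context (F : fieldType) (K : choiceType) (W : lmodType F) (h : K -> W).

Definition malg_lift (g : {malg F[K]}) : W := \sum_(k <- msupp g) g@_k *: h k.

Lemma malg_lift_wide (g : {malg F[K]}) (D : {fset K}) : (msupp g `<=` D)%fset ->
  malg_lift g = \sum_(k <- D) g@_k *: h k.
Proof.
move=> gD; apply: big_fset_incl => // k _ /mcoeff_outdom ->.
by rewrite scale0r.
Qed.

Lemma malg_lift_lin : linear malg_lift.
Proof.
move=> c x y; pose D := (msupp x `|` msupp y `|` msupp (c *: x + y)%R)%fset.
rewrite !(@malg_lift_wide _ D);
  try by apply/fsubsetP => i; rewrite !in_fsetU => ->; rewrite ?orbT.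
rewrite scaler_sumr -big_split; apply: eq_bigr => i _ /=.
by rewrite mcoeffD mcoeffZ scalerDl scalerA.
Qed.

Lemma malg_liftU k : malg_lift << k >> = h k.
Proof.
rewrite (@malg_lift_wide _ [fset k]%fset) ?msuppU_le // big_seq_fset1.
by rewrite mcoeffUU scale1r.
Qed.

End MalgLift.

Lemma malg_ind (F : fieldType) (K : choiceType) (P : {malg F[K]} -> Prop) :
  P 0 -> (forall c k x, P x -> P (c *: << k >> + x)) -> forall x, P x.
Proof.
move=> P0 PS x; rewrite [x]monalgE; elim/big_rec: _ => // k y _.
suff -> : << x@_k *g k >> = x@_k *: (<< k >> : {malg F[K]}) by exact: PS.
by apply/malgP => k'; rewrite mcoeffZ !mcoeffU mulr_natr.
Qed.

Lemma malg_lin0 (F : fieldType) (K : choiceType) (W : lmodType F)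
    (f : {malg F[K]} -> W) :
  linear f -> (forall k, f << k >> = 0) -> forall x, f x = 0.
Proof.
move=> fl f0; apply: malg_ind => [|c k x fx]; first exact: lin0.
by rewrite fl f0 fx scaler0 addr0.
Qed.

Section EnvelopingLift.
Context (F : fieldType) (L : lmodType F) (br : L -> L -> L).
Local Notation free_alg := {malg F[{fmonom L}]}.
Local Notation gen := (env_gen br).

Lemma free_wordE (w : seq L) :
  \prod_(x <- w) free_gen x = << FMonom w >> :> free_alg.
Proof.
elim: w => [|x w IHw]; first by rewrite big_nil -fmoneE.
rewrite big_cons IHw malgM_def fgmulUU mulr1; congr << _ >>.
by apply/eqP; rewrite fmP fmM fmU.
Qed.

Lemma free_monomE (k : {fmonom L}) : << k >> = \prod_(x <- k) free_gen x :> free_alg.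
Proof. by rewrite free_wordE fmK. Qed.

Lemma env_rel_mem r : env_rel br r -> r \in env_ideal br.
Proof. by move=> rr; apply: mem_span; exists 1, r, 1; rewrite mul1r mulr1. Qed.

Lemma env_genD x y : gen (x + y) = gen x + gen y.
Proof. by rewrite /env_gen qclassD; apply/qclassP/env_rel_mem/env_relD. Qed.

Lemma env_genZ c x : gen (c *: x) = c *: gen x.
Proof. by rewrite /env_gen env_classZ; apply/qclassP/env_rel_mem/env_relZ. Qed.

Lemma env_gen_lin : linear gen.
Proof. by move=> c x y; rewrite env_genD env_genZ. Qed.

Lemma env_gen_br x y : gen x * gen y - gen y * gen x = gen (br x y).
Proof.
rewrite /env_gen !env_classM -(linB (qclass_lin _)).
exact/qclassP/env_rel_mem/env_rel_br.
Qed.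

Lemma env_wordE (w : seq L) :
  \prod_(x <- w) gen x = qclass (env_ideal br) (\prod_(x <- w) free_gen x).
Proof.
elim: w => [|x w IHw]; first by rewrite !big_nil.
by rewrite !big_cons IHw /env_gen env_classM.
Qed.

Lemma env_ind (P : env_alg br -> Prop) :
  P 0 -> (forall c w u, P u -> P (c *: \prod_(x <- w) gen x + u)) -> forall u, P u.
Proof.
move=> P0 PS; apply: quot_ind; apply: malg_ind => [|c k u Pu].
  by rewrite (lin0 (qclass_lin _)).
by rewrite qclass_lin free_monomE -env_wordE; apply: PS.
Qed.

Section Lift.
Context (M : lmodType F) (h : seq L -> M) (h_lin : multilinear h).
Context (h_br : forall u x y v,
  h (u ++ x :: y :: v) - h (u ++ y :: x :: v) = h (u ++ br x y :: v)).

(** The target has no product, so the values are prescribed on words rather than on generators. The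
    exchange relation [h_br] makes them compatible with the relations of the enveloping algebra. *)
Definition env_word_lift (u : env_alg br) : M :=
  malg_lift (fun k : {fmonom L} => h k) (repr u).

Lemma malg_lift_word w :
  malg_lift (fun k : {fmonom L} => h k) (\prod_(x <- w) free_gen x) = h w.
Proof. by rewrite free_wordE malg_liftU. Qed.

(** By linearity the outer factors a and b may be taken to be words; each defining relation placed
    between two words is then killed by multilinearity or by the exchange relation. *)
Lemma env_ideal_lin0 (H : free_alg -> M) : linear H ->
  (forall w, H (\prod_(x <- w) free_gen x) = h w) ->
  forall g, g \in env_ideal br -> H g = 0.
Proof.
move=> Hl E g; elim/span_ind=> [|c u v [a [r [b [rr ->]]]] Hv]; first exact: lin0.
rewrite Hl Hv addr0.
suff -> : H (a * r * b) = 0 by rewrite scaler0.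
apply: (@malg_lin0 _ _ _ (fun a => H (a * r * b))) => {a} [d a a'|k].
  by rewrite mulrDl mulrDl -(scalerAl d a r) -(scalerAl d _ b) Hl.
apply: (@malg_lin0 _ _ _ (fun b => H (<< k >> * r * b))) => {b} [d b b'|l].
  by rewrite mulrDr -(malg_scaleAr d _ b) Hl.
rewrite !free_monomE.
(* [Hm] is hidden behind an existential, so that rewriting does not see through the products. *)
have [Hm [HmE Hml]] : exists Hm : free_alg -> M,
    (forall u, Hm u = H (\prod_(x <- k) free_gen x * u * \prod_(x <- l) free_gen x))
    /\ linear Hm.
  exists (fun u => H (\prod_(x <- k) free_gen x * u * \prod_(x <- l) free_gen x)).
  split=> // d u' v'; rewrite mulrDr -(malg_scaleAr d _ u') mulrDl.
  by rewrite -(scalerAl d _ (\prod_(y <- l) _)) Hl.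
rewrite -HmE.
have E1 x : Hm (free_gen x) = h (k ++ x :: l).
  by rewrite HmE -E big_cat /= big_cons mulrA.
have E2 x y : Hm (free_gen x * free_gen y) = h (k ++ x :: y :: l).
  by rewrite HmE -E big_cat /= 2!big_cons -mulrA -[in LHS]mulrA.
case: rr => [x y|d x|x y].
- rewrite (linB Hml) (linD Hml) (E1 (x + y)) (E1 x) (E1 y).
  by rewrite multilinearD // subrr.
- by rewrite (linB Hml) (linZ Hml) (E1 (d *: x)) (E1 x) multilinearZ // subrr.
- rewrite (linB Hml (free_gen x * free_gen y - free_gen y * free_gen x)).
  rewrite (linB Hml (free_gen x * free_gen y) (free_gen y * free_gen x)).
  by rewrite (E2 x y) (E2 y x) (E1 (br x y)) -h_br subrr.
Qed.

Lemma env_word_ker g :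
  g \in env_ideal br -> malg_lift (fun k : {fmonom L} => h k) g = 0.
Proof. exact: (env_ideal_lin0 (malg_lift_lin _) malg_lift_word). Qed.

Lemma env_word_lift_lin : linear env_word_lift.
Proof. by apply: quot_lift_lin; [exact: malg_lift_lin|exact: env_word_ker]. Qed.

Lemma env_word_liftE w : env_word_lift (\prod_(x <- w) gen x) = h w.
Proof.
rewrite env_wordE /env_word_lift quot_lift_class ?malg_lift_word //.
  exact: malg_lift_lin.
exact: env_word_ker.
Qed.

End Lift.

Lemma linear_env_ext (M : lmodType F) (f g : env_alg br -> M) :
  linear f -> linear g ->
  (forall w, f (\prod_(x <- w) gen x) = g (\prod_(x <- w) gen x)) -> f =1 g.
Proof.
move=> fl gl fg; apply: env_ind => [|c w u IHu]; first by rewrite !lin0.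
by rewrite fl gl fg IHu.
Qed.

Lemma multilinear_prod (A : algType F) (g : L -> A) :
  linear g -> multilinear (fun w => \prod_(x <- w) g x).
Proof.
move=> gl c w0 w1 w2; elim=> [x y v|z ? ? ? _ IH]; rewrite !big_cons.
  by rewrite gl mulrDl scalerAl.
by rewrite IH mulrDr scalerAr.
Qed.

End EnvelopingLift.

(** * The Lie algebra L(R) *)

Lemma fsbig_nat_trunc (V : nmodType) (G : nat -> V) N :
  (forall i, (N <= i)%N -> G i = 0) ->
  \sum_(i \in [set: nat]) G i = \sum_(i < N) G i.
Proof.
move=> G0; rewrite (fsbig_ord _ _ G) //; symmetry; apply: fsbig_widen => //.
by move=> i /= [_] /negP; rewrite -leqNgt => /G0.
Qed.

(** As U vanishes from N on, the square of index pairs may be cut down to its antidiagonals i + j =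
    k < N. *)
Lemma diagonal_sum (F : fieldType) (V : lmodType F) N (c : nat -> nat -> F)
    (U : nat -> V) : (forall k, (N <= k)%N -> U k = 0) ->
  \sum_(i < N) \sum_(j < N) c i j *: U (i + j)%N =
  \sum_(k < N) (\sum_(i < k.+1) c i (k - i)%N) *: U k.
Proof.
move=> U0.
have E1 (i j : nat) :
    (\sum_(k < N | k == (i + j)%N :> nat) c i j *: U k) = c i j *: U (i + j)%N.
  rewrite (@big_ord1_eq _ _ _ (fun k => c i j *: U k)); case: ltnP => // /U0 ->.
  by rewrite scaler0.
under eq_bigr => i _ do under eq_bigr => j _ do rewrite -E1.
under eq_bigr => i _ do rewrite (exchange_big_dep predT) //=.
rewrite exchange_big /=; apply: eq_bigr => k _; rewrite scaler_suml.
rewrite (big_ord_widen _ (fun i => c i (k - i)%N *: U k) (ltn_ord k)).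
rewrite [RHS]big_mkcond; apply: eq_bigr => i _; rewrite ltnS.
case: leqP => [ik|ki]; last by rewrite big_pred0 // => j; apply/eqP; lia.
rewrite (eq_bigl (fun j : 'I_N => j == (k - i)%N :> nat)) => [|j]; last by lia.
rewrite (@big_ord1_eq _ _ _ (fun j => c i j *: U k)) ifT //.
by have := ltn_ord k; lia.
Qed.

Lemma shifted_sum (V : nmodType) K s (G : nat -> V) :
  (forall j, (K <= j)%N -> G j = 0) ->
  \sum_(j < K | (s <= j)%N) G j = \sum_(j < K) G (s + j)%N.
Proof.
move=> G0; symmetry.
have E1 (j : nat) : \sum_(k < K | k == (s + j)%N :> nat) G k = G (s + j)%N.
  by rewrite (@big_ord1_eq _ _ _ G); case: ltnP => // /G0.
under eq_bigr => j _ do rewrite -E1.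
rewrite (exchange_big_dep predT) //= [RHS]big_mkcond; apply: eq_bigr => k _.
case: leqP => [sk|ks]; last by rewrite big_pred0 // => j; apply/eqP; lia.
rewrite (eq_bigl (fun j : 'I_K => j == (k - s)%N :> nat)) => [|j]; last by lia.
rewrite (@big_ord1_eq _ _ _ (fun=> G k)) ifT //.
by have := ltn_ord k; lia.
Qed.

Section LoopLie.
Context (F : numFieldType) (R : vertexLie F).
Local Notation binz := (binz F).
Local Notation d := (@vl_d F R).
Local Notation pr := (@vl_pr F R).
Local Notation LR := (LR R).

Let d_lin : linear d := vl_d_lin (vlP R).
Let pr_linl n b : linear (fun a => pr a n b) := vl_linl (vlP R) n b.
Let pr_linr a n : linear (pr a n) := vl_linr (vlP R) a n.

Let fact_neq0 i : (i`!)%:R != 0 :> F.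
Proof. by rewrite pnatr_eq0 -lt0n fact_gt0. Qed.

Lemma pr_trunc (a b : R) : exists N, forall n, (N <= n)%N -> pr a n b = 0.
Proof. exact: (vl_C0 (vlP R)). Qed.

Lemma loop_mon_lin n : linear (fun a => loop_mon (R := R) a n).
Proof. exact: dinj_lin. Qed.

Lemma Lmode_lin n : linear (fun a => Lmode (R := R) a n).
Proof. by move=> c a b; rewrite /Lmode loop_mon_lin qclass_lin. Qed.

Lemma iter_d_lin j : linear (iter j d).
Proof. by elim: j => [|j IHj] // c a b; rewrite !iterS IHj d_lin. Qed.

Let loop_d_term n (a : R) : loop R :=
  loop_mon (d a) n + loop_mon (n%:~R *: a) (n - 1).

Let loop_d_term_lin n : linear (loop_d_term n).
Proof.
move=> c a b; rewrite /loop_d_term d_lin scalerDr !scalerA [_ * c]mulrC -scalerA.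
by rewrite !loop_mon_lin addrACA -scalerDr.
Qed.

(** Sums over [dsupp] are instances of [dlift] by conversion, which is how linearity is obtained for
    [loop_d] here and for the graded maps later. *)
Lemma loop_dE f : loop_d f = dlift loop_d_term f.
Proof. by []. Qed.

Lemma loop_d_mon a n :
  loop_d (loop_mon (R := R) a n) = loop_mon (d a) n + loop_mon (n%:~R *: a) (n - 1).
Proof. by rewrite loop_dE dlift_dinj. Qed.

Lemma loop_d_lin : linear (@loop_d F R).
Proof. exact: (dlift_lin loop_d_term_lin). Qed.

Lemma Lmode_d a n : Lmode (d a) n = - n%:~R *: Lmode (R := R) a (n - 1).
Proof.
apply/eqP; rewrite scaleNr -subr_eq0 opprK -(linZ (Lmode_lin _)).
apply/eqP; rewrite /Lmode -(linD (qclass_lin _)) -loop_d_mon.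
by apply/qclass_eq0/mem_span; exists (loop_mon a n).
Qed.

Lemma Lmode_iter_d j a n : Lmode (iter j d a) n =
  ((-1) ^+ j * (j`!)%:R * binz n j) *: Lmode (R := R) a (n - j%:Z).
Proof.
elim: j n => [|j IHj] n; first by rewrite binz0 !mulr1 scale1r subr0.
rewrite iterS Lmode_d IHj scalerA -addrA -opprD -PoszD add1n; congr (_ *: _).
rewrite exprS factS natrM -[_ * (_ * _) * binz _ _]mulrA.
rewrite [j.+1%:R * _]mulrC -[_ * j.+1%:R * _]mulrA binz_absorb.
by ring.
Qed.

Lemma LR_ind (P : LR -> Prop) :
  P 0 -> (forall x y, P x -> P y -> P (x + y)) -> (forall a n, P (Lmode a n)) ->
  forall x, P x.
Proof.
move=> P0 PD Pm; apply: quot_ind; apply: dsum_ind => [|x y Px Py|n a].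
- by rewrite (lin0 (qclass_lin _)).
- by rewrite (linD (qclass_lin _)); apply: PD.
- exact: Pm.
Qed.

Lemma linear_LR_ext (W : lmodType F) (f g : LR -> W) : linear f -> linear g ->
  (forall a n, f (Lmode a n) = g (Lmode a n)) -> f =1 g.
Proof.
move=> fl gl fg; apply: LR_ind => [|x y IHx IHy|//]; first by rewrite !lin0.
by rewrite !linD // IHx IHy.
Qed.

Definition mode_br (a : R) (m : int) (b : R) (n : int) : LR :=
  \sum_(i \in [set: nat]) binz m i *: Lmode (pr a i b) (m + n - i%:Z).

Lemma mode_brE N a m b n : (forall i, (N <= i)%N -> pr a i b = 0) ->
  mode_br a m b n = \sum_(i < N) binz m i *: Lmode (pr a i b) (m + n - i%:Z).
Proof.
move=> ab0; apply: fsbig_nat_trunc => i /ab0 ->.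
by rewrite (lin0 (Lmode_lin _)) scaler0.
Qed.

Lemma mode_br_linl m b n : linear (fun a => mode_br a m b n).
Proof.
move=> c a a'; have [N aN] := pr_trunc a b; have [N' aN'] := pr_trunc a' b.
have H i : (maxn N N' <= i)%N -> pr a i b = 0 /\ pr a' i b = 0.
  by rewrite geq_max => /andP[? ?]; rewrite aN ?aN'.
rewrite !(@mode_brE (maxn N N')); try by move=> i /H [].
  rewrite scaler_sumr -big_split; apply: eq_bigr => i _ /=.
  by rewrite pr_linl Lmode_lin scalerDr !scalerA [c * _]mulrC.
by move=> i /H[h h']; rewrite pr_linl h h' scaler0 addr0.
Qed.

(** Skew symmetry (C2) writes a_i b through the d^j (b_(i+j) a); in L(R) the powers of d turn into
    binomial factors. Collecting the terms with i + j = k leaves the sum evaluated in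
    [binz_alternating_sum]. *)
Lemma mode_br_anti a m b n : mode_br a m b n = - mode_br b n a m.
Proof.
have [N aN] := pr_trunc a b; have [N' bN] := pr_trunc b a.
pose M := maxn N N'.
have aM i : (M <= i)%N -> pr a i b = 0 by rewrite geq_max => /andP[/aN].
have bM i : (M <= i)%N -> pr b i a = 0 by rewrite geq_max => /andP[_ /bN].
rewrite (mode_brE _ _ aM) (mode_brE _ _ bM).
pose U k := Lmode (pr b k a) (m + n - k%:Z).
have U0 k : (M <= k)%N -> U k = 0.
  by move=> /bM; rewrite /U => ->; rewrite (lin0 (Lmode_lin _)).
transitivity (\sum_(i < M) \sum_(j < M)
    ((-1) ^+ i.+1 * binz m i * binz (m + n - i%:Z) j) *: U (i + j)%N).
  apply: eq_bigr => i _; rewrite (vl_C2 (vlP R)) (@fsbig_nat_trunc _ _ M).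
    rewrite (lin_sum (Lmode_lin _)) scaler_sumr; apply: eq_bigr => j _.
    rewrite (linZ (Lmode_lin _)) Lmode_iter_d !scalerA /U PoszD opprD addrA.
    congr (_ *: _); rewrite addn1 -addSn exprD.
    move: (sqrr_sign F j) => s2.
    move: ((-1) ^+ j) ((-1) ^+ i.+1) (binz m i) (binz _ j) s2 => s s' x y s2.
    transitivity (s ^+ 2 * (s' * x * y)); last by rewrite s2 mul1r.
    by field; rewrite fact_neq0.
  move=> j Mj; rewrite bM ?(leq_trans Mj) ?leq_addl //.
  by rewrite (lin0 (iter_d_lin _)) scaler0.
rewrite (@diagonal_sum _ _ M
  (fun i j => (-1) ^+ i.+1 * binz m i * binz (m + n - i%:Z) j)) // -sumrN.
apply: eq_bigr => k _; rewrite -(binz_alternating_sum F m) -scaleNr -sumrN /U.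
rewrite [n + m]addrC; congr (_ *: _); apply: eq_bigr => i _.
by rewrite exprS !mulN1r !mulNr.
Qed.

Lemma mode_br_linr a m n : linear (fun b => mode_br a m b n).
Proof.
move=> c b b'; rewrite ![mode_br a m _ n]mode_br_anti (mode_br_linl n a m).
by rewrite opprD scalerN.
Qed.

(** (C1) lowers the index of the product, and the factors match by (i + 1) binom(m, i + 1) = m
    binom(m - 1, i). *)
Lemma mode_br_d a m b n :
  mode_br (d a) m b n + m%:~R *: mode_br a (m - 1) b n = 0.
Proof.
have [N aN] := pr_trunc a b.
have dE i : pr (d a) i b = - (i%:R *: pr a i.-1 b) := vl_C1 (vlP R) a i b.
rewrite (@mode_brE N.+1) ?(mode_brE _ _ aN); last first.
  by case=> // i /aN; rewrite dE /= => ->; rewrite scaler0 oppr0.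
rewrite big_ord_recl dE scale0r oppr0 (lin0 (Lmode_lin _)) scaler0 add0r.
rewrite scaler_sumr -big_split big1 //= => i _; rewrite dE /=.
rewrite -scaleNr (linZ (Lmode_lin _)) !scalerA.
rewrite (_ : m - 1 + n - i%:Z = m + n - (bump 0 i)%:Z); last by rewrite /bump; lia.
rewrite -scalerDl /bump add1n mulrN [_ * _.+1%:R]mulrC binz_absorb.
by rewrite addNr scale0r.
Qed.

(** The values are taken in the quotient from the outset because antisymmetry holds only there. It
    is antisymmetry that reduces compatibility with [loop_d] in the second argument to the first
    one. *)
Definition loop_mode_br (f g : loop R) : LR :=
  dlift (fun m a => dlift (fun n b => mode_br a m b n) g) f.

Lemma loop_mode_br_linl g : linear (loop_mode_br^~ g).
Proof.
apply: dlift_lin => m c a a'; rewrite /dlift scaler_sumr -big_split.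
by apply: eq_bigr => n _ /=; rewrite mode_br_linl.
Qed.

Lemma loop_mode_br_linr f : linear (loop_mode_br f).
Proof.
move=> c g g'; rewrite /loop_mode_br /dlift scaler_sumr -big_split.
apply: eq_bigr => m _ /=.
exact: (dlift_lin (fun n => mode_br_linr (dcoef f m) m n)).
Qed.

Lemma loop_mode_br_mon a m b n :
  loop_mode_br (loop_mon a m) (loop_mon b n) = mode_br a m b n.
Proof.
rewrite /loop_mode_br (dlift_dinj (phi := fun m a => _)).
  by rewrite (dlift_dinj (phi := fun n b => mode_br a m b n)) // => ?; apply: mode_br_linr.
move=> i c x y; rewrite /dlift scaler_sumr -big_split.
by apply: eq_bigr => j _ /=; rewrite mode_br_linl.
Qed.

Lemma linear_loop0 (W : lmodType F) (f : loop R -> W) : linear f ->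
  (forall a n, f (loop_mon a n) = 0) -> forall x, f x = 0.
Proof.
move=> fl f0; apply: dsum_ind => [|x y fx fy|n a]; first exact: lin0.
  by rewrite linD // fx fy addr0.
exact: f0.
Qed.

Lemma loop_mode_br_kerl f g :
  f \in span (range (@loop_d F R)) -> loop_mode_br f g = 0.
Proof.
elim/span_ind=> [|c u v [u' _ <-] IHv]; first exact: (lin0 (loop_mode_br_linl g)).
rewrite loop_mode_br_linl IHv addr0.
suff -> : loop_mode_br (loop_d u') g = 0 by rewrite scaler0.
apply: (@linear_loop0 _ (fun u => loop_mode_br (loop_d u) g)) => [e x y|a m].
  by rewrite loop_d_lin loop_mode_br_linl.
apply: (linear_loop0 (loop_mode_br_linr _)) => b n.
rewrite loop_d_mon (linD (loop_mode_br_linl _)) !loop_mode_br_mon.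
by rewrite (linZ (mode_br_linl _ _ _)) mode_br_d.
Qed.

Lemma loop_mode_br_kerr f g :
  g \in span (range (@loop_d F R)) -> loop_mode_br f g = 0.
Proof.
elim/span_ind=> [|c u v [u' _ <-] IHv]; first exact: (lin0 (loop_mode_br_linr f)).
rewrite loop_mode_br_linr IHv addr0.
suff -> : loop_mode_br f (loop_d u') = 0 by rewrite scaler0.
apply: (@linear_loop0 _ (fun u => loop_mode_br f (loop_d u))) => [e x y|b n].
  by rewrite loop_d_lin loop_mode_br_linr.
apply: (linear_loop0 (loop_mode_br_linl _)) => a m.
rewrite loop_d_mon (linD (loop_mode_br_linr _)) !loop_mode_br_mon.
rewrite !(mode_br_anti a m) (linZ (mode_br_linl _ _ _)) -opprD.
by rewrite mode_br_d oppr0.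
Qed.

Lemma qclass_loop_br f g :
  qclass (span (range (@loop_d F R))) (loop_br f g) = loop_mode_br f g.
Proof.
rewrite /loop_br (lin_sum (qclass_lin _)); apply: eq_bigr => m _.
rewrite (lin_sum (qclass_lin _)); apply: eq_bigr => n _.
have [N abN] := pr_trunc (dcoef f m) (dcoef g n).
rewrite (mode_brE _ _ abN) (@fsbig_nat_trunc _ _ N) => [|i /abN ->]; last first.
  by rewrite scaler0 (lin0 (loop_mon_lin _)).
rewrite (lin_sum (qclass_lin _)); apply: eq_bigr => i _.
by rewrite -(linZ (Lmode_lin _)).
Qed.

Lemma Lbr_class f g :
  Lbr (qclass _ f : LR) (qclass _ g : LR) = loop_mode_br f g.
Proof.
rewrite /Lbr qclass_loop_br.
rewrite (quot_lift_class (loop_mode_br_linl _)) => [|v]; last exact: loop_mode_br_kerl.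
by rewrite (quot_lift_class (loop_mode_br_linr _)) => // v; exact: loop_mode_br_kerr.
Qed.

Lemma Lbr_mode a m b n : Lbr (Lmode a m) (Lmode b n) = mode_br a m b n.
Proof. by rewrite Lbr_class loop_mode_br_mon. Qed.

Lemma Lbr_linl y : linear (fun x : LR => Lbr x y).
Proof.
move=> c; elim/quot_ind=> u; elim/quot_ind=> v; move: y; elim/quot_ind=> w.
by rewrite -qclass_lin !Lbr_class loop_mode_br_linl.
Qed.

Lemma Lbr_linr x : linear (Lbr (R := R) x).
Proof.
move=> c; elim/quot_ind=> u; elim/quot_ind=> v; move: x; elim/quot_ind=> w.
by rewrite -qclass_lin !Lbr_class loop_mode_br_linr.
Qed.

Lemma Lbr_anti (x y : LR) : Lbr x y = - Lbr y x.
Proof.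
move: x; apply: linear_LR_ext => [|c u v|a m]; first exact: Lbr_linl.
  by rewrite Lbr_linr opprD scalerN.
move: y; apply: linear_LR_ext => [|c u v|b n]; first exact: Lbr_linr.
  by rewrite Lbr_linl opprD scalerN.
by rewrite !Lbr_mode mode_br_anti.
Qed.

(** Only finitely many g i can be nonzero, so finitely many truncation bounds have a maximum. *)
Lemma uniform_trunc (f : R -> nat -> R) (g : nat -> R) N :
    (forall x, exists M, forall j, (M <= j)%N -> f x j = 0) -> (forall j, f 0 j = 0) ->
  (forall i, (N <= i)%N -> g i = 0) ->
  exists M, forall i j, (M <= j)%N -> f (g i) j = 0.
Proof.
move=> f_trunc f0 g0.
have [M HM] : exists M, forall i j, (i < N)%N -> (M <= j)%N -> f (g i) j = 0.
  elim: N {g0} => [|N [M IH]]; first by exists 0%N.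
  have [M' HM'] := f_trunc (g N); exists (maxn M M') => i j.
  rewrite ltnS geq_max leq_eqVlt => /predU1P[->|iN] /andP[Mj M'j]; first exact: HM'.
  exact: IH.
by exists M => i j Mj; have [Ni|iN] := leqP N i; [rewrite g0 ?f0 | apply: HM].
Qed.

Lemma Lbr_mode_r K a m b n c p :
  (forall i, (K <= i)%N -> pr b i c = 0) ->
  (forall i j, (K <= j)%N -> pr a j (pr b i c) = 0) ->
  Lbr (Lmode a m) (mode_br b n c p) = \sum_(i < K) \sum_(j < K)
    (binz n i * binz m j) *: Lmode (pr a j (pr b i c)) (m + n + p - (i + j)%N%:Z).
Proof.
move=> bc abc; rewrite (mode_brE _ _ bc) (lin_sum (Lbr_linr _)).
apply: eq_bigr => i _; rewrite (linZ (Lbr_linr _)) Lbr_mode (mode_brE _ _ (abc i)).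
rewrite scaler_sumr; apply: eq_bigr => j _; rewrite scalerA; congr (_ *: Lmode _ _).
by lia.
Qed.

(** (C3) produces the terms (a_s b)_(i+j-s) c with coefficient binom(n, i) binom(m, j) binom(j, s).
    Trinomial revision replaces the last two factors by binom(m, s) binom(m - s, j - s); after
    shifting j by s, Vandermonde's identity along the antidiagonals gives binom(m + n - s, k), the
    coefficient on the right. *)
Lemma Lbr_jacobi_mode a m b n c p :
  Lbr (Lmode a m) (mode_br b n c p) - Lbr (Lmode b n) (mode_br a m c p) =
  Lbr (mode_br a m b n) (Lmode c p).
Proof.
have [M1 bc] := pr_trunc b c; have [M2 ac] := pr_trunc a c.
have [M3 ab] := pr_trunc a b.
have [M4 abc] := uniform_trunc (pr_trunc a) (fun j => lin0 (pr_linr a j)) bc.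
have [M5 bac] := uniform_trunc (pr_trunc b) (fun j => lin0 (pr_linr b j)) ac.
have [M6 ab_c] := uniform_trunc (fun x => pr_trunc x c) (fun j => lin0 (pr_linl j c)) ab.
have [M [H1 H2 H3 [H4 H5 H6]]] : exists M,
    [/\ M1 <= M, M2 <= M, M3 <= M & [/\ M4 <= M, M5 <= M & M6 <= M]]%N.
  by exists (M1 + M2 + M3 + M4 + M5 + M6)%N; split; [..|split]; lia.
(* M bounds every single product. The bound is doubled because a nonzero (a_s b)_(i+j-s) c has s < M
   and i + j - s < M, hence i + j < K: cutting all sums at K loses nothing, even after the shift by
   s. *)
have [K KE] : exists K, K = (M + M)%N by exists (M + M)%N.
rewrite (@Lbr_mode_r K) => [|i Ki|i j Kj]; [|apply: bc; lia|apply: abc; lia].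
rewrite (@Lbr_mode_r K) => [|i Ki|i j Kj]; [|apply: ac; lia|apply: bac; lia].
rewrite (@mode_brE K) => [|i Ki]; last by apply: ab; lia.
rewrite (lin_sum (Lbr_linl _)).
pose T s k := Lmode (pr (pr a s b) k c) (m + n + p - (s + k)%N%:Z).
have T0l s k : (M <= s)%N -> T s k = 0.
  move=> Ms; rewrite /T ab; last by lia.
  by rewrite (lin0 (pr_linl _ _)) (lin0 (Lmode_lin _)).
have T0r s k : (M <= k)%N -> T s k = 0.
  move=> Mk; rewrite /T ab_c; last by lia.
  exact: (lin0 (Lmode_lin _)).
transitivity (\sum_(s < K) \sum_(i < K) \sum_(j < K | (s <= j)%N)
    (binz n i * (binz m j * 'C(j, s)%:R)) *: T s (j + i - s)%N).
  rewrite [X in _ - X]exchange_big -sumrB.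
  rewrite [RHS]exchange_big; apply: eq_bigr => i _; rewrite -sumrB.
  rewrite (exchange_big_dep predT) //=; apply: eq_bigr => j _.
  rewrite [binz m j * binz n i]mulrC [n + m]addrC [in X in _ - X]addnC.
  rewrite -scalerBr -(linB (Lmode_lin _)).
  rewrite (vl_C3 (vlP R)) (lin_sum (Lmode_lin _)) scaler_sumr.
  rewrite (big_ord_widen K (fun s => (binz n i * binz m j) *:
    Lmode ('C(j, s)%:R *: pr (pr a s b) (j + i - s) c) (m + n + p - (i + j)%N%:Z))) //.
  apply: eq_big => // s; rewrite ltnS => sj.
  rewrite (linZ (Lmode_lin _)) scalerA mulrA /T; congr (_ *: Lmode _ _).
  by lia.
apply: eq_bigr => s _; rewrite (linZ (Lbr_linl _)) Lbr_mode.
rewrite (@mode_brE K) => [|i Ki]; last by apply: ab_c; lia.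
have [Ms|sM] := leqP M s.
  rewrite big1 => [|i _]; last by rewrite big1 // => j _; rewrite T0l ?scaler0.
  rewrite big1 ?scaler0 // => i _; rewrite ab; last by lia.
  by rewrite (lin0 (pr_linl _ _)) (lin0 (Lmode_lin _)) scaler0.
transitivity (\sum_(i < K) \sum_(j < K)
    (binz n i * (binz m s * binz (m - s%:Z) j)) *: T s (i + j)%N).
  apply: eq_bigr => i _.
  rewrite (@shifted_sum _ K s (fun j =>
    (binz n i * (binz m j * 'C(j, s)%:R)) *: T s (j + i - s)%N)) => [|j Kj]; last first.
    by rewrite T0r ?scaler0 //; lia.
  apply: eq_bigr => j _; rewrite binz_trinomial; congr (_ *: T _ _).
  by lia.
rewrite (@diagonal_sum _ _ K
  (fun i j => binz n i * (binz m s * binz (m - s%:Z) j))); last first.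
  by move=> k Kk; rewrite T0r //; lia.
rewrite scaler_sumr; apply: eq_bigr => k _; rewrite scalerA /T.
rewrite (_ : m + n - s%:Z = m - s%:Z + n); last by lia.
rewrite -(binz_vandermonde F (m - s%:Z)) mulr_sumr.
congr (_ *: Lmode _ _); last by lia.
by apply: eq_bigr => i _; rewrite mulrCA [binz n i * _]mulrC.
Qed.

Lemma Lbr_jacobi (x y z : LR) :
  Lbr x (Lbr y z) = Lbr (Lbr x y) z + Lbr y (Lbr x z).
Proof.
apply/eqP; rewrite -subr_eq; apply/eqP.
move: x; apply: linear_LR_ext => [k u v|k u v|a m].
- by rewrite !Lbr_linl Lbr_linr opprD addrACA scalerBr.
- by rewrite !Lbr_linl.
move: y; apply: linear_LR_ext => [k u v|k u v|b n].
- by rewrite !Lbr_linl Lbr_linr opprD addrACA scalerBr.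
- by rewrite Lbr_linr Lbr_linl.
move: z; apply: linear_LR_ext => [k u v|k u v|c p].
- by rewrite !Lbr_linr opprD addrACA scalerBr.
- by rewrite Lbr_linr.
by rewrite !Lbr_mode Lbr_jacobi_mode.
Qed.

Let loop_proj_term (n : int) (a : R) : R :=
  if n is Negz k then (k`!)%:R^-1 *: iter k d a else 0.

Let loop_proj_term_lin n : linear (loop_proj_term n).
Proof.
case: n => k c a b /=; first by rewrite scaler0 addr0.
by rewrite iter_d_lin scalerDr !scalerA mulrC.
Qed.

(* The projection of L(R) onto R = {a(-1)} along L(R)_+. *)
Definition Lproj (x : LR) : R := dlift loop_proj_term (repr x).

Lemma loop_proj_ker f :
  f \in span (range (@loop_d F R)) -> dlift loop_proj_term f = 0.
Proof.
have pl : linear (dlift loop_proj_term) by exact: (dlift_lin loop_proj_term_lin).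
elim/span_ind=> [|c u v [u' _ <-] IHv]; first exact: (lin0 pl).
rewrite pl IHv addr0.
suff -> : dlift loop_proj_term (loop_d u') = 0 by rewrite scaler0.
apply: (@linear_loop0 _ (fun u => dlift loop_proj_term (loop_d u))) => [e x y|a n].
  by rewrite loop_d_lin pl.
rewrite loop_d_mon (linD pl) !dlift_dinj //.
case: n => [[|n]|n].
- by rewrite scale0r (lin0 (loop_proj_term_lin _)) addr0.
- by rewrite (_ : n.+1%:Z - 1 = n%:Z); [exact: addr0 | lia].
rewrite (_ : Negz n - 1 = Negz n.+1); last by lia.
rewrite /loop_proj_term (linZ (iter_d_lin _)) scalerA iterSr -scalerDl.
rewrite factS natrM NegzE rmorphN /= mulrN invfM mulrAC mulVf ?mul1r.
  by rewrite subrr scale0r.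
by rewrite pnatr_eq0.
Qed.

Lemma Lproj_lin : linear Lproj.
Proof.
apply: quot_lift_lin; last exact: loop_proj_ker.
exact: (dlift_lin loop_proj_term_lin).
Qed.

Lemma Lproj_mode a n : Lproj (Lmode a n) = loop_proj_term n a.
Proof.
rewrite /Lproj /Lmode quot_lift_class ?dlift_dinj //; last exact: loop_proj_ker.
exact: (dlift_lin loop_proj_term_lin).
Qed.

Lemma Lproj_nneg a (n : nat) : Lproj (Lmode a n%:Z) = 0.
Proof. by rewrite Lproj_mode. Qed.

Lemma Lproj_N1 a : Lproj (Lmode a (-1)) = a.
Proof. by rewrite Lproj_mode /= invr1 scale1r. Qed.

Lemma binzN1 i : binz (-1) i = (-1) ^+ i.
Proof.
elim: i => [|i IHi]; first by rewrite binz0.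
apply: (@mulfI _ i.+1%:R); first by rewrite pnatr_eq0.
rewrite binzS IHi exprS mulrA mulrN1; congr (_ * _).
by rewrite -[i.+1%:R]/(i.+1%:~R) -rmorphN; congr _%:~R; lia.
Qed.

Lemma Lmode_Negz a k :
  Lmode a (Negz k) = Lmode ((k`!)%:R^-1 *: iter k d a : R) (-1).
Proof.
rewrite (linZ (Lmode_lin _)) Lmode_iter_d scalerA binzN1 mulrAC -expr2 sqrr_sign.
by rewrite mul1r mulVf // scale1r; congr Lmode; lia.
Qed.

(** The complementary projection; it serves as pi in [pbw_functional]. *)
Definition Lplus_proj (x : LR) : LR := x - Lmode (Lproj x) (-1).

Lemma Lplus_proj_lin : linear Lplus_proj.
Proof.
by move=> c x y; rewrite /Lplus_proj Lproj_lin Lmode_lin opprD addrACA scalerBr.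
Qed.

Lemma Lproj_plus x : Lproj (Lplus_proj x) = 0.
Proof. by rewrite (linB Lproj_lin) Lproj_N1 subrr. Qed.

Lemma Lplus_proj_id x : Lproj x = 0 -> Lplus_proj x = x.
Proof. by rewrite /Lplus_proj => ->; rewrite (lin0 (Lmode_lin _)) subr0. Qed.

Lemma Lplus_proj_mode a n :
  Lplus_proj (Lmode a n) = if n is Posz _ then Lmode a n else 0.
Proof.
case: n => n; first by rewrite Lplus_proj_id ?Lproj_nneg.
by rewrite /Lplus_proj Lproj_mode Lmode_Negz subrr.
Qed.

Lemma Lproj_Lplus x : x \in Lplus_sub R -> Lproj x = 0.
Proof.
elim/span_ind=> [|c u v [a [n ->]] IHv]; first exact: (lin0 Lproj_lin).
by rewrite Lproj_lin Lproj_nneg IHv scaler0 addr0.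
Qed.

(** L(R)_+ is a subalgebra: for m >= 0 the coefficient binom(m, i) vanishes for i > m, and otherwise
    the mode m + n - i is nonnegative. *)
Lemma Lproj_br_plus x y : Lproj (Lbr (Lplus_proj x) (Lplus_proj y)) = 0.
Proof.
move: x; apply: (linear_LR_ext (g := fun=> 0)) => [k u v|k u v|a m].
- by rewrite Lplus_proj_lin Lbr_linl Lproj_lin.
- by rewrite scaler0 addr0.
move: y; apply: (linear_LR_ext (g := fun=> 0)) => [k u v|k u v|b n].
- by rewrite Lplus_proj_lin Lbr_linr Lproj_lin.
- by rewrite scaler0 addr0.
rewrite !Lplus_proj_mode; case: m n => m [] n; last 3 first.
- by rewrite (lin0 (Lbr_linr _)) (lin0 Lproj_lin).
- by rewrite (lin0 (Lbr_linl _)) (lin0 Lproj_lin).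
- by rewrite (lin0 (Lbr_linl _)) (lin0 Lproj_lin).
have [N abN] := pr_trunc a b.
rewrite Lbr_mode (mode_brE _ _ abN) (lin_sum Lproj_lin) big1 // => i _.
rewrite (linZ Lproj_lin) binz_nat; have [im|mi] := leqP i m.
  by rewrite (_ : m%:Z + n%:Z - i%:Z = (m + n - i)%N%:Z) ?Lproj_nneg ?scaler0 //; lia.
by rewrite bin_small // scale0r.
Qed.

End LoopLie.

(** * The vacuum module and the symmetric algebra *)

Section TensorLift.
Context (F : fieldType) (A : Type) (M N W : lmodType F).
Context (ract : M -> A -> M) (lact : A -> N -> N).
Local Notation tens := (tens ract lact).

Lemma tens_linl n : linear (fun m => tens m n).
Proof.
move=> c u v; transitivity (tens (c *: u) n + tens v n).
  by rewrite /Defs.tens qclassD; apply/qclassP/mem_span/tensor_relDl.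
congr (_ + _); rewrite /Defs.tens -(linZ (qclass_lin _)).
exact/qclassP/mem_span/tensor_relZl.
Qed.

Lemma tens_linr m : linear (tens m).
Proof.
move=> c u v; transitivity (tens m (c *: u) + tens m v).
  by rewrite /Defs.tens qclassD; apply/qclassP/mem_span/tensor_relDr.
congr (_ + _); rewrite /Defs.tens -(linZ (qclass_lin _)).
exact/qclassP/mem_span/tensor_relZr.
Qed.

Lemma tens_act m a n : tens (ract m a) n = tens m (lact a n).
Proof. exact/qclassP/mem_span/tensor_rel_act. Qed.

Lemma tensor_ind (P : tensor ract lact -> Prop) :
  P 0 -> (forall c m n t, P t -> P (c *: tens m n + t)) -> forall t, P t.
Proof.
move=> P0 PS; apply: quot_ind; apply: malg_ind => [|c [m n] t Pt].
  by rewrite (lin0 (qclass_lin _)).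
by rewrite qclass_lin; apply: PS.
Qed.

Context (h : M -> N -> W) (h_linl : forall n, linear (h^~ n)).
Context (h_linr : forall m, linear (h m)).
Context (h_act : forall m a n, h (ract m a) n = h m (lact a n)).

Definition tensor_lift (t : tensor ract lact) : W :=
  malg_lift (fun p => h p.1 p.2) (repr t).

Lemma tensor_lift_ker g : g \in span (tensor_rel ract lact) ->
  malg_lift (fun p => h p.1 p.2) g = 0.
Proof.
have Hl := malg_lift_lin (fun p => h p.1 p.2).
have E m n : malg_lift (fun p => h p.1 p.2) << (m, n) >> = h m n by exact: malg_liftU.
move: (malg_lift _) Hl E => H Hl E.
elim/span_ind=> [|c u v rr Hv]; first exact: lin0.
rewrite Hl Hv addr0; suff -> : H u = 0 by rewrite scaler0.
case: rr => [m m' n|m n n'|d m n|d m n|m a n].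
- by rewrite (linB Hl) (linD Hl) !E (linD (h_linl _)) subrr.
- by rewrite (linB Hl) (linD Hl) !E (linD (h_linr _)) subrr.
- by rewrite (linB Hl) (linZ Hl) !E (linZ (h_linl _)) subrr.
- by rewrite (linB Hl) (linZ Hl) !E (linZ (h_linr _)) subrr.
- by rewrite (linB Hl) !E h_act subrr.
Qed.

Lemma tensor_lift_lin : linear tensor_lift.
Proof. by apply: quot_lift_lin; [exact: malg_lift_lin|exact: tensor_lift_ker]. Qed.

Lemma tensor_liftE m n : tensor_lift (tens m n) = h m n.
Proof.
rewrite /tensor_lift quot_lift_class ?malg_liftU //; first exact: malg_lift_lin.
exact: tensor_lift_ker.
Qed.

End TensorLift.

Section ActionExtension.
Context (F : fieldType) (L V : lmodType F) (U : lalgType F) (C : Type).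
Context (act : L -> V -> V) (gen : L -> U) (g : U -> C -> V).
Context (g_ext : forall f h : V -> V, linear f -> linear h ->
  (forall u c, f (g u c) = h (g u c)) -> f =1 h).
Context (act_lin : forall x, linear (act x)) (gen_lin : linear gen).
Context (g_lin : forall c, linear (g^~ c)).
Context (act_g : forall x u c, act x (g u c) = g (gen x * u) c).

(** Here [g u c] is to be read as u tensor c, and [g_ext] says that such elements span. The module
    is kept abstract so that rewriting does not unfold the tensor product. *)
Lemma action_linl v : linear (act^~ v).
Proof.
move=> k x y; move: v; apply: g_ext => [//||u c]; first exact: linear_lincomb.
by rewrite !act_g gen_lin mulrDl -scalerAl (linP (g_lin c)).
Qed.

Lemma action_br (br : L -> L -> L) x y v :
  (forall x y, gen x * gen y - gen y * gen x = gen (br x y)) ->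
  act x (act y v) - act y (act x v) = act (br x y) v.
Proof.
move=> genbr; move: v; apply: g_ext => [|//|u c].
  exact: linear_sub (linear_comp _ _) (linear_comp _ _).
by rewrite !act_g -genbr mulrBl -!mulrA (linB (g_lin c)).
Qed.

End ActionExtension.

Section InducedModule.
Context (F : numFieldType) (R : vertexLie F).
Local Notation gen := (env_gen (@Lbr F R)).
Local Notation incl := (@ULp_incl F R).
Local Notation aug := (@ULp_aug F R).
Local Notation VR := (VR R).
Local Notation ract := (fun (u : UL R) (a : ULp R) => u * incl a).
Local Notation lact := (fun (a : ULp R) (c : F^o) => aug a * c).

Definition VRtens (u : UL R) (c : F^o) : VR := tens ract lact u c.

Lemma VRtens_linl c : linear (VRtens^~ c).
Proof. exact: (tens_linl ract lact c). Qed.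

Lemma VRtens_linr u : linear (VRtens u).
Proof. exact: (tens_linr ract lact u). Qed.

Lemma VRtens_act u a c : VRtens (u * incl a) c = VRtens u (aug a * c).
Proof. exact: (tens_act ract lact u a c). Qed.

Lemma VRtens_ind (P : VR -> Prop) :
  P 0 -> (forall c u k v, P v -> P (c *: VRtens u k + v)) -> forall v, P v.
Proof. exact: tensor_ind. Qed.

Let VRact_lift x (u : UL R) (c : F^o) : VR := VRtens (gen x * u) c.

Let VRact_lift_linl x c : linear (VRact_lift x ^~ c).
Proof.
move=> k u v; rewrite /VRact_lift mulrDr -(scalerAr k (gen x) u).
exact: VRtens_linl.
Qed.

Let VRact_lift_linr x u : linear (VRact_lift x u).
Proof. exact: VRtens_linr. Qed.

Let VRact_lift_act x u a c :
  VRact_lift x (u * incl a) c = VRact_lift x u (aug a * c).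
Proof.
rewrite /VRact_lift (mulrA (gen x) u (incl a)); exact: VRtens_act.
Qed.

Lemma VRact_lin x : linear (VRact (R := R) x).
Proof.
exact: (@tensor_lift_lin _ _ _ _ _ ract lact (VRact_lift x) (VRact_lift_linl x)
  (VRact_lift_linr x) (VRact_lift_act x)).
Qed.

Lemma VRact_tens (x : LR R) u c : VRact x (VRtens u c) = VRtens (gen x * u) c.
Proof.
exact: (@tensor_liftE _ _ _ _ _ ract lact (VRact_lift x) (VRact_lift_linl x)
  (VRact_lift_linr x) (VRact_lift_act x)).
Qed.

Definition VRword (w : seq (LR R)) : VR := foldr (@VRact F R) (VRvac R) w.

Lemma VRwordE w : VRword w = VRtens (\prod_(x <- w) gen x) 1.
Proof.
elim: w => [|x w IHw]; first by rewrite big_nil.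
by rewrite big_cons -VRact_tens -IHw.
Qed.

Lemma VRtens1 u (c : F) : VRtens u c = c *: VRtens u 1.
Proof.
rewrite -(linZ (VRtens_linr u)); congr VRtens.
by rewrite -[RHS]/(c * 1) mulr1.
Qed.

Lemma VR_ind (P : VR -> Prop) :
  P 0 -> (forall c w v, P v -> P (c *: VRword w + v)) -> forall v, P v.
Proof.
move=> P0 PS; apply: VRtens_ind => // c u k t Pt.
rewrite VRtens1 scalerA.
move: {c k} (c * k) t Pt; elim/env_ind: u => [|k w u IHu] c t Pt.
  by rewrite (lin0 (VRtens_linl 1)) scaler0 add0r.
rewrite (linP (VRtens_linl 1)) -VRwordE scalerDr scalerA -addrA.
by apply: PS; apply: IHu.
Qed.

Lemma linear_VR_ext (W : lmodType F) (f g : VR -> W) : linear f -> linear g ->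
  (forall u c, f (VRtens u c) = g (VRtens u c)) -> f =1 g.
Proof.
move=> fl gl fg; apply: VRtens_ind => [|c u k v IHv]; first by rewrite !lin0.
by rewrite (linP fl) (linP gl) fg IHv.
Qed.

Lemma VRact_linl (v : VR) : linear (fun x : LR R => VRact x v).
Proof.
exact: (@action_linl _ (LR R) VR (UL R) _ (@VRact F R) gen VRtens (@linear_VR_ext VR)
  VRact_lin (@env_gen_lin _ _ _) VRtens_linl VRact_tens).
Qed.

Lemma VRact_br (x y : LR R) (v : VR) :
  VRact x (VRact y v) - VRact y (VRact x v) = VRact (Lbr x y) v.
Proof.
exact: (@action_br _ (LR R) VR (UL R) _ (@VRact F R) gen VRtens (@linear_VR_ext VR)
  VRact_lin VRtens_linl VRact_tens (@Lbr F R) x y v (@env_gen_br _ _ _)).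
Qed.

Section Functional.
Context (W : lmodType F) (H : UL R -> W) (H_lin : linear H).
Context (H_plus : forall u x, x \in Lplus_sub R -> H (u * gen x) = 0).

(** [incl a] and [aug a] expand the same representative of a, word by word. The empty word
    contributes its coefficient on both sides; any other word ends in a letter of L(R)_+, so H kills
    it on the left, and the augmentation kills it on the right. *)
Lemma H_incl u a : H (u * incl a) = aug a *: H u.
Proof.
rewrite /ULp_incl /ULp_aug /env_lift !mmapE mulr_sumr (lin_sum H_lin) scaler_suml.
apply: eq_bigr => k _; rewrite mulr_algl -scalerAr (linZ H_lin).
have [->|] := eqVneq (k : seq _) [::].
  by rewrite !big_nil !mulr1 /GRing.scale /= !mulr1.
case/lastP: (k : seq _) => // w x _.
rewrite -cats1 !big_cat /= !big_seq1 !mulr0 scale0r mulrA H_plus ?scaler0 //.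
exact: (valP x).
Qed.

Definition VRlift (v : VR) : W :=
  @tensor_lift _ _ _ _ _ ract lact (fun u (c : F^o) => c *: H u) v.

Let linl (c : F^o) : linear (fun u => c *: H u).
Proof. by move=> k u v; rewrite (linP H_lin) scalerDr !scalerA mulrC. Qed.

Let linr u : linear (fun c : F^o => c *: H u).
Proof. by move=> k c e; rewrite scalerDl scalerA. Qed.

Let balanced u a (c : F^o) : c *: H (u * incl a) = (aug a * c) *: H u.
Proof. by rewrite H_incl scalerA mulrC. Qed.

Lemma VRlift_lin : linear VRlift.
Proof. exact: (@tensor_lift_lin _ _ _ _ _ ract lact _ linl linr balanced). Qed.

Lemma VRlift_word w : VRlift (VRword w) = H (\prod_(x <- w) gen x).
Proof.
rewrite VRwordE -[RHS]scale1r.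
exact: (@tensor_liftE _ _ _ _ _ ract lact _ linl linr balanced).
Qed.

End Functional.

End InducedModule.

Lemma perm_big_mulC (A : pzRingType) (T : eqType) (g : T -> A) w w' :
  commutative (@GRing.mul A) ->
  perm_eq w w' -> \prod_(x <- w) g x = \prod_(x <- w') g x.
Proof.
move=> mulC ww'; move: w w' ww'.
apply: catCA_perm_subst => s1 s2 s3; rewrite !big_cat /= !mulrA.
by congr (_ * _); exact: mulC.
Qed.

Lemma span_mulC (F : fieldType) (A : algType F) (T : Type) (g : T -> A) :
  (forall x y, g x * g y = g y * g x) ->
  (forall f h : A -> A, linear f -> linear h ->
    (forall w, f (\prod_(x <- w) g x) = h (\prod_(x <- w) g x)) -> f =1 h) ->
  commutative (@GRing.mul A).
Proof.
move=> gC ext.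
have genC x w : g x * (\prod_(y <- w) g y) = (\prod_(y <- w) g y) * g x.
  elim: w => [|y w IHw]; first by rewrite big_nil mulr1 mul1r.
  by rewrite !big_cons mulrA gC -!mulrA IHw.
have wordC w v : (\prod_(x <- w) g x) * (\prod_(y <- v) g y) =
    (\prod_(y <- v) g y) * (\prod_(x <- w) g x).
  elim: w => [|x w IHw]; first by rewrite big_nil mulr1 mul1r.
  by rewrite !big_cons -mulrA IHw !mulrA genC.
move=> u v; move: u; apply: (ext) => [c a b|c a b|w].
- by rewrite mulrDl scalerAl.
- by rewrite mulrDr scalerAr.
move: v; apply: (ext) => [c a b|c a b|v].
- by rewrite mulrDr scalerAr.
- by rewrite mulrDl scalerAl.
exact: wordC.
Qed.

(** * Commutativity and grading of the symmetric algebra *)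

Section SymmetricAlgebra.
Context (F : fieldType) (V : lmodType F).
Local Notation S := (sym_alg V).
Local Notation gen := (env_gen (fun _ _ : V => 0)).

Lemma sym_alg_mulC : commutative (@GRing.mul S).
Proof.
apply: (@span_mulC _ S _ gen) => [x y|f h fl hl fh].
  by apply/eqP; rewrite -subr_eq0 env_gen_br (lin0 (env_gen_lin _)).
exact: linear_env_ext.
Qed.

Lemma perm_sym_prod (T : eqType) (g : T -> S) w w' :
  perm_eq w w' -> \prod_(x <- w) g x = \prod_(x <- w') g x.
Proof. exact: (@perm_big_mulC S T g w w' sym_alg_mulC). Qed.

Let comp_word n (w : seq V) : S := if size w == n then \prod_(x <- w) gen x else 0.

Let comp_word_lin n : multilinear (comp_word n).
Proof.
move=> c w0 w1 w2 l3; rewrite /comp_word; have [-> ->] := lin3_size l3.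
case: ifP => _; last by rewrite scaler0 addr0.
exact: (multilinear_prod (env_gen_lin _) l3).
Qed.

Let comp_word_br n u x y v :
  comp_word n (u ++ x :: y :: v) - comp_word n (u ++ y :: x :: v) =
  comp_word n (u ++ 0 :: v).
Proof.
rewrite multilinear0; last exact: comp_word_lin.
apply/eqP; rewrite subr_eq0; apply/eqP; rewrite /comp_word !size_cat.
case: ifP => // _; apply: perm_sym_prod; rewrite perm_cat2l.
exact/permPl/(perm_catCA [:: x] [:: y]).
Qed.

(** The projection onto degree n. It exists because the zero bracket makes the relations
    homogeneous: restricting words to length n respects them. *)
Definition sym_comp n (u : S) : S := env_word_lift (comp_word n) u.

Lemma sym_comp_lin n : linear (sym_comp n).
Proof. exact: (env_word_lift_lin (comp_word_lin n) (comp_word_br n)). Qed.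

Lemma sym_comp_word n w : sym_comp n (\prod_(x <- w) gen x) =
  if size w == n then \prod_(x <- w) gen x else 0.
Proof. exact: (env_word_liftE (comp_word_lin n) (comp_word_br n)). Qed.

End SymmetricAlgebra.

(** * From V(R) back to S(R): leading terms *)

Section TopSymbol.
Context (F : numFieldType) (R : vertexLie F).
Local Notation SR := (SR R).

Lemma SRgen_lin : linear (@SRgen F R).
Proof. exact: env_gen_lin. Qed.

Lemma VRmonomialE (s : seq R) : VRmonomial s = VRword [seq Lmode a (-1) | a <- s].
Proof. by elim: s => [//|a s IHs]; exact: (congr1 (VRact _) IHs). Qed.

(** The functional h vanishes on words ending in L(R)_+, hence on the left ideal of U(L(R))
    generated by L(R)_+, and so descends to V(R). On words of length at most n, [sym_comp n]
    discards everything in h but the leading term, and [Lproj] recovers a from a(-1). *)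
Lemma VR_top_symbol : exists Phi : VR R -> SR, linear Phi /\
  forall n s, (size s <= n)%N -> sym_comp n (Phi (VRmonomial s)) =
    if size s == n then \prod_(a <- s) SRgen a else 0.
Proof.
pose t (w : seq (LR R)) : SR := \prod_(x <- w) SRgen (Lproj x).
have gl : linear (fun x : LR R => SRgen (Lproj x)).
  exact: (linear_comp SRgen_lin (@Lproj_lin F R)).
(* Degree less than k, expressed through the components. *)
pose Q k (u : SR) := forall m, (k <= m)%N -> sym_comp m u = 0.
have [h [h_lin h_br h_plus h_top]] : exists h : seq (LR R) -> SR,
    [/\ multilinear h,
        forall u x y v,
          h (u ++ x :: y :: v) - h (u ++ y :: x :: v) = h (u ++ Lbr x y :: v),
        forall w x, h (rcons w (Lplus_proj x)) = 0 &
        forall w, Q (size w) (h w - t w)].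
  apply: pbw_functional.
  - exact: Lbr_linl.
  - exact: Lbr_linr.
  - exact: Lbr_anti.
  - exact: Lbr_jacobi.
  - exact: Lplus_proj_lin.
  - by move=> x; rewrite Lplus_proj_id ?Lproj_plus.
  - by move=> x y; rewrite Lplus_proj_id ?Lproj_br_plus.
  - exact: (multilinear_prod gl).
  - by move=> w w' ww'; apply: perm_sym_prod.
  - move=> x w; rewrite /t big_cons Lproj_plus.
    by rewrite (lin0 SRgen_lin) mul0r.
  - by move=> k c a b Qa Qb m km; rewrite sym_comp_lin Qa ?Qb // scaler0 addr0.
  - by move=> k m _; rewrite (lin0 (sym_comp_lin m)).
  - by move=> k a Qa m km; apply: Qa; apply: ltnW.
  - move=> w m wm; rewrite /t -(big_map (@Lproj F R) predT (fun a => SRgen a)).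
    rewrite sym_comp_word size_map ifN //.
    by apply: contraTneq wm => <-; rewrite ltnn.
pose H (u : UL R) : SR := env_word_lift h u.
have H_lin : linear H by exact: (env_word_lift_lin h_lin h_br).
have HE w : H (\prod_(x <- w) env_gen (@Lbr F R) x) = h w.
  exact: (env_word_liftE h_lin h_br).
have H_plus (u : UL R) x : x \in Lplus_sub R -> H (u * env_gen (@Lbr F R) x) = 0.
  move=> /Lproj_Lplus/Lplus_proj_id xE.
  move: u; apply: (linear_env_ext (g := fun=> 0)) => [c a b|c a b|w].
  - by rewrite mulrDl -(scalerAl c a) (linP H_lin).
  - by rewrite scaler0 addr0.
  rewrite -{1}xE -(h_plus w x) -HE -cats1 big_cat /= big_seq1; exact: erefl.
exists (VRlift H); split; first exact: VRlift_lin.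
move=> n s sn; rewrite VRmonomialE VRlift_word // HE.
set w := map _ s.
have tE : t w = \prod_(a <- s) SRgen a.
  by rewrite /t big_map; apply: eq_bigr => a _; rewrite Lproj_N1.
rewrite -[h w](subrK (t w)) (linD (sym_comp_lin n)) h_top ?size_map // add0r tE.
exact: sym_comp_word.
Qed.

End TopSymbol.

(** * Associated graded spaces *)

Section AssociatedGraded.
Context (F : fieldType) (V : lmodType F) (E : int -> subspace V).
Context (E_incr : forall m n, (m <= n)%R -> {subset E m <= E n}).

Let val_insubd_E n v : v \in E n -> \val (insubd (0 : subsp (E n)) v) = v.
Proof. by move=> vE; rewrite val_insubd vE. Qed.

Let cl n (w : subsp (E n)) : gr E :=
  dinj (qclass (restr_sub (E n) (E (n - 1))) w : gr_piece E n).

Let cl_lin n : linear (@cl n).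
Proof. by move=> c u v; rewrite /cl qclass_lin dinj_lin. Qed.

(** Outside E n the default value of [insubd] replaces v by 0, so additivity needs both memberships.
    This is why memberships are carried along in all computations with classes. *)
Lemma gr_class_lin n c u v : u \in E n -> v \in E n ->
  gr_class E n (c *: u + v) = c *: gr_class E n u + gr_class E n v.
Proof.
move=> uE vE; rewrite -![gr_class E n _]/(cl (insubd 0 _)) -(linP (@cl_lin n)).
congr cl; apply/val_inj.
rewrite val_insubd_E ?rpredD ?rpredZ //.
by rewrite -[RHS]/(c *: \val (insubd 0 u) + \val (insubd 0 v)) !val_insubd_E.
Qed.

Lemma gr_class_eq0 n v : v \in E n -> (gr_class E n v = 0) <-> (v \in E (n - 1)).
Proof.
move=> vE; have clE : (insubd 0 v : subsp (E n)) \in restr_sub (E n) (E (n - 1))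
    = (v \in E (n - 1)).
  by rewrite -[LHS]/(\val _ \in _) val_insubd_E.
split=> [/(congr1 (fun x => dcoef x n))|vE'].
  by rewrite dcoef_dinj => /qclass_eq0; rewrite clE.
have q0 : qclass (restr_sub (E n) (E (n - 1))) (insubd 0 v) = 0.
  by apply/qclass_eq0; rewrite clE.
by rewrite /gr_class q0; apply: (lin0 (@dinj_lin F int (gr_piece E) n)).
Qed.

Lemma gr_class_pieceE n (x : gr_piece E n) : dinj x = gr_class E n (\val (repr x)).
Proof. by rewrite /gr_class valKd qclass_repr. Qed.

Lemma gr_ind (P : gr E -> Prop) :
  P 0 -> (forall x y, P x -> P y -> P (x + y)) ->
  (forall n v, v \in E n -> P (gr_class E n v)) -> forall x, P x.
Proof.
move=> P0 PD Pc; apply: dsum_ind => // n x.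
by rewrite gr_class_pieceE; apply/Pc/valP.
Qed.

Lemma linear_gr_ext (W : lmodType F) (f g : gr E -> W) : linear f -> linear g ->
  (forall n v, v \in E n -> f (gr_class E n v) = g (gr_class E n v)) -> f =1 g.
Proof.
move=> fl gl fg; apply: gr_ind => [|x y IHx IHy|//]; first by rewrite !lin0.
by rewrite !linD // IHx IHy.
Qed.

Section PieceLift.
Context (n : int) (W : lmodType F) (h : V -> W).
Context (h_lin : forall c u v, u \in E n -> v \in E n ->
  h (c *: u + v) = c *: h u + h v).
Context (h_ker : forall v, v \in E (n - 1) -> h v = 0).

Let hv (u : subsp (E n)) : W := h (\val u).

Let hv_lin : linear hv.
Proof. by move=> c u v; rewrite /hv /= h_lin ?(valP u) ?(valP v). Qed.

Let hv_ker u : u \in restr_sub (E n) (E (n - 1)) -> hv u = 0.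
Proof. exact: h_ker. Qed.

Lemma piece_lift_lin : linear (fun x : gr_piece E n => h (\val (repr x))).
Proof. exact: (quot_lift_lin hv_lin hv_ker). Qed.

Lemma piece_liftE v : v \in E n ->
  h (\val (repr (qclass (restr_sub (E n) (E (n - 1))) (insubd 0 v)))) = h v.
Proof.
move=> vE; have := quot_lift_class hv_lin hv_ker (insubd 0 v).
by rewrite /hv val_insubd_E.
Qed.

End PieceLift.

Section GrMap.
Context (f : V -> V) (f_lin : linear f) (fE : forall n v, v \in E n -> f v \in E n).

Let h n v := gr_class E n (f v).
Let h_lin n c u v : u \in E n -> v \in E n -> h n (c *: u + v) = c *: h n u + h n v.
Proof. by move=> uE vE; rewrite /h f_lin gr_class_lin // fE. Qed.
Let h_ker n v : v \in E (n - 1) -> h n v = 0.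
Proof.
move=> vE; apply/gr_class_eq0; last exact: fE.
by apply: fE; apply: E_incr vE; rewrite gerDl.
Qed.

Let phi n (x : gr_piece E n) : gr E := h n (\val (repr x)).

Let phi_lin n : linear (@phi n).
Proof. exact: (piece_lift_lin (@h_lin n) (@h_ker n)). Qed.

Lemma gr_map_lin : linear (gr_map (E := E) f).
Proof. exact: (@dlift_lin F int (gr_piece E) (gr E) phi phi_lin). Qed.

Lemma gr_map_class n v : v \in E n -> gr_map f (gr_class E n v) = gr_class E n (f v).
Proof.
move=> vE; transitivity (phi (qclass (restr_sub (E n) (E (n - 1))) (insubd 0 v))).
  exact: (@dlift_dinj F int (gr_piece E) (gr E) phi phi_lin).
exact: (piece_liftE (@h_lin n) (@h_ker n)).
Qed.

End GrMap.

Section GrMap2.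
Context (op : V -> V -> V) (s : int).
Context (op_linl : forall v, linear (op^~ v)) (op_linr : forall u, linear (op u)).
Context (opE : forall m n u v, u \in E m -> v \in E n -> op u v \in E (m + n + s)).

Let h m n u v := gr_class E (m + n + s) (op u v).

Let hl m n v : v \in E n -> forall c u u', u \in E m -> u' \in E m ->
  h m n (c *: u + u') v = c *: h m n u v + h m n u' v.
Proof. by move=> vE c u u' uE u'E; rewrite /h op_linl gr_class_lin // opE. Qed.

Let hr m n u : u \in E m -> forall c v v', v \in E n -> v' \in E n ->
  h m n u (c *: v + v') = c *: h m n u v + h m n u v'.
Proof. by move=> uE c v v' vE v'E; rewrite /h op_linr gr_class_lin // opE. Qed.

Let kl m n v : v \in E n -> forall u, u \in E (m - 1) -> h m n u v = 0.
Proof.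
move=> vE u uE; apply/gr_class_eq0.
  by apply: opE vE; apply: E_incr uE; rewrite gerDl.
by rewrite (_ : m + n + s - 1 = m - 1 + n + s); [apply: opE | lia].
Qed.

Let kr m n u : u \in E m -> forall v, v \in E (n - 1) -> h m n u v = 0.
Proof.
move=> uE v vE; apply/gr_class_eq0.
  by apply: opE uE _; apply: E_incr vE; rewrite gerDl.
by rewrite (_ : m + n + s - 1 = m + (n - 1) + s); [apply: opE | lia].
Qed.

Let phi m n (x : gr_piece E m) (y : gr_piece E n) : gr E :=
  h m n (\val (repr x)) (\val (repr y)).

Let phi_linl m n y : linear (fun x => phi (m := m) (n := n) x y).
Proof. exact: (piece_lift_lin (hl (valP (repr y))) (kl (valP (repr y)))). Qed.

Let phi_linr m n x : linear (fun y => phi (m := m) (n := n) x y).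
Proof. exact: (piece_lift_lin (hr (valP (repr x))) (kr (valP (repr x)))). Qed.

Let phi2 m (y : gr E) (x : gr_piece E m) : gr E :=
  @dlift F int (gr_piece E) (gr E) (fun n y => phi x y) y.

Let phi2_linl y m : linear (@phi2 m y).
Proof.
move=> c x x'; rewrite /phi2 /dlift scaler_sumr -big_split; apply: eq_bigr => n _ /=.
exact: phi_linl.
Qed.

Let phi2_linr m x : linear (fun y => @phi2 m y x).
Proof.
exact: (@dlift_lin F int (gr_piece E) (gr E) _ (fun n => @phi_linr m n x)).
Qed.

Lemma gr_map2_linl y : linear (fun x => gr_map2 (E := E) op s x y).
Proof. exact: (@dlift_lin F int (gr_piece E) (gr E) _ (phi2_linl y)). Qed.

Lemma gr_map2_linr x : linear (gr_map2 (E := E) op s x).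
Proof.
move=> c y y'.
have E1 z :
    gr_map2 op s x z = \sum_(m <- dsupp x) @phi2 m z (dcoef x m) by exact: erefl.
rewrite !E1 scaler_sumr -big_split; apply: eq_bigr => m _ /=.
exact: phi2_linr.
Qed.

Lemma gr_map2_class m n u v : u \in E m -> v \in E n ->
  gr_map2 op s (gr_class E m u) (gr_class E n v) = gr_class E (m + n + s) (op u v).
Proof.
move=> uE vE.
pose pc k w : gr_piece E k := qclass (restr_sub (E k) (E (k - 1))) (insubd 0 w).
transitivity (phi2 (gr_class E n v) (pc m u)).
  exact: (@dlift_dinj F int (gr_piece E) (gr E) _ (phi2_linl (gr_class E n v))).
transitivity (phi (pc m u) (pc n v)).
  exact: (@dlift_dinj F int (gr_piece E) (gr E) _ (fun n => @phi_linr m n (pc m u))).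
rewrite /phi (piece_liftE (hr (valP (repr (pc m u)))) (kr (valP (repr (pc m u))))) //.
exact: (piece_liftE (hl vE) (kl vE)).
Qed.

End GrMap2.

End AssociatedGraded.

(** * Consequences of the Jacobi identity *)

Section VertexAlgebraTheory.
Context (F : numFieldType) (V : lmodType F) (Y : V -> int -> V -> V) (vac : V).
Context (hY : is_vertex_algebra Y vac).
Local Notation binz := (binz F).
Local Notation D := (fun v => Y v (-2) vac).

Let linl n v : linear (fun u => Y u n v) := va_linl hY n v.
Let linr u n : linear (Y u n) := va_linr hY u n.

Let Y0l n v : Y 0 n v = 0. Proof. exact: (lin0 (linl n v)). Qed.
Let Y0r u n : Y u n 0 = 0. Proof. exact: (lin0 (linr u n)). Qed.

Lemma va_trunc_nat u n v :
  exists N : nat, forall i : nat, (N <= i)%N -> Y u (n + i%:Z) v = 0.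
Proof.
have [N uvN] := va_trunc hY u v; exists `|N - n|%N => i Ni; apply: uvN; lia.
Qed.

Lemma va_trunc_nat0 u v : exists N : nat, forall i : nat, (N <= i)%N -> Y u i%:Z v = 0.
Proof.
by have [N uvN] := va_trunc_nat u 0 v; exists N => i /uvN; rewrite add0r.
Qed.

Lemma delta_coef_N1 i : delta_coef F (-1) i = 1.
Proof. by rewrite /delta_coef binzN1 -expr2 sqrr_sign. Qed.

Lemma delta_coef0 i : delta_coef F 0 i = (i == 0%N)%:R.
Proof.
rewrite /delta_coef (binz_nat F 0) bin0n eq_sym.
by case: i => [|i]; rewrite ?mul1r //= mulr0.
Qed.

Lemma delta_coef_N2 i : delta_coef F (-2) i = i.+1%:R.
Proof.
rewrite /delta_coef; suff -> : binz (-2) i = (-1) ^+ i * i.+1%:R.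
  by rewrite mulrA -expr2 sqrr_sign mul1r.
elim: i => [|i IHi]; first by rewrite binz0 mul1r.
apply: (@mulfI _ i.+1%:R); first by rewrite pnatr_eq0.
have E : (-2 - i%:Z)%:~R = - i.+2%:R :> F.
  by rewrite -[i.+2%:R]/(i.+2%:~R) -rmorphN; congr _%:~R; lia.
by rewrite binzS IHi exprS E; ring.
Qed.

(** The Jacobi identity with l = -1 and m = 0: on the right binom(0, i) leaves the single term i =
    0, and on the left all coefficients are 1. *)
Lemma va_assoc N u v n w :
  (forall i : nat, (N <= i)%N -> Y v (n + i%:Z) w = 0) ->
  (forall i : nat, (N <= i)%N -> Y u i%:Z w = 0) ->
  Y (Y u (-1) v) n w = \sum_(i < N)
    (Y u (-1 - i%:Z) (Y v (n + i%:Z) w) + Y v (n - 1 - i%:Z) (Y u i%:Z w)).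
Proof.
move=> vw uw; have := va_jacobi hY u v w (-1) 0 n.
rewrite (@fsbig_nat_trunc _ _ N) => [|i Ni]; last by rewrite vw // Y0r scaler0.
rewrite (@fsbig_nat_trunc _ _ N) => [|i Ni]; last by rewrite add0r uw // Y0r scaler0.
rewrite (@fsbig_nat_trunc _ _ 1) => [|[|i] // _]; last first.
  by rewrite delta_coef_reflect (binz_nat F 0) bin0n scale0r.
rewrite big_ord1 delta_coef_reflect binz0 scale1r addr0 subr0 [0 + n]add0r => <-.
rewrite -[(-1) ^ (-1)]/((-1)^-1) invrN1 scaleN1r opprK -big_split.
apply: eq_bigr => i _ /=; rewrite !delta_coef_N1 !scale1r !add0r.
by congr (Y u _ _ + Y v _ _); rewrite ?add0r //; lia.
Qed.

(** The Jacobi identity with l = 0, where each sum on the left reduces to its first term. *)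
Lemma va_comm N u m v n w :
  (forall i : nat, (N <= i)%N -> Y u i%:Z v = 0) ->
  Y u m (Y v n w) - Y v n (Y u m w) =
  \sum_(i < N) binz m i *: Y (Y u i%:Z v) (m + n - i%:Z) w.
Proof.
move=> uv; have := va_jacobi hY u v w 0 m n.
rewrite (@fsbig_nat_trunc _ _ 1) => [|[|i] // _]; last by rewrite delta_coef0 scale0r.
rewrite (@fsbig_nat_trunc _ _ 1) => [|[|i] // _]; last by rewrite delta_coef0 scale0r.
rewrite (@fsbig_nat_trunc _ _ N) => [|i Ni]; last by rewrite add0r uv // Y0l scaler0.
rewrite !big_ord1 !delta_coef0 !scale1r !addr0 ?subr0 => ->.
by apply: eq_bigr => i _; rewrite delta_coef_reflect add0r.
Qed.

Let va_vac0 n v : n <> -1 -> Y vac n v = 0.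
Proof. by move=> /eqP/negPf n1; rewrite (va_vac hY) n1. Qed.

Let va_vac1 n v : n = -1 -> Y vac n v = v.
Proof. by move=> ->; rewrite (va_vac hY) eqxx. Qed.

(** The Jacobi identity with the vacuum for v, l = -2 and m = 0. As only the mode -1 of the vacuum
    is nonzero, each sum on the left has at most one term: the first contributes for n < 0, the
    second for n > 0. *)
Lemma va_D_mode u n w : Y (D u) n w = - n%:~R *: Y u (n - 1) w.
Proof.
have := va_jacobi hY u vac w (-2) 0 n.
rewrite [X in _ = X](@fsbig_nat_trunc _ _ 1) => [|[|i] // _]; last first.
  by rewrite delta_coef_reflect (binz_nat F 0) bin0n scale0r.
rewrite big_ord1 delta_coef_reflect binz0 scale1r addr0 subr0 [0 + n]add0r => <-.
rewrite -[(-1) ^ (-2)]/((-1 * -1)^-1) mulrNN mulr1 invr1 scale1r.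
case: n => [n|k].
  rewrite (@fsbig_nat_trunc _ _ 0) => [|i _]; last first.
    by rewrite va_vac0 ?Y0r ?scaler0 //; lia.
  rewrite big_ord0 add0r; case: n => [|n].
    rewrite (@fsbig_nat_trunc _ _ 0) => [|i _]; last first.
      by rewrite va_vac0 ?scaler0 //; lia.
    by rewrite big_ord0 !oppr0 scale0r.
  rewrite (@fsbig_nat_trunc _ _ n.+1) => [|i ni]; last first.
    by rewrite va_vac0 ?scaler0 //; lia.
  rewrite big_ord_recr big1 /= => [|i _]; last first.
    by have := ltn_ord i => ik; rewrite va_vac0 ?scaler0 //; lia.
  rewrite add0r va_vac1; last by lia.
  rewrite delta_coef_N2 add0r scaleNr; congr (- (_ *: Y u _ w)); lia.
rewrite [X in _ - X](@fsbig_nat_trunc _ _ 0) => [|i _]; last first.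
  by rewrite va_vac0 ?scaler0 //; lia.
rewrite big_ord0 subr0.
rewrite (@fsbig_nat_trunc _ _ k.+1) => [|i ki]; last first.
  by rewrite va_vac0 ?Y0r ?scaler0 //; lia.
rewrite big_ord_recr big1 /= => [|i _]; last first.
  by have := ltn_ord i => ik; rewrite va_vac0 ?Y0r ?scaler0 //; lia.
rewrite add0r va_vac1; last by lia.
rewrite delta_coef_N2 NegzE rmorphN /= opprK; congr (_ *: Y u _ w); lia.
Qed.

Lemma va_iter_D i w : Y w (-1 - i%:Z) vac = (i`!)%:R^-1 *: iter i D w.
Proof.
elim: i w => [|i IHi] w; first by rewrite subr0 (va_creation1 hY) invr1 scale1r.
have := va_D_mode w (-1 - i%:Z) vac.
rewrite IHi -iterSr => /(congr1 ( *:%R i.+1%:R^-1)).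
rewrite !scalerA factS natrM invfM => ->.
rewrite (_ : - (-1 - i%:Z)%:~R = i.+1%:R :> F); last first.
  by rewrite -rmorphN -[RHS]/(i.+1%:~R); congr _%:~R; lia.
by rewrite mulVf ?scale1r ?pnatr_eq0 //; congr (Y w _ vac); lia.
Qed.

(** The Jacobi identity applied to the vacuum, with m = -1 and n = 0. The creation property kills
    the first sum and all but one term of the second; on the right the modes -1 - i on the vacuum
    are D^i / i!. *)
Lemma va_skew N u v (l : nat) :
  (forall i : nat, (N <= i)%N -> Y u (l + i)%N%:Z v = 0) ->
  Y v l%:Z u =
  \sum_(i < N) ((-1) ^+ (l + i + 1) / (i`!)%:R) *: iter i D (Y u (l + i)%N%:Z v).
Proof.
move=> uv; have := va_jacobi hY u v vac l%:Z (-1) 0.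
rewrite (@fsbig_nat_trunc _ _ 0) => [|i _]; last first.
  by rewrite (va_creation hY) ?Y0r ?scaler0 //; lia.
rewrite (@fsbig_nat_trunc _ _ 1) => [|[|i] // _]; last first.
  by rewrite (va_creation hY u) ?Y0r ?scaler0 //; lia.
rewrite (@fsbig_nat_trunc _ _ N) => [|i Ni]; last first.
  by rewrite -PoszD uv // Y0l scaler0.
rewrite big_ord0 big_ord1 /= /delta_coef binz0 mulr1 scale1r !addr0 !add0r.
rewrite (va_creation1 hY) => /(congr1 (fun x => - ((-1) ^+ l *: x))).
rewrite scalerN opprK scalerA -expr2 sqrr_sign scale1r => ->.
rewrite scaler_sumr -sumrN; apply: eq_bigr => i _.
have := @delta_coef_reflect F (-1) i; rewrite /delta_coef => ->.
rewrite -PoszD ?addr0 va_iter_D binzN1 !scalerA -scaleNr; congr (_ *: _).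
by rewrite addn1 exprS exprD mulN1r mulNr.
Qed.

Lemma va_D_derivation u v : D (Y u (-1) v) = Y (D u) (-1) v + Y u (-1) (D v).
Proof.
rewrite /= (@va_assoc 2) => [|[|[|i]] // _|i _]; last 2 first.
- by rewrite (va_creation hY) //; lia.
- by rewrite (va_creation hY).
rewrite !big_ord_recl big_ord0 /= addr0 (va_creation hY u (n := 0)) //.
rewrite (va_creation hY u (n := 1)) // !Y0r !addr0.
rewrite addrC; congr (_ + _).
by rewrite (va_creation1 hY) va_D_mode opprK scale1r.
Qed.

End VertexAlgebraTheory.

(** * Transport of structure along a linear bijection *)

Section Transport.
Context (F : fieldType) (A B : lmodType F) (f : A -> B) (g : B -> A).
Context (f_lin : linear f) (fK : cancel f g) (gK : cancel g f).

Let surj (P : B -> Prop) : (forall a, P (f a)) -> forall b, P b.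
Proof. by move=> Pf b; rewrite -[b]gK. Qed.

Lemma vertex_Poisson_transport (P : vertexPoissonOps A) (Q : vertexPoissonOps B) :
  f (vp_one P) = vp_one Q ->
  (forall a b, f (vp_mul P a b) = vp_mul Q (f a) (f b)) ->
  (forall a, f (vp_d P a) = vp_d Q (f a)) ->
  (forall a n b, f (vp_pr P a n b) = vp_pr Q (f a) n (f b)) ->
  is_vertex_Poisson P -> is_vertex_Poisson Q.
Proof.
move=> f1 fM fd fp hP.
have linr n b : linear (fun a => vp_pr P a n b) := vl_linl (vp_Lie hP) n b.
have derT (u : A -> A) (v : B -> B) : (forall a, f (u a) = v (f a)) ->
    is_derivation (vp_mul P) u -> is_derivation (vp_mul Q) v.
  move=> uv [ul um]; split=> [c|].
    by elim/surj=> x; elim/surj=> y; rewrite -f_lin -!uv ul f_lin.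
  by elim/surj=> x; elim/surj=> y; rewrite -fM -!uv um (linD f_lin) !fM.
have iterT i a : iter i (vp_d Q) (f a) = f (iter i (vp_d P) a).
  by elim: i => //= i ->; rewrite fd.
split.
- elim/surj=> b c; elim/surj=> x; elim/surj=> y.
  by rewrite -f_lin -!fM (vp_mul_linl hP) f_lin.
- elim/surj=> x; elim/surj=> y; elim/surj=> z.
  by rewrite -!fM (vp_mulA hP).
- by elim/surj=> x; elim/surj=> y; rewrite -!fM (vp_mulC hP).
- by elim/surj=> x; rewrite -f1 -fM (vp_mul1 hP).
- exact: derT fd (vp_d_der hP).
- have hL := vp_Lie hP; split.
  + move=> c; elim/surj=> x; elim/surj=> y.
    by rewrite -f_lin -!fd (vl_d_lin hL) f_lin.
  + move=> n; elim/surj=> b c; elim/surj=> x; elim/surj=> y.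
    by rewrite -f_lin -!fp (vl_linl hL) f_lin.
  + elim/surj=> a n c; elim/surj=> x; elim/surj=> y.
    by rewrite -f_lin -!fp (vl_linr hL) f_lin.
  + elim/surj=> a; elim/surj=> b; have [N abN] := vl_C0 hL a b.
    by exists N => n /abN; rewrite -fp => ->; apply: lin0.
  + elim/surj=> a n; elim/surj=> b.
    by rewrite -fd -!fp (vl_C1 hL) (linN f_lin) (linZ f_lin).
  + elim/surj=> a n; elim/surj=> b; have [N baN] := vl_C0 hL b a.
    have d0 i : iter i (vp_d P) 0 = 0.
      by elim: i => //= i ->; apply: lin0 (vl_d_lin hL).
    rewrite -fp (vl_C2 hL) !(@fsbig_nat_trunc _ _ N) => [|i Ni|i Ni].
    * rewrite (lin_sum f_lin); apply: eq_bigr => i _.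
      by rewrite (linZ f_lin) -fp iterT.
    * by rewrite -fp iterT baN ?d0 ?(lin0 f_lin) ?scaler0 // (leq_trans Ni) ?leq_addl.
    * by rewrite baN ?d0 ?scaler0 // (leq_trans Ni) ?leq_addl.
  + elim/surj=> a; elim/surj=> b; elim/surj=> c m n.
    rewrite -!fp -(linB f_lin) (vl_C3 hL) (lin_sum f_lin); apply: eq_bigr => i _.
    by rewrite (linZ f_lin) !fp.
- elim/surj=> a n; exact: derT (fp a n) (vp_pr_der hP a n).
Qed.

Lemma Lie_module_transport (L : lmodType F) (br : L -> L -> L)
    (actA : L -> A -> A) (actB : L -> B -> B) :
  (forall x a, f (actA x a) = actB x (f a)) ->
  is_Lie_module br actA -> is_Lie_module br actB.
Proof.
move=> fact [al ar ab]; split.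
- by elim/surj=> m c x y; rewrite -!fact al f_lin.
- by move=> x c; elim/surj=> u; elim/surj=> v; rewrite -f_lin -!fact ar f_lin.
- by move=> x y; elim/surj=> m; rewrite -!fact ab (linB f_lin).
Qed.

End Transport.

(** * The filtration by length and its graded space *)

(* V, act and mon stand for VR, VRact and VRmonomial, and are abstract so that
   rewriting never unfolds the tensor product. *)
Section VacuumModule.
Context (F : numFieldType) (R : vertexLie F) (V : lmodType F).
Context (Y : V -> int -> V -> V) (vac : V) (hY : is_vertex_algebra Y vac).
Context (act : LR R -> V -> V) (act_lin : forall x, linear (act x)).
Context (act_linl : forall v, linear (act^~ v)).
Context (act_br : forall x y v, act x (act y v) - act y (act x v) = act (Lbr x y) v).
Context (Y_act : forall a n v, Y (act (Lmode a (-1)) vac) n v = act (Lmode a n) v).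
Context (V_ind : forall P : V -> Prop, P 0 ->
  (forall c w v, P v -> P (c *: foldr act vac w + v)) -> forall v, P v).
Context (mon : seq R -> V) (mon_nil : mon [::] = vac).
Context (mon_cons : forall a s, mon (a :: s) = act (Lmode a (-1)) (mon s)).
Context (E : int -> subspace V).
Context (E_mon : forall n s, (Posz (size s) <= n)%R -> mon s \in E n).
Context (E_ind : forall n (P : V -> Prop), P 0 ->
  (forall c s v, (Posz (size s) <= n)%R -> P v -> P (c *: mon s + v)) ->
  forall v, v \in E n -> P v).
Local Notation pr := (@vl_pr F R).
Local Notation Lmode := (@Lmode F R).
Local Notation D := (fun v => Y v (-2) vac).

Let linl n v : linear (fun u => Y u n v) := va_linl hY n v.
Let linr u n : linear (Y u n) := va_linr hY u n.

Lemma filt_incr m n : (m <= n)%R -> {subset E m <= E n}.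
Proof.
move=> mn v; elim/E_ind=> [|c s u sm uE]; first exact: rpred0.
by rewrite rpredD ?rpredZ // E_mon // (le_trans sm).
Qed.

Lemma filt_monD n (f : V -> V) m : linear f ->
  (forall s, (Posz (size s) <= n)%R -> f (mon s) \in E m) ->
  forall v, v \in E n -> f v \in E m.
Proof.
move=> fl fm v; elim/E_ind=> [|c s u sn uE]; first by rewrite lin0 // rpred0.
by rewrite fl rpredD ?rpredZ // fm.
Qed.

Lemma act_N1_filt a n v : v \in E n -> act (Lmode a (-1)) v \in E (n + 1).
Proof.
apply: filt_monD => // s sn; rewrite -mon_cons E_mon //=.
by rewrite -addn1 PoszD lerD2r.
Qed.

Lemma act_Negz_filt a k n v : v \in E n -> act (Lmode a (Negz k)) v \in E (n + 1).
Proof. by rewrite Lmode_Negz; apply: act_N1_filt. Qed.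

Let vac_filt : vac \in E 0.
Proof. by rewrite -mon_nil E_mon. Qed.

(** In the bracket of a(k) and b(-1) the summand i = k has mode -1, those with i < k have the
    nonnegative modes k - 1 - i, and binom(k, i) = 0 for i > k. So L(R)_+ passes a letter at the
    cost of a monomial of the same length and of further elements of L(R)_+ acting on a shorter
    one. *)
Lemma act_comm_N1 a (k : nat) b v : act (Lmode a k%:Z) (act (Lmode b (-1)) v) =
  act (Lmode b (-1)) (act (Lmode a k%:Z) v) + act (Lmode (pr a k b) (-1)) v +
  \sum_(i < k) 'C(k, i)%:R *: act (Lmode (pr a i b) ((k - i.+1)%N%:Z)) v.
Proof.
have [N abN] := pr_trunc a b; pose M := maxn N k.+1.
have /esym/eqP := act_br (Lmode a k%:Z) (Lmode b (-1)) v; rewrite Lbr_mode.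
rewrite (@mode_brE _ _ M) => [|i]; last by rewrite geq_max => /andP[/abN].
rewrite (lin_sum (act_linl v)) -subr_eq opprK => /eqP <-.
rewrite addrC -addrA; congr (_ + _).
rewrite (big_ord_widen_cond M xpredT
  (fun i => 'C(k, i)%:R *: act (Lmode (pr a i b) ((k - i.+1)%N%:Z)) v)); last first.
  by rewrite leq_max leqnSn orbT.
pose T i := binz F k%:Z i *: act (Lmode (pr a i b) (k%:Z + -1 - i%:Z)) v.
transitivity (\sum_(i < M) T i).
  by apply: eq_bigr => i _; rewrite (linZ (act_linl v)).
have kM : (k < M)%N by rewrite leq_max ltnSn orbT.
rewrite (bigD1 (Ordinal kM)) //= {1}/T binz_nat binn scale1r.
congr (act (Lmode _ _) _ + _); first by lia.
rewrite big_mkcond [RHS]big_mkcond; apply: eq_bigr => i _ /=.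
rewrite -val_eqE /= /T binz_nat; case: ltngtP => //= [ik|ki].
  by congr (_ *: act (Lmode _ _) _); lia.
by rewrite bin_small // scale0r.
Qed.

Lemma act_nneg_mon s a (k : nat) : act (Lmode a k%:Z) (mon s) \in E (size s)%:Z.
Proof.
elim: s a k => [|b s IHs] a k.
  by rewrite mon_nil -Y_act (va_creation hY) // rpred0.
rewrite mon_cons act_comm_N1 /= -addn1 PoszD; apply: rpredD; first apply: rpredD.
- exact/act_N1_filt/IHs.
- exact/act_N1_filt/E_mon.
apply: rpred_sum => i _; apply: rpredZ; apply: filt_incr (IHs _ _).
by rewrite lerDl.
Qed.

Lemma act_nneg_filt a (k : nat) n v : v \in E n -> act (Lmode a k%:Z) v \in E n.
Proof.
by apply: filt_monD => // s sn; apply: filt_incr sn _ (act_nneg_mon s a k).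
Qed.

Lemma act_mode_filt a k n v : v \in E n -> act (Lmode a k) v \in E (n + 1).
Proof.
case: k => k vE; last exact: act_Negz_filt.
by apply: filt_incr (act_nneg_filt a k vE); rewrite lerDl.
Qed.

Lemma act_filt x n v : v \in E n -> act x v \in E (n + 1).
Proof.
move=> vE; elim/LR_ind: x => [|x y xE yE|a k]; last exact: act_mode_filt.
  by rewrite (lin0 (act_linl v)) rpred0.
by rewrite (linD (act_linl v)) rpredD.
Qed.

Lemma act_plus_filt x n v : x \in Lplus_sub R -> v \in E n -> act x v \in E n.
Proof.
move=> xL vE; elim/span_ind: xL => [|c y z [a [k ->]] zE].
  by rewrite (lin0 (act_linl v)) rpred0.
by rewrite (linP (act_linl v)) rpredD ?rpredZ // act_nneg_filt.
Qed.

Lemma filt_exhaust v : exists n, v \in E n.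
Proof.
have word w : foldr act vac w \in E (size w)%:Z.
  by elim: w => //= x w IHw; rewrite -addn1 PoszD; apply: act_filt.
elim/V_ind: v => [|c w v [n vE]]; first by exists 0; apply: rpred0.
exists (Num.max (size w)%:Z n); rewrite rpredD ?rpredZ //.
  by apply: filt_incr (word w); rewrite le_max lexx.
by apply: filt_incr vE; rewrite le_max lexx orbT.
Qed.

(** The boolean is the extra drop by one for j >= 0. Both signs of j are treated together, since
    [va_assoc] for the word a :: s involves the modes j + i and j - 1 - i of [mon s]. In the first
    summand a mode of a costs the one degree that the new letter provides; in the second one a_i
    with i >= 0 costs none, and the degree saved covers the drop. *)
Lemma Y_mon_filt s n v j : v \in E n ->
  Y (mon s) j v \in E ((size s)%:Z + n - (0 <= j)%R%:Z).
Proof.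
elim: s n v j => [|a s IHs] n v j vE.
  rewrite mon_nil (va_vac hY); case: eqP => [->|_]; last exact: rpred0.
  by rewrite add0r subr0.
have [N1 sN] := va_trunc_nat hY (mon s) j v.
have [N2 aN] := va_trunc_nat0 hY (act (Lmode a (-1)) vac) v.
pose N := maxn N1 N2; rewrite mon_cons -Y_act.
rewrite (@va_assoc _ _ _ _ hY N) => [|i|i]; last 2 first.
- by rewrite geq_max => /andP[/sN].
- by rewrite geq_max => /andP[_ /aN].
apply: rpred_sum => i _; rewrite !Y_act /= -addn1 PoszD; apply: rpredD.
  have := act_mode_filt a (-1 - i%:Z) (IHs n v (j + i%:Z) vE).
  by apply: filt_incr; case: (lerP 0 j) => j0; case: (lerP 0 (j + _)) => ji; lia.
have := IHs n _ (j - 1 - i%:Z) (act_nneg_filt a i vE).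
by apply: filt_incr; case: (lerP 0 j) => j0; case: lerP => ji; lia.
Qed.

Lemma Y_filt m n u v j : u \in E m -> v \in E n ->
  Y u j v \in E (m + n - (0 <= j)%R%:Z).
Proof.
move=> uE vE; move: u uE; apply: (filt_monD (f := fun u => Y u j v)) => // s sm.
by apply: filt_incr (Y_mon_filt s j vE); rewrite lerD2r lerD2r.
Qed.

Lemma filt_good : good_filtration Y vac E.
Proof.
split.
- exact: filt_incr.
- exact: filt_exhaust.
- exact: vac_filt.
- move=> m n u v j uE vE j0; have := Y_filt j uE vE.
  by rewrite leNgt j0 subr0.
- move=> m n u v j uE vE j0; have := Y_filt j uE vE.
  by rewrite j0.
Qed.

Lemma mon_lin : multilinear mon.
Proof.
move=> c w0 w1 w2; elim=> [x y v|z ? ? ? _ IH]; rewrite !mon_cons.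
  by rewrite (linP (@Lmode_lin F R (-1))) (linP (act_linl _)).
by rewrite IH (linP (act_lin _)).
Qed.

Local Notation cls := (gr_class E).

Lemma mon_class_lin : multilinear (fun s => cls (size s)%:Z (mon s)).
Proof.
move=> c w0 w1 w2 l3; have [s1 s2] := lin3_size l3.
by rewrite s1 s2 (mon_lin l3) gr_class_lin // E_mon ?s1 ?s2.
Qed.

Lemma cls_eq n u v : u \in E n -> v \in E n -> u - v \in E (n - 1) -> cls n u = cls n v.
Proof.
move=> uE vE uv; have := gr_class_lin 1 (rpredB uE vE) vE.
rewrite !scale1r subrK => ->.
have -> : cls n (u - v) = 0 by apply/(gr_class_eq0 (rpredB uE vE)).
exact: add0r.
Qed.

(** The commutator of x(-1) and y(-1) is a single element of L(R), which raises the degree by at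
    most one, where the two letters together may raise it by two. *)
Lemma mon_swap_filt u x y v : mon (u ++ x :: y :: v) - mon (u ++ y :: x :: v)
  \in E ((size u + size v).+1)%:Z.
Proof.
elim: u => [|a u IHu] /=.
  rewrite !mon_cons act_br -addn1 PoszD; exact/act_filt/E_mon.
rewrite !mon_cons -(linB (act_lin _)) -addn1 PoszD.
exact: act_N1_filt.
Qed.

Lemma mon_class_swap u x y v :
  cls (size (u ++ x :: y :: v))%:Z (mon (u ++ x :: y :: v)) =
  cls (size (u ++ y :: x :: v))%:Z (mon (u ++ y :: x :: v)).
Proof.
have -> : size (u ++ y :: x :: v) = size (u ++ x :: y :: v) by rewrite !size_cat.
apply: cls_eq; rewrite ?E_mon ?size_cat //.
by apply: filt_incr (mon_swap_filt u x y v); rewrite /=; lia.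
Qed.

(** Of the associativity formula only a_(-1) applied to the product for the shorter word reaches the
    top degree: for i > 0 the mode -1 + i of [mon s] is nonnegative and loses a degree, and the
    terms with a_i, i >= 0, lack the degree of a. *)
Lemma Y_mon_cat s t :
  Y (mon s) (-1) (mon t) - mon (s ++ t) \in E ((size s)%:Z + (size t)%:Z - 1).
Proof.
elim: s => [|a s IHs]; first by rewrite mon_nil (va_vac hY) eqxx subrr rpred0.
have [N1 sN] := va_trunc_nat hY (mon s) (-1) (mon t).
have [N2 aN] := va_trunc_nat0 hY (act (Lmode a (-1)) vac) (mon t).
pose N := maxn N1 N2; rewrite [mon (a :: s)]mon_cons -Y_act.
(* One term more than needed, so that the summand i = 0 can be split off. *)
rewrite (@va_assoc _ _ _ _ hY N.+1) => [|i|i]; last 2 first.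
- by move=> /ltnW; rewrite geq_max => /andP[/sN].
- by move=> /ltnW; rewrite geq_max => /andP[_ /aN].
have tE : mon t \in E (size t)%:Z by rewrite E_mon.
rewrite big_ord_recl /= !Y_act subr0 addr0 mon_cons addrAC.
rewrite [X in X + _]addrAC -(linB (act_lin _)) -addn1 PoszD.
apply: rpredD; last first.
  apply: rpred_sum => i _; rewrite !Y_act; apply: rpredD.
    have := act_mode_filt a (-1 - (bump 0 i)%:Z) (Y_mon_filt s (-1 + (bump 0 i)%:Z) tE).
    by apply: filt_incr; rewrite /bump; case: lerP => ji; lia.
  have := Y_mon_filt s (-1 - 1 - (bump 0 i)%:Z) (act_nneg_filt a (bump 0 i) tE).
  by apply: filt_incr; rewrite /bump; case: lerP => ji; lia.
apply: rpredD; first by have := act_N1_filt a IHs; apply: filt_incr; lia.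
have := Y_mon_filt s (-1 - 1 - 0%:Z) (act_nneg_filt a 0 tE).
by apply: filt_incr; case: lerP => ji; lia.
Qed.

(** * The symbol map psi, its inverse, and products on the graded space *)

Section Symbols.
Context (S : algType F) (gen : R -> S) (gen_lin : linear gen).
Context (S_ind : forall P : S -> Prop, P 0 ->
  (forall c s u, P u -> P (c *: \prod_(a <- s) gen a + u)) -> forall u, P u).
Context (psi : S -> gr E) (psi_lin : linear psi).
Context (psi_word : forall s, psi (\prod_(a <- s) gen a) = cls (size s)%:Z (mon s)).
Context (G : nat -> V -> S) (G_lin : forall n, linear (G n)).
Context (G_mon : forall n s, (size s <= n)%N ->
  G n (mon s) = if size s == n then \prod_(a <- s) gen a else 0).

Let Gz (n : int) : V -> S := if n is Posz k then G k else fun=> 0.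

Let Gz_lin n : linear (Gz n).
Proof. by case: n => n c u v; [exact: G_lin | rewrite scaler0 addr0]. Qed.

Let Gz_ker n v : v \in E (n - 1) -> Gz n v = 0.
Proof.
case: n => // n; elim/E_ind=> [|c s u sn IH]; first exact: (lin0 (G_lin n)).
rewrite (linP (Gz_lin n)) IH addr0 /= G_mon; last by lia.
by rewrite ifN ?scaler0 //; apply/eqP; lia.
Qed.

Let Gphi n (x : gr_piece E n) : S := Gz n (\val (repr x)).

Let Gphi_lin n : linear (@Gphi n).
Proof. by apply: piece_lift_lin => [c u v _ _|v]; [exact: Gz_lin | exact: Gz_ker]. Qed.

(** On the piece of degree n this is the degree n part of the leading term, which vanishes on E (n -
    1); the pieces of negative degree, where E is zero, are sent to 0. *)
Definition sym_inv (x : gr E) : S := @dlift F int (gr_piece E) S Gphi x.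

Lemma sym_inv_lin : linear sym_inv.
Proof. exact: (@dlift_lin F int (gr_piece E) S Gphi Gphi_lin). Qed.

Lemma sym_inv_class n v : v \in E n -> sym_inv (cls n v) = Gz n v.
Proof.
move=> vE.
transitivity (Gphi (qclass (restr_sub (E n) (E (n - 1))) (insubd 0 v))).
  exact: (@dlift_dinj F int (gr_piece E) S Gphi Gphi_lin).
by apply: piece_liftE => [c u w _ _|w|//]; [exact: Gz_lin | exact: Gz_ker].
Qed.

Lemma linear_S_ext (W : lmodType F) (f g : S -> W) : linear f -> linear g ->
  (forall s, f (\prod_(a <- s) gen a) = g (\prod_(a <- s) gen a)) -> f =1 g.
Proof.
move=> fl gl fg; elim/S_ind=> [|c s u IHu]; first by rewrite !lin0.
by rewrite fl gl fg IHu.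
Qed.

Lemma psiK : cancel psi sym_inv.
Proof.
apply: linear_S_ext => [|//|s]; first exact: linear_comp sym_inv_lin psi_lin.
by rewrite psi_word sym_inv_class ?E_mon //= G_mon ?eqxx.
Qed.

Lemma sym_invK : cancel sym_inv psi.
Proof.
apply: linear_gr_ext => [|//|n v]; first exact: linear_comp psi_lin sym_inv_lin.
have clsl c s u : (Posz (size s) <= n)%R -> u \in E n ->
    cls n (c *: mon s + u) = c *: cls n (mon s) + cls n u.
  by move=> sn uE; rewrite gr_class_lin // E_mon.
(* Membership is put into the conclusion because the induction principle of E n does not retain it,
   while classes are additive only on E n. *)
suff H : v \in E n -> v \in E n /\ psi (sym_inv (cls n v)) = cls n v by case/H.
elim/E_ind=> [|c s u sn [uE IHu]].
  rewrite rpred0; split=> //.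
  have -> : cls n 0 = 0 by apply/(gr_class_eq0 (rpred0 _)); apply: rpred0.
  by rewrite (lin0 sym_inv_lin) (lin0 psi_lin).
split; first by rewrite rpredD ?rpredZ ?E_mon.
rewrite clsl // (linP sym_inv_lin) (linP psi_lin) IHu; congr (_ *: _ + _).
have [sE|sN] := eqVneq (Posz (size s)) n.
  by rewrite -sE -psi_word psiK.
have -> : cls n (mon s) = 0.
  by apply/(gr_class_eq0 (E_mon sn)); rewrite E_mon //; lia.
by rewrite (lin0 sym_inv_lin) (lin0 psi_lin).
Qed.

Local Notation mulg := (gr_map2 (E := E) (fun u v => Y u (-1) v) 0).
Local Notation dg := (gr_map (E := E) D).
Local Notation prg i := (gr_map2 (E := E) (fun u v => Y u (Posz i) v) (-1)).

Let mul_filt m n u v : u \in E m -> v \in E n -> Y u (-1) v \in E (m + n + 0).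
Proof. by move=> uE vE; have := Y_filt (-1) uE vE; apply: filt_incr; lia. Qed.

Let pr_filt i m n u v : u \in E m -> v \in E n -> Y u (Posz i) v \in E (m + n + -1).
Proof. by move=> uE vE; have := Y_filt (Posz i) uE vE. Qed.

Let D_filt n v : v \in E n -> D v \in E n.
Proof. by move=> vE; have := Y_filt (-2) vE vac_filt; apply: filt_incr; lia. Qed.

Let mulgl y : linear (mulg^~ y) := gr_map2_linl filt_incr (linl (-1)) mul_filt y.
Let mulgr x : linear (mulg x) :=
  gr_map2_linr filt_incr (fun u => linr u (-1)) mul_filt x.
Let mulg_cls m n u v (uE : u \in E m) (vE : v \in E n) :
  mulg (cls m u) (cls n v) = cls (m + n + 0) (Y u (-1) v) :=
  gr_map2_class filt_incr (linl (-1)) (fun u => linr u (-1)) mul_filt uE vE.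
Let prgl i y : linear ((prg i)^~ y) := gr_map2_linl filt_incr (linl i) (@pr_filt i) y.
Let prgr i x : linear (prg i x) :=
  gr_map2_linr filt_incr (fun u => linr u i) (@pr_filt i) x.
Let prg_cls i m n u v (uE : u \in E m) (vE : v \in E n) :
  prg i (cls m u) (cls n v) = cls (m + n + -1) (Y u (Posz i) v) :=
  gr_map2_class filt_incr (linl i) (fun u => linr u i) (@pr_filt i) uE vE.
Let dg_lin : linear dg := gr_map_lin filt_incr (linl (-2) vac) D_filt.
Let dg_cls n v (vE : v \in E n) : dg (cls n v) = cls n (D v) :=
  gr_map_class filt_incr (linl (-2) vac) D_filt vE.

Lemma psi_one : psi 1 = cls 0 vac.
Proof. by have := psi_word [::]; rewrite big_nil mon_nil. Qed.

Lemma psi_mul s t : psi (s * t) = mulg (psi s) (psi t).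
Proof.
move: s; apply: linear_S_ext => [c a b|c a b|s].
- by rewrite mulrDl -scalerAl psi_lin.
- by rewrite psi_lin mulgl.
move: t; apply: linear_S_ext => [c a b|c a b|t].
- by rewrite mulrDr -scalerAr psi_lin.
- by rewrite psi_lin mulgr.
rewrite -big_cat /= !psi_word mulg_cls ?E_mon // size_cat PoszD addr0.
symmetry; apply: cls_eq; last exact: Y_mon_cat.
- by rewrite -[_ + _]addr0 mul_filt ?E_mon.
- by rewrite E_mon // size_cat.
Qed.

Lemma psi_gen a : psi (gen a) = cls 1 (act (Lmode a (-1)) vac).
Proof. by have := psi_word [:: a]; rewrite big_seq1 mon_cons mon_nil. Qed.

Let gen_filt a : act (Lmode a (-1)) vac \in E 1.
Proof. by rewrite -mon_nil -mon_cons E_mon. Qed.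

Lemma mulg_gen a n v : v \in E n ->
  mulg (psi (gen a)) (cls n v) = cls (n + 1) (act (Lmode a (-1)) v).
Proof. by move=> vE; rewrite psi_gen mulg_cls // Y_act addr0 addrC. Qed.

Lemma prg_gen a i n v : v \in E n ->
  prg i (psi (gen a)) (cls n v) = cls n (act (Lmode a i%:Z) v).
Proof. by move=> vE; rewrite psi_gen prg_cls // Y_act addrAC subrr add0r. Qed.

(** In the commutator of u_i and v_(-1) the summand j = i is (u_i v)_(-1), and those with j > i have
    coefficient 0. For j < i both products, u_j v and its mode i - 1 - j on w, are nonnegative, so
    two degrees are lost instead of one and the class is zero. *)
Lemma prg_derivation i x y z :
  prg i x (mulg y z) = mulg (prg i x y) z + mulg y (prg i x z).
Proof.
move: x; apply: (linear_gr_ext (g := fun x => mulg (prg i x y) z + mulg y (prg i x z)))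
  => [c a b|c a b|m u uE].
- exact: prgl.
- by rewrite !prgl mulgl mulgr scalerDr addrACA.
move: y; apply: (linear_gr_ext
  (g := fun y => mulg (prg i (cls m u) y) z + mulg y (prg i (cls m u) z))) => [c a b|c a b|n v vE].
- by rewrite mulgl prgr.
- by rewrite prgr !mulgl scalerDr addrACA.
move: z; apply: (linear_gr_ext
  (g := fun z => mulg (prg i (cls m u) (cls n v)) z + mulg (cls n v) (prg i (cls m u) z)))
  => [c a b|c a b|p w wE].
- by rewrite mulgr prgr.
- by rewrite prgr !mulgr scalerDr addrACA.
rewrite !(mulg_cls, prg_cls) ?mul_filt ?pr_filt //.
have -> : m + (n + p + 0) + -1 = m + n + p + -1 by lia.
have -> : m + n + -1 + p + 0 = m + n + p + -1 by lia.
have -> : n + (m + p + -1) + 0 = m + n + p + -1 by lia.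
have E1 : Y (Y u i v) (-1) w \in E (m + n + p + -1).
  by have := mul_filt (pr_filt i uE vE) wE; apply: filt_incr; lia.
have E2 : Y v (-1) (Y u i w) \in E (m + n + p + -1).
  by have := mul_filt vE (pr_filt i uE wE); apply: filt_incr; lia.
have E3 : Y u i (Y v (-1) w) \in E (m + n + p + -1).
  by have := pr_filt i uE (mul_filt vE wE); apply: filt_incr; lia.
have := gr_class_lin 1 E1 E2; rewrite !scale1r => <-.
apply: cls_eq => //; first exact: rpredD.
rewrite [_ + Y v _ _]addrC opprD addrA.
have [N uv] := va_trunc_nat0 hY u v; pose M := maxn N i.+1.
rewrite (@va_comm _ _ _ _ hY M) => [|j]; last by rewrite geq_max => /andP[/uv].
have iM : (i < M)%N by rewrite leq_max ltnSn orbT.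
rewrite (bigD1 (Ordinal iM)) //= binz_nat binn scale1r.
rewrite (_ : i%:Z + -1 - i%:Z = -1); last by lia.
rewrite addrAC subrr add0r.
apply: rpred_sum => j; rewrite -val_eqE /= => ji; rewrite binz_nat.
case: (ltngtP j i) ji => // [ji _|ij _]; last by rewrite bin_small // scale0r rpred0.
apply: rpredZ; have := Y_filt (i%:Z + -1 - j%:Z) (pr_filt j uE vE) wE.
by apply: filt_incr; case: lerP => h; lia.
Qed.

(** * Compatibility of psi with d, the products a_n b and the action of L(R)_+ *)

Section PoissonStructure.
Context (dS : S -> S) (prS : S -> nat -> S -> S).
Context (hS : is_vertex_Poisson (VertexPoissonOps *%R 1 dS prS)).
Context (hdS : forall a : R, dS (gen a) = gen (vl_d a)).
Context (hprS : forall (a : R) (n : nat) (b : R),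
  prS (gen a) n (gen b) = gen (pr a n b)).

Let dS_lin : linear dS := proj1 (vp_d_der hS).
Let dS_mul a b : dS (a * b) = dS a * b + a * dS b := proj2 (vp_d_der hS) a b.
Let prS_linr a n : linear (prS a n) := proj1 (vp_pr_der hS a n).
Let prS_linl n b : linear (fun a => prS a n b) := vl_linl (vp_Lie hS) n b.
Let prS_mul u n a b : prS u n (a * b) = prS u n a * b + a * prS u n b :=
  proj2 (vp_pr_der hS u n) a b.

Let der1 (f : S -> S) : (forall a b, f (a * b) = f a * b + a * f b) -> f 1 = 0.
Proof.
move=> /(_ 1 1)/eqP; rewrite !mulr1 mul1r -[X in X == _]addr0.
by rewrite (inj_eq (addrI _)) eq_sym => /eqP.
Qed.

Lemma psi_d u : psi (dS u) = dg (psi u).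
Proof.
move: u; apply: linear_S_ext => [||s].
- exact: linear_comp psi_lin dS_lin.
- exact: linear_comp dg_lin psi_lin.
rewrite psi_word dg_cls ?E_mon //; elim: s => [|a s IHs].
  rewrite big_nil der1 // (lin0 psi_lin) mon_nil; symmetry.
  rewrite (va_vac hY); apply/gr_class_eq0; exact: rpred0.
have sE : mon s \in E (size s)%:Z by rewrite E_mon.
rewrite big_cons dS_mul (linD psi_lin) !psi_mul hdS psi_word IHs !mulg_gen ?D_filt //.
rewrite mon_cons -[act (Lmode a (-1)) (mon s)]Y_act (va_D_derivation hY).
rewrite (va_D_mode hY) !Y_act opprK scale1r.
rewrite (_ : (size (a :: s))%:Z = (size s)%:Z + 1); last by rewrite /=; lia.
have := gr_class_lin 1 (act_N1_filt (vl_d a) sE) (act_N1_filt a (D_filt sE)).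
by rewrite !scale1r => <-; rewrite Lmode_d opprK scale1r.
Qed.

(** Both sides are derivations in t, relative to psi, so their values on 1 and on generators
    determine them. *)
Lemma psi_pr_ext u n :
  (forall b, psi (prS u n (gen b)) = prg n (psi u) (psi (gen b))) ->
  prg n (psi u) (psi 1) = 0 ->
  forall t, psi (prS u n t) = prg n (psi u) (psi t).
Proof.
move=> ug u1; apply: linear_S_ext => [||s].
- exact: linear_comp psi_lin (prS_linr u n).
- exact: linear_comp (prgr n (psi u)) psi_lin.
elim: s => [|b s IHs]; first by rewrite big_nil u1 der1 ?(lin0 psi_lin).
by rewrite big_cons prS_mul (linD psi_lin) !psi_mul ug IHs prg_derivation.
Qed.

Lemma prg1 x n : prg n x (psi 1) = 0.
Proof.
move: x; apply: (linear_gr_ext (g := fun=> 0)) => [|c a b|m u uE].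
- exact: prgl.
- by rewrite scaler0 addr0.
rewrite psi_one prg_cls ?vac_filt // (va_creation hY) //.
apply/gr_class_eq0; exact: rpred0.
Qed.

Lemma psi_pr_gen a n t : psi (prS (gen a) n t) = prg n (psi (gen a)) (psi t).
Proof.
apply: psi_pr_ext => [b|]; last exact: prg1.
rewrite hprS [psi (gen b)]psi_gen prg_gen // psi_gen; congr (cls _ _).
rewrite act_comm_N1 -[act (Lmode a _) vac]Y_act (va_creation hY) //.
rewrite (lin0 (act_lin _)) add0r big1 ?addr0 // => i _.
by rewrite -Y_act (va_creation hY) // scaler0.
Qed.

Lemma cls_sum n (I : Type) (r : seq I) (c : I -> F) (f : I -> V) :
  (forall i, f i \in E n) ->
  cls n (\sum_(i <- r) c i *: f i) = \sum_(i <- r) c i *: cls n (f i).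
Proof.
move=> fE; elim: r => [|i r IHr].
  by rewrite !big_nil; apply/gr_class_eq0; apply: rpred0.
by rewrite !big_cons gr_class_lin ?IHr // rpred_sum // => j _; rewrite rpredZ.
Qed.

Lemma iter_D_filt i n v : v \in E n -> iter i D v \in E n.
Proof. by move=> vE; elim: i => //= i; apply: D_filt. Qed.

Lemma iter_dg_cls i n v : v \in E n -> iter i dg (cls n v) = cls n (iter i D v).
Proof. by move=> vE; elim: i => //= i ->; rewrite dg_cls // iter_D_filt. Qed.

Lemma psi_iter_d i u : psi (iter i dS u) = iter i dg (psi u).
Proof. by elim: i => //= i <-; rewrite psi_d. Qed.

(** [psi_pr_ext] reduces the second argument to a generator b. Then (C2) in S and [va_skew] in V
    exchange the arguments with the same coefficients, and the first argument becomes b, the case of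
    [psi_pr_gen]. *)
Lemma psi_pr u n t : psi (prS u n t) = prg n (psi u) (psi t).
Proof.
move: u; apply: (linear_S_ext (g := fun u => prg n (psi u) (psi t))) => [c a b|c a b|s].
- by rewrite prS_linl psi_lin.
- by rewrite psi_lin prgl.
apply: psi_pr_ext => [b|]; last exact: prg1.
set u := \prod_(a <- s) gen a; have sE : mon s \in E (size s)%:Z by rewrite E_mon.
have -> : prS u n (gen b) = \sum_(i \in [set: nat])
    ((-1) ^+ (n + i + 1) / (i`!)%:R) *: iter i dS (prS (gen b) (n + i)%N u).
  exact: (vl_C2 (vp_Lie hS) u n (gen b)).
have [N1 Nu] : exists N, forall k, (N <= k)%N -> prS (gen b) k u = 0.
  exact: (vl_C0 (vp_Lie hS) (gen b) u).
have [N2 NY] := va_trunc_nat0 hY (act (Lmode b (-1)) vac) (mon s).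
pose M := maxn N1 N2.
have dS0 i : iter i dS 0 = 0 by elim: i => //= i ->; rewrite (lin0 dS_lin).
rewrite (@fsbig_nat_trunc _ _ M) => [|i]; last first.
  rewrite geq_max => /andP[N1i _]; rewrite Nu ?dS0 ?scaler0 //.
  exact: leq_trans N1i (leq_addl _ _).
rewrite (lin_sum psi_lin) psi_gen psi_word prg_cls ?gen_filt //.
rewrite (@va_skew _ _ _ _ hY M (act (Lmode b (-1)) vac)) => [|i]; last first.
  by rewrite geq_max => /andP[_ N2i]; rewrite NY // (leq_trans N2i) ?leq_addl.
rewrite addrK cls_sum => [|i]; last by apply: iter_D_filt; rewrite Y_act act_nneg_filt.
apply: eq_bigr => i _; rewrite (linZ psi_lin) psi_iter_d psi_pr_gen psi_word.
by rewrite prg_gen // iter_dg_cls ?act_nneg_filt // Y_act.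
Qed.

Context (actS : Lplus R -> S -> S).
Context (actS_linl : forall u, linear (fun x => actS x u)).
Context (actS_der : forall x, is_derivation *%R (actS x)).
Context (actS_gen : forall a n b, actS (Lpmode a n) (gen b) = gen (pr a n b)).

Lemma Lplus_ind (P : Lplus R -> Prop) : P 0 ->
  (forall c a n x, P x -> P (c *: Lpmode a n + x)) -> forall x, P x.
Proof.
move=> P0 PS x.
(* The span lives in L(R): the induction builds an element of the subtype with the same value as
   x. *)
suff [y yx Py] : exists2 y : Lplus R, \val y = \val x & P y by rewrite -(val_inj yx).
elim/span_ind: (valP x) => [|c u v [a [n ->]] [y yv Py]]; first by exists 0.
by exists (c *: Lpmode a n + y); [rewrite -yv | apply: PS].
Qed.

(** Two derivations with the same values on generators. It reduces equivariance of psi to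
    [psi_pr_gen]. *)
Lemma actS_mode a n u : actS (Lpmode a n) u = prS (gen a) n u.
Proof.
have [al ad] := actS_der (Lpmode a n).
move: u; apply: linear_S_ext => [//|//|s].
elim: s => [|b s IHs]; first by rewrite big_nil !der1.
by rewrite big_cons ad prS_mul IHs actS_gen hprS.
Qed.

Lemma gr_act_lincomb c (x y : Lplus R) w :
  gr_map (act (\val (c *: x + y))) w =
  c *: gr_map (act (\val x)) w + gr_map (E := E) (act (\val y)) w.
Proof.
have El (z : Lplus R) : linear (gr_map (E := E) (act (\val z))).
  by apply: (gr_map_lin filt_incr) => // n v; apply/act_plus_filt/valP.
move: w; apply: linear_gr_ext => [//||n v vE].
  exact: linear_lincomb.
rewrite !(gr_map_class filt_incr) // => [|m u|m u|m u];
  try exact/act_plus_filt/valP.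
by rewrite -gr_class_lin ?act_plus_filt ?(valP x) ?(valP y) // -(linP (act_linl v)).
Qed.

Lemma psi_act x u : psi (actS x u) = gr_map (act (\val x)) (psi u).
Proof.
elim/Lplus_ind: x => [|c a n x IHx].
  rewrite (lin0 (actS_linl u)) (lin0 psi_lin).
  have := gr_act_lincomb (-1) 0 0 (psi u).
  by rewrite scaler0 addr0 scaleN1r addNr.
rewrite (linP (actS_linl u)) (linP psi_lin) gr_act_lincomb IHx actS_mode psi_pr_gen.
congr (_ *: _ + _); move: (psi u).
apply: (linear_gr_ext (f := prg n (psi (gen a)))) => [||m v vE].
- exact: prgr.
- by apply: (gr_map_lin filt_incr) => // k v; apply: act_nneg_filt.
by rewrite prg_gen // (gr_map_class filt_incr) // => k w; apply: act_nneg_filt.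
Qed.

Lemma psi_vertex_Poisson_iso :
  vertex_Poisson_iso (VertexPoissonOps *%R 1 dS prS) (gr_ops E Y vac) psi.
Proof.
split; [exact: hS | | by exists sym_inv; [exact: psiK | exact: sym_invK] |].
  apply: (vertex_Poisson_transport (Q := gr_ops E Y vac) psi_lin sym_invK _ _ _ _ hS).
  - exact: psi_one.
  - exact: psi_mul.
  - exact: psi_d.
  - exact: psi_pr.
split.
- exact: psi_lin.
- exact: psi_one.
- exact: psi_mul.
- exact: psi_d.
- exact: psi_pr.
Qed.

Context (actS_mod : is_Lie_module (@Lpbr F R) actS).

Lemma psi_Lie_module_iso :
  Lie_module_iso (@Lpbr F R) actS (fun x => gr_map (E := E) (act (\val x))) psi.
Proof.
split=> //; last exact: psi_act.
  exact: (Lie_module_transport psi_lin sym_invK psi_act actS_mod).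
by exists sym_inv; [exact: psiK | exact: sym_invK].
Qed.

End PoissonStructure.

End Symbols.

(** S(R) enters through two properties: words in the generators span it, and a symmetric multilinear
    function on words extends to it linearly. The extension yields psi; the degree n parts of Phi
    yield its inverse. *)
Lemma vacuum_module_gr (S : algType F) (gen : R -> S) (Phi : V -> S)
    (comp : nat -> S -> S) (dS : S -> S) (prS : S -> nat -> S -> S)
    (actS : Lplus R -> S -> S) :
  (forall P : S -> Prop, P 0 ->
    (forall c s u, P u -> P (c *: \prod_(a <- s) gen a + u)) -> forall u, P u) ->
  (forall h : seq R -> gr E, multilinear h ->
    (forall u x y v, h (u ++ x :: y :: v) = h (u ++ y :: x :: v)) ->
    exists psi : S -> gr E,
      linear psi /\ forall s, psi (\prod_(a <- s) gen a) = h s) ->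
  linear Phi -> (forall n, linear (comp n)) ->
  (forall n s, (size s <= n)%N -> comp n (Phi (mon s)) =
    if size s == n then \prod_(a <- s) gen a else 0) ->
  is_vertex_Poisson (VertexPoissonOps *%R 1 dS prS) ->
  (forall a, dS (gen a) = gen (vl_d a)) ->
  (forall a n b, prS (gen a) n (gen b) = gen (pr a n b)) ->
  is_Lie_module (@Lpbr F R) actS -> (forall x, is_derivation *%R (actS x)) ->
  (forall a n b, actS (Lpmode a n) (gen b) = gen (pr a n b)) ->
  exists psi : {linear S -> gr E},
    [/\ forall s, psi (\prod_(a <- s) gen a) = gr_class E (size s)%:Z (mon s),
        vertex_Poisson_iso (VertexPoissonOps *%R 1 dS prS) (gr_ops E Y vac) psi &
        Lie_module_iso (@Lpbr F R) actS
          (fun x => gr_map (E := E) (act (\val x))) psi].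
Proof.
move=> S_ind S_lift Phil compl PhiE hS hdS hprS actS_mod actS_der actS_gen.
have [psi [psil psiE]] := S_lift _ mon_class_lin mon_class_swap.
pose psi_isl := GRing.isLinear.Build F S (gr E) *:%R psi psil.
pose psiL : {linear S -> gr E} := HB.pack psi psi_isl.
have Gl n : linear (fun v => comp n (Phi v)).
  exact: linear_comp (compl n) Phil.
exists psiL; split; first exact: psiE.
  exact: (psi_vertex_Poisson_iso S_ind psil psiE Gl PhiE hS hdS hprS).
have [actl _ _] := actS_mod.
exact: (psi_Lie_module_iso S_ind psil psiE Gl PhiE hS hprS actl
  actS_der actS_gen actS_mod).
Qed.

End VacuumModule.

(** * The case of V(R) and S(R) *)

Section InducedFiltration.
Context (F : numFieldType) (R : vertexLie F).
Context (Y : VR R -> int -> VR R -> VR R).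
Context (hY : is_vertex_algebra Y (VRvac R)).
Context (hYR : forall (a : R) (n : int) (v : VR R),
  Y (VRembed a) n v = VRact (Lmode a n) v).
Local Notation E := (@VRfilt F R).
Local Notation act := (@VRact F R).
Local Notation vac := (VRvac R).
Local Notation mon := (@VRmonomial F R).

Let mon_cons a s : mon (a :: s) = act (Lmode a (-1)) (mon s). Proof. exact: erefl. Qed.

Let E_mon n s : (Posz (size s) <= n)%R -> mon s \in E n.
Proof. by move=> sn; apply: mem_span; exists s. Qed.

Let E_ind n (P : VR R -> Prop) : P 0 ->
  (forall c s v, (Posz (size s) <= n)%R -> P v -> P (c *: mon s + v)) ->
  forall v, v \in E n -> P v.
Proof.
move=> P0 PS; apply: span_ind => // c u v [s sn ->] Pv; exact: PS.
Qed.

Lemma VRfilt_good : good_filtration Y vac E.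
Proof.
exact: (@filt_good F R (VR R) Y vac hY act (@VRact_lin F R) (@VRact_linl F R)
  (@VRact_br F R) hYR (@VR_ind F R) mon erefl mon_cons E E_mon E_ind).
Qed.

Lemma VRfilt_Lplus n (x : Lplus R) v : v \in E n -> act (\val x) v \in E n.
Proof.
exact: (@act_plus_filt F R (VR R) Y vac hY act (@VRact_lin F R) (@VRact_linl F R)
  (@VRact_br F R) hYR mon erefl mon_cons E E_mon E_ind _ _ _ (valP x)).
Qed.

Let SR_lift (h : seq R -> gr E) : multilinear h ->
  (forall u x y v, h (u ++ x :: y :: v) = h (u ++ y :: x :: v)) ->
  exists psi : SR R -> gr E,
    linear psi /\ forall s, psi (\prod_(a <- s) SRgen a) = h s.
Proof.
move=> hl hs.
have hb u x y v : h (u ++ x :: y :: v) - h (u ++ y :: x :: v) = h (u ++ 0 :: v).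
  by rewrite hs subrr multilinear0.
exists (fun u : SR R => env_word_lift h u); split.
  exact: (env_word_lift_lin hl hb).
exact: (env_word_liftE hl hb).
Qed.

Context (dS : SR R -> SR R) (prS : SR R -> nat -> SR R -> SR R).
Context (hS : is_vertex_Poisson (VertexPoissonOps *%R 1 dS prS)).
Context (hdS : forall a : R, dS (SRgen a) = SRgen (vl_d a)).
Context (hprS : forall (a : R) (n : nat) (b : R),
  prS (SRgen a) n (SRgen b) = SRgen (vl_pr a n b)).
Context (actS : Lplus R -> SR R -> SR R) (hactS : is_induced_action actS).

Lemma VR_gr_iso : exists psi : {linear SR R -> gr E},
  [/\ forall s : seq R,
        psi (\prod_(a <- s) SRgen a) = gr_class E (size s)%:Z (VRmonomial s),
      vertex_Poisson_iso (VertexPoissonOps *%R 1 dS prS) (gr_ops E Y vac) psi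
    & Lie_module_iso (@Lpbr F R) actS
        (fun x => gr_map (E := E) (act (\val x))) psi].
Proof.
have [actS_mod actS_der actS_gen] := hactS.
have [Phi [Phi_lin PhiE]] := VR_top_symbol R.
exact: (@vacuum_module_gr F R (VR R) Y vac hY act (@VRact_lin F R) (@VRact_linl F R)
  (@VRact_br F R) hYR mon erefl mon_cons E E_mon E_ind (SR R) (@SRgen F R)
  Phi (@sym_comp F R) dS prS actS (@env_ind F R (fun _ _ : R => 0)) SR_lift Phi_lin
  (@sym_comp_lin F R) PhiE hS hdS hprS actS_mod actS_der actS_gen).
Qed.

End InducedFiltration.

Theorem proposition4p7 (K : realType) (R : vertexLie K[i])
    (Y : VR R -> int -> VR R -> VR R)
    (hY : is_vertex_algebra Y (VRvac R))
    (hYR : forall (a : R) (n : int) (v : VR R),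
        Y (VRembed a) n v = VRact (Lmode a n) v)
    (dS : SR R -> SR R) (prS : SR R -> nat -> SR R -> SR R)
    (hS : is_vertex_Poisson (VertexPoissonOps *%R 1 dS prS))
    (hdS : forall a : R, dS (SRgen a) = SRgen (vl_d a))
    (hprS : forall (a : R) (n : nat) (b : R),
        prS (SRgen a) n (SRgen b) = SRgen (vl_pr a n b))
    (actS : Lplus R -> SR R -> SR R)
    (hactS : is_induced_action actS) :
  let E := VRfilt R in
  let actgr (x : Lplus R) : gr E -> gr E := gr_map (VRact (\val x)) in
  [/\ good_filtration Y (VRvac R) E,
      forall (n : int) (x : Lplus R) (v : VR R),
        v \in E n -> VRact (\val x) v \in E n
    & exists psi : {linear SR R -> gr E},
        [/\ forall s : seq R,
              psi (\prod_(a <- s) SRgen a) = gr_class E (size s)%:Z (VRmonomial s),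
            vertex_Poisson_iso (VertexPoissonOps *%R 1 dS prS)
              (gr_ops E Y (VRvac R)) psi
          & Lie_module_iso (@Lpbr _ R) actS actgr psi]].
Proof.
split.
- exact: (@VRfilt_good K[i] R Y hY hYR).
- exact: (@VRfilt_Lplus K[i] R Y hY hYR).
- exact: (@VR_gr_iso K[i] R Y hY hYR dS prS hS hdS hprS actS hactS).
Qed.
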